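(* Let $p>1$, and let $F:\mathbb{R}\to[0,\infty)$ and $f_0:\mathbb{R}\times\mathbb{R}\to[0,\infty)$ satisfy (A-1), (A-2) and (A-3) (stated in the context). Then there exist $\delta>0$, a constant $C$, and a function $f\in C^1([0,\delta]\times\mathbb{R}^2)$ which satisfies the Vlasov–Poisson system $$\partial_t f+v\,\partial_x f-E\,\partial_v f=0,\qquad \rho(t,x)=\int_{\mathbb{R}}\bigl(F(v)-f(t,x,v)\bigr)\,dv,$$ $$E(t,x)=\frac12\left(\int_{-\infty}^x\rho(t,y)\,dy-\int_x^\infty\rho(t,y)\,dy\right),\qquad f(0,x,v)=f_0(x,v)$$ for $t\in[0,\delta]$, $x,v\in\mathbb{R}$, with $$|\|(F-f)(t)\||\le C\qquad\text{for all } t\in[0,\delta].$$ Moreover, $f$ is unique: any function $h\in C^1([0,\delta]\times\mathbb{R}^2)$ that satisfies $$\partial_t h+v\,\partial_x h-E_h\,\partial_v h=0,\qquad \rho_h(t,x)=\int_{\mathbb{R}}\bigl(F(v)-h(t,x,v)\bigr)\,dv,$$ $$E_h(t,x)=\frac12\left(\int_{-\infty}^x\rho_h(t,y)\,dy-\int_x^\infty\rho_h(t,y)\,dy\right),\qquad h(0,x,v)=f_0(x,v)$$ for $t\in[0,\delta]$, $x,v\in\mathbb{R}$, and for which $|\|(F-h)(t)\||$ is bounded on $[0,\delta]$ coincides with $f$.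
   Context: Notation. $R(x)=\sqrt{1+|x|^2}$ and $R^{-p}(x)=(R(x))^{-p}$. For $h:\mathbb{R}^2\to\mathbb{R}$ (a function of $(x,v)$), $\|h\|_\infty=\sup_{z\in\mathbb{R}^2}|h(z)|$. For $\sigma:\mathbb{R}\to\mathbb{R}$ (a function of $x$), $\|\sigma\|_p=\sup_{x\in\mathbb{R}}|\sigma(x)|R^p(x)$ (a weighted sup norm, not an $L^p$ norm). For a function of $(x,v)$, $\|\partial_x h\|_p=\sup_{x,v}|\partial_x h(x,v)|R^p(x)$. Put $$|\|h\||=\|h\|_\infty+\|\partial_v h\|_\infty+\|\partial_x h\|_p+\left\|\int h\,dv\right\|_p .$$ $F-f$ denotes $F(v)-f(t,x,v)$, $(F-f)(t)$ is the function $(x,v)\mapsto F(v)-f(t,x,v)$, and $(F-f_0)(x,v)=F(v)-f_0(x,v)$. Assumptions. (A-1) $f_0\in C^1(\mathbb{R}^2)$ is nonnegative with compact $v$-support (there is a bounded set of $v$ outside of which $f_0(x,v)=0$ for all $x$), and there is a constant $C$ such that for all $x,v\in\mathbb{R}$, $|(F-f_0)(x,v)|+|\partial_v(F-f_0)(x,v)|\le C R^{-p}(x)$. (A-2) $F\in C^3(\mathbb{R})$ is nonnegative and there is $W\in(0,\infty)$ such that $F(v)=0$ for $|v|>W$. (A-3) $|\|F-f_0\||$ is finite. *)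

(* Defs.v *)
From HB Require Import structures.
From mathcomp Require Import all_boot all_order all_algebra.
From mathcomp Require Import all_classical all_reals all_analysis.

Set Implicit Arguments.
Unset Strict Implicit.
Unset Printing Implicit Defensive.

Import Order.TTheory GRing.Theory Num.Theory.
Import numFieldNormedType.Exports.

Local Open Scope classical_set_scope.
Local Open Scope ring_scope.

Section VlasovPoisson.
Context {R : realType}.
Implicit Types (p : R) (h : R -> R -> R) (f : R -> R -> R -> R).

Notation mu := (@lebesgue_measure R).

Definition weight (x : R) : R := Num.sqrt (1 + `|x| ^+ 2).

Definition dx h : R -> R -> R := fun x v => derive1 (h^~ v) x.
Definition dv h : R -> R -> R := fun x v => derive1 (h x) v.

(* All norms take values in \bar R, so that "the norm is finite" is the
   statement [_ < +oo]. *)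
Definition sup_norm h : \bar R :=
  ereal_sup [set `|h z.1 z.2|%:E | z in [set: R * R]].

(* The argument is extended-real valued so that it can be applied to
   [int_v h] below; a real function s is covered by [EFin \o s]. *)
Definition wnorm p (s : R -> \bar R) : \bar R :=
  ereal_sup [set (`|s x| * (weight x `^ p)%:E)%E | x in [set: R]].

Definition wnorm2 p h : \bar R :=
  ereal_sup [set (`|h z.1 z.2| * weight z.1 `^ p)%:E | z in [set: R * R]].

(* Kept in \bar R: if h x is measurable but not integrable, the absolute value
   of this integral is +oo, hence so is its weighted norm. *)
Definition int_v h : R -> \bar R := fun x => (\int[mu]_v (h x v)%:E)%E.

Definition triple_norm p h : \bar R :=
  (sup_norm h + sup_norm (dv h) + wnorm2 p (dx h) + wnorm p (int_v h))%E.

Definition C1_plane h : Prop :=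
  [/\ forall x v, derivable (h^~ v) x 1 /\ derivable (h x) v 1,
      continuous (fun z : R * R => h z.1 z.2),
      continuous (fun z : R * R => dx h z.1 z.2) &
      continuous (fun z : R * R => dv h z.1 z.2)].

Definition C3 (F : R -> R) : Prop :=
  (forall k x, (k < 3)%N -> derivable (derive1n k F) x 1) /\ continuous (derive1n 3 F).

(* Derivative relative to a set A: one-sided at the end points when A is a
   closed interval. *)
Definition diff_quot (g : R -> R) (t s : R) : R := (g s - g t) / (s - t).

Definition derivable_in (A : set R) (g : R -> R) (t : R) : Prop :=
  cvg (diff_quot g t @ within A t^').

Definition derive_in (A : set R) (g : R -> R) (t : R) : R :=
  lim (diff_quot g t @ within A t^').

Definition dt (d : R) f : R -> R -> R -> R :=
  fun t x v => derive_in `[0, d] (fun s => f s x v) t.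

(* f in C^1([0,d] x R^2); the values f t x v with t outside [0, d] are
   irrelevant. *)
Definition C1_slab (d : R) f : Prop :=
  let slab := [set z : R * R * R | z.1.1 \in `[0, d]] in
  [/\ forall t x v, t \in `[0, d] ->
        [/\ derivable_in `[0, d] (fun s => f s x v) t,
            derivable (fun y => f t y v) x 1 &
            derivable (f t x) v 1],
      {within slab, continuous (fun z => f z.1.1 z.1.2 z.2)},
      {within slab, continuous (fun z => dt d f z.1.1 z.1.2 z.2)},
      {within slab, continuous (fun z => dx (f z.1.1) z.1.2 z.2)} &
      {within slab, continuous (fun z => dv (f z.1.1) z.1.2 z.2)}].

Definition rho (F : R -> R) f (t x : R) : R :=
  \int[mu]_v (F v - f t x v).

Definition efield (F : R -> R) f (t x : R) : R :=
  2^-1 * (\int[mu]_(y in `]-oo, x]) rho F f t y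
          - \int[mu]_(y in `[x, +oo[) rho F f t y).

(* The two integrability clauses say that the integrals defining rho and the
   field exist (as Lebesgue integrals); [Rintegral] is total. *)
Definition VP_solution (F : R -> R) (f0 : R -> R -> R) (d : R) f : Prop :=
  [/\ forall t x, t \in `[0, d] ->
        mu.-integrable setT (fun v => (F v - f t x v)%:E),
      forall t, t \in `[0, d] ->
        mu.-integrable setT (fun x => (rho F f t x)%:E),
      forall t x v, t \in `[0, d] ->
        dt d f t x v + v * dx (f t) x v - efield F f t x * dv (f t) x v = 0 &
      forall x v, f 0 x v = f0 x v].

End VlasovPoisson.

(* Main.v *)
Require Import Defs.
From mathcomp Require Import all_boot all_order all_algebra.
From mathcomp Require Import all_classical all_reals all_analysis.
From mathcomp Require Import measurable_realfun ring lra.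
Import Order.TTheory GRing.Theory Num.Theory.
Import numFieldNormedType.Exports.
Local Open Scope classical_set_scope.
Local Open Scope ring_scope.

(** The solution is obtained as a fixed point of the map that sends a field E
    to the field of the density transported by E.

    Linear step. For a given field E, continuous with a continuous derivative r
    in x, the characteristics solve Z'' = - E(s, Z). They exist by Picard
    iteration (ode_exists) and depend in a C^1 way on the initial data, since
    the difference quotients of the flow solve linear equations whose
    coefficients converge (variation_slope). The solution of the transport
    equation is the initial value at the foot of the characteristic
    (transport_exists).

    Comparison. Upper bounds for a function w with w_t + v w_x - E w_v <= b
    follow from a maximum principle on backward cones (comparison). It uses
    only a bound on E, and therefore also applies to an arbitrary competitor in
    the uniqueness statement; it yields the bound on the
    velocities in the support (transport_support) and the estimate of the
    difference of two solutions by the difference of their fields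
    (transport_stability).

    Field. The difference of two solutions does not decay in x, although the
    field is an integral over the whole line. But charge is conserved: the time
    derivative of the charge of a segment is a flux at its end points, and so
    the difference of two fields is bounded by the time integral of the
    supremum of the difference of the solutions (charge_growth,
    field_stability).

    Together the last two estimates contract in the norm with weight
    exp (- la t) for la large (contraction). This gives uniqueness
    (vlasov_poisson_unique) and the uniform convergence of the iteration
    (local_existence). The iteration stays in a fixed set: v-derivatives are
    bounded, x-derivatives are bounded by a multiple of the weight R^-p (decay), and
    by conservation of charge so is the change of the density
    (density_growth), which is what limits the time of existence. As R^-p is
    integrable for p > 1, the fields are bounded. *)

Set Implicit Arguments.
Unset Strict Implicit.
Unset Printing Implicit Defensive.

(** * Continuity and mean values *)

Section Calculus.
Context {R : realType}.
Implicit Types (f g df dg : R -> R) (a b c t x v e : R).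

Definition cont2 (h : R -> R -> R) := continuous (fun z : R * R => h z.1 z.2).

Definition cont3 (h : R -> R -> R -> R) :=
  continuous (fun z : R * R * R => h z.1.1 z.1.2 z.2).

Lemma cont2_comp (T : topologicalType) (h : R -> R -> R) (a b : T -> R) :
  cont2 h -> continuous a -> continuous b -> continuous (fun p => h (a p) (b p)).
Proof.
move=> ch ca cb p.
apply: (@cvg_comp _ _ _ (fun p => (a p, b p)) (fun z => h z.1 z.2) _
  (nbhs (a p, b p))); last exact: (ch (a p, b p)).
exact: (cvg_pair (ca p) (cb p)).
Qed.

Lemma cont3_comp (T : topologicalType) (h : R -> R -> R -> R) (a b c : T -> R) :
  cont3 h -> continuous a -> continuous b -> continuous c ->
  continuous (fun p => h (a p) (b p) (c p)).
Proof.
move=> ch ca cb cc p.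
apply: (@cvg_comp _ _ _ (fun p => (a p, b p, c p))
  (fun z => h z.1.1 z.1.2 z.2) _ (nbhs (a p, b p, c p))); last exact: (ch (a p, b p, c p)).
exact: (cvg_pair (cvg_pair (ca p) (cb p)) (cc p)).
Qed.

Lemma cont2P (h : R -> R -> R) : cont2 h <->
  forall x v e : R, 0 < e -> exists2 d : R, 0 < d & forall x' v' : R,
    `|x' - x| < d -> `|v' - v| < d -> `|h x' v' - h x v| < e.
Proof.
split=> [ch x v e e0|H z].
  have /cvgrPdist_lt/(_ _ e0)/nbhs_ballP[d /= d0 Hd] := ch (x, v).
  exists d => // x' v' hx hv; rewrite distrC; apply: (Hd (x', v')).
  by split => /=; rewrite /ball /= distrC.
apply/cvgrPdist_lt => e e0; have [d d0 Hd] := H z.1 z.2 e e0.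
apply/(@nbhs_ballP R (R * R)%type); exists d => // -[x' v'] [/= hx hv].
by rewrite distrC; apply: Hd; rewrite distrC.
Qed.

Lemma cont3P (h : R -> R -> R -> R) : cont3 h <->
  forall t x v e : R, 0 < e -> exists2 d : R, 0 < d & forall t' x' v' : R,
    `|t' - t| < d -> `|x' - x| < d -> `|v' - v| < d ->
    `|h t' x' v' - h t x v| < e.
Proof.
split=> [ch t x v e e0|H z].
  have /cvgrPdist_lt/(_ _ e0)/nbhs_ballP[d /= d0 Hd] := ch (t, x, v).
  exists d => // t' x' v' ht hx hv; rewrite distrC; apply: (Hd (t', x', v')).
  by split => /=; [split => /=|]; rewrite /ball /= distrC.
apply/cvgrPdist_lt => e e0; have [d d0 Hd] := H z.1.1 z.1.2 z.2 e e0.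
apply/(@nbhs_ballP R (R * R * R)%type); exists d => // -[[t' x'] v'] [/= [/= ht hx] hv].
by rewrite distrC; apply: Hd; rewrite distrC.
Qed.

Lemma is_derive_continuous f x c : is_derive x 1 f c -> {for x, continuous f}.
Proof. by move=> [fx _]; apply/differentiable_continuous/derivable1_diffP. Qed.

Lemma is_derive_continuousT f df :
  (forall x, is_derive x 1 f (df x)) -> continuous f.
Proof. by move=> fx x; exact: is_derive_continuous (fx x). Qed.

Lemma increment_le f df g dg a b : a <= b ->
  continuous f -> continuous g ->
  (forall x, a < x < b -> is_derive x 1 f (df x)) ->
  (forall x, a < x < b -> is_derive x 1 g (dg x)) ->
  (forall x, a < x < b -> df x <= dg x) -> f b - f a <= g b - g a.
Proof.
move=> ab cf cg df_ dg_ le.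
move: ab; rewrite le_eqVlt => /predU1P[->|ab]; first by rewrite !subrr.
have [| |c cab] := @MVT R (g \- f) (fun x => dg x - df x) a b ab.
- move=> x; rewrite in_itv /= => xab.
  have := df_ _ xab; have := dg_ _ xab => ? ?; exact: is_deriveB.
- by apply: continuous_subspaceT => x; apply: cvgB; [exact: cg|exact: cf].
move: cab; rewrite in_itv /= => cab E.
have : 0 <= (dg c - df c) * (b - a).
  by rewrite mulr_ge0 // subr_ge0 ?le // ltW.
by rewrite -E /=; lra.
Qed.

Lemma increment_norm_le f df g dg a b : a <= b ->
  continuous f -> continuous g ->
  (forall x, a < x < b -> is_derive x 1 f (df x)) ->
  (forall x, a < x < b -> is_derive x 1 g (dg x)) ->
  (forall x, a < x < b -> `|df x| <= dg x) -> `|f b - f a| <= g b - g a.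
Proof.
move=> ab cf cg df_ dg_ le; rewrite ler_norml; apply/andP; split; last first.
  by apply: (@increment_le f df g dg) => // x /le; rewrite ler_norml => /andP[].
have : (\- f) b - (\- f) a <= g b - g a.
  apply: (@increment_le (\- f) (fun x => - df x) g dg) => //.
  - by move=> x; apply: cvgN; exact: cf.
  - by move=> x /df_ ?; exact: is_deriveN.
  - by move=> x /le; rewrite ler_norml => /andP[+ _]; lra.
by rewrite /=; lra.
Qed.

(** The end points may come in either order, so the intermediate point is
    located by its distances to them. *)
Lemma mean_value f df a b : (forall x, is_derive x 1 f (df x)) ->
  exists c : R, [/\ `|c - a| <= `|b - a|, `|c - b| <= `|b - a| &
    f b - f a = df c * (b - a)].
Proof.
move=> Df; have cf := is_derive_continuousT Df.
have [ab|/ltW ba] := leP a b.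
  have [c + E] := @MVT_segment R f df a b ab (fun x _ => Df x)
    (continuous_subspaceT cf).
  rewrite in_itv /= => /andP[ac cb]; exists c; split => //;
    rewrite ler_norml (ger0_norm (x := b - a)) ?subr_ge0//; lra.
have [c + E] := @MVT_segment R f df b a ba (fun x _ => Df x)
  (continuous_subspaceT cf).
rewrite in_itv /= => /andP[ac cb]; exists c; split; last by lra.
  by rewrite ler_norml (ler0_norm (x := b - a)) ?subr_le0//; lra.
by rewrite ler_norml (ler0_norm (x := b - a)) ?subr_le0//; lra.
Qed.

Lemma lipschitz_of_derive f df M a b : (forall x, is_derive x 1 f (df x)) ->
  (forall x, `|df x| <= M) -> `|f b - f a| <= M * `|b - a|.
Proof.
move=> Df leM; have [c [_ _ E]] := mean_value a b Df; rewrite E.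
by rewrite normrM ler_wpM2r.
Qed.

Lemma derive_ge0_le f df a b : a <= b ->
  (forall x, is_derive x 1 f (df x)) -> (forall x, a < x < b -> 0 <= df x) ->
  f a <= f b.
Proof.
move=> ab Df p; have := @increment_le (cst 0) (cst 0) f df a b ab.
rewrite subrr subr_ge0; apply => //.
- by move=> x; exact: cvg_cst.
- exact: is_derive_continuousT Df.
Qed.

(** Compactness of [a, b] turns continuity in the parameter into continuity
    that is uniform in s. *)
Lemma tube (T : topologicalType) (h : R * T -> R) (p0 : T) a b e :
  continuous h -> 0 < e ->
  \forall p \near p0, forall s, a <= s <= b -> `|h (s, p) - h (s, p0)| < e.
Proof.
move=> ch e0; have /compact_near_coveringP/near_covering_withinP cov :=
  @segment_compact R a b.
have := cov T (nbhs p0) (fun p s => `|h (s, p) - h (s, p0)| < e) _.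
move=> H; have {H} : \forall p \near p0, `[a, b] `<=`
    (fun s => `|h (s, p) - h (s, p0)| < e).
  apply: H => s _.
  have e2 : 0 < e / 2 by rewrite divr_gt0.
  have /cvgrPdist_lt/(_ _ e2) H1 := ch (s, p0).
  have H2 : \forall z \near (s, p0), `|h (s, p0) - h (z.1, p0)| < e / 2.
    have : (fun z : R * T => h (z.1, p0)) @ (s, p0) --> h (s, p0).
      apply: (@cvg_comp _ _ _ (fun z : R * T => (z.1, p0)) h _ (nbhs (s, p0))).
        exact: (cvg_pair (@cvg_fst _ _ (nbhs s) (nbhs p0) _) (@cvg_cst _ p0 _ _ _)).
      exact: (ch (s, p0)).
    by move=> /cvgrPdist_lt/(_ _ e2).
  have [[A B] /= [As Bs] AB] := filterI H1 H2.
  exists (A, B) => // -[s' p] [/= As' Bp] _.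
  have [] := AB (s', p) (conj As' Bp).
  rewrite /= !ltr_norml; lra.
move=> N; near=> p => s sab.
have : `[a, b] `<=` (fun s => `|h (s, p) - h (s, p0)| < e) by near: p.
by apply; rewrite /= in_itv.
Unshelve. all: by end_near. Qed.

End Calculus.

(** * Geometrically convergent sequences *)

Section GeometricLimits.
Context {R : realType}.
Implicit Types (u : nat -> R) (B C e : R) (n : nat).

Notation half := (2^-1 : R).

Lemma geometric_lt C e : 0 < e -> exists n, C * half ^+ n < e.
Proof.
move=> e0.
have h : `|half| < 1 by rewrite ger0_norm // invf_lt1 // ltr1n.
have /cvgrPdist_lt/(_ e e0)[N _ HN] := @cvg_geometric R C half h.
exists N; have := HN N (leqnn N).
by rewrite sub0r normrN /geometric /=; apply: le_lt_trans; exact: ler_norm.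
Qed.

Lemma geometric_le0 C e : (forall n, e <= C * half ^+ n) -> e <= 0.
Proof.
move=> H; rewrite leNgt; apply/negP => e0.
by have [n] := geometric_lt C e0; rewrite ltNge H.
Qed.

(** The sequences u n - 2 B / 2^n and u n + 2 B / 2^n are monotone and enclose
    each other, so the supremum of the first one is a common limit. *)
Lemma geometric_limit u B :
  (forall n, `|u n.+1 - u n| <= B * half ^+ n) ->
  exists l : R, forall n, `|u n - l| <= 2 * B * half ^+ n.
Proof.
move=> H.
pose a n := u n - 2 * B * half ^+ n; pose b n := u n + 2 * B * half ^+ n.
have aS n : a n <= a n.+1.
  by move: (H n); rewrite ler_norml /a exprS => /andP[]; lra.
have bS n : b n.+1 <= b n.
  by move: (H n); rewrite ler_norml /b exprS => /andP[]; lra.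
have B0 n : 0 <= B * half ^+ n by apply: le_trans (H n).
have ab n m : a n <= b m.
  have nd : {homo a : n m / (n <= m)%N >-> n <= m} by exact: homo_leq le_trans aS.
  have ni : {homo b : n m / (n <= m)%N >-> m <= n}.
    by apply: (homo_leq (r := fun x y => y <= x)) bS => // x y z xy yz; exact: le_trans yz xy.
  apply: le_trans (nd _ _ (leq_maxl n m)) _.
  apply: le_trans (ni _ _ (leq_maxr n m)).
  by rewrite /a /b; have := B0 (maxn n m); lra.
have hs : has_sup (range a).
  by split; [exists (a 0%N), 0%N|exists (b 0%N) => _ [n _ <-]; exact: ab].
exists (sup (range a)) => n.
have : a n <= sup (range a) by apply: ub_le_sup; [case: hs|exists n].
have : sup (range a) <= b n.
  by apply: ge_sup; [case: hs|move=> _ [m _ <-]; exact: ab].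
by rewrite /a /b ler_norml; lra.
Qed.

(** The factor w lets the convergence be only locally uniform. *)
Lemma geometric_limit_continuous (T : topologicalType) (Y : nat -> T -> R)
    (Z w : T -> R) B :
  (forall n, continuous (Y n)) -> continuous w ->
  (forall n s, `|Y n s - Z s| <= B * half ^+ n * w s) -> continuous Z.
Proof.
move=> cY cw H s; apply/cvgrPdist_lt => e e0.
have [n] := geometric_lt (`|B| * (`|w s| + 1)) (e := e / 4) ltac:(lra).
move=> Hn.
have /cvgrPdist_lt/(_ 1 ltr01) c1 := cw s.
have /cvgrPdist_lt/(_ (e / 4) ltac:(lra)) c2 := cY n s.
have h0 : 0 <= half ^+ n by rewrite exprn_ge0.
have bnd s' : `|w s'| <= `|w s| + 1 -> `|Y n s' - Z s'| < e / 4.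
  move=> ws; apply: le_lt_trans (H n s') (le_lt_trans _ Hn).
  rewrite (le_trans (ler_norm _))// !normrM (ger0_norm h0) -!mulrA.
  by rewrite ler_wpM2l // [leLHS]mulrC ler_wpM2r.
near=> s'.
have d1 : `|w s - w s'| < 1 by near: s'.
have d2 : `|Y n s - Y n s'| < e / 4 by near: s'.
have d3 : `|Y n s - Z s| < e / 4 by apply: bnd; lra.
have d4 : `|Y n s' - Z s'| < e / 4.
  apply: bnd; rewrite -lerBlDl (le_trans (lerB_dist _ _)) //.
  by rewrite distrC ltW.
move: d2 d3 d4; rewrite !ltr_norml; lra.
Unshelve. all: by end_near. Qed.

End GeometricLimits.

(** * Antiderivatives and barriers *)

Section Ode.
Context {R : realType}.
Implicit Types (u g : R -> R) (a b c t x v e s r : R).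

Notation half := (2^-1 : R).

Lemma is_derive_expR_affine c t (s : R) :
  is_derive s (1 : R) (fun s => expR (c * (s - t))) (c * expR (c * (s - t))).
Proof.
have H : is_derive s 1 (fun s => c * (s - t)) c.
  have : is_derive s 1 (fun s => c *: (s - t)) (c *: (1 - 0)).
    by apply: is_deriveZ; apply: is_deriveB.
  by rewrite subr0 scaler1 /GRing.scale /=.
rewrite mulrC; have D := is_derive_expR (c * (s - t)).
exact: (@is_derive1_comp R expR (fun s => c * (s - t)) s _ _ D H).
Qed.

(** Near a given point the antiderivative is an integral with the lower bound
    - N, for N large; changing N only changes it by a constant, which the
    normalization at t removes. This avoids oriented integrals. *)
Lemma antiderivative g t : continuous g ->
  exists P : R -> R, P t = 0 /\ forall s, is_derive s 1 P (g s).
Proof.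
move=> cg; pose mu := @lebesgue_measure R.
have ig a b : mu.-integrable `[a, b] (EFin \o g).
  by apply: continuous_compact_integrable; [exact: segment_compact|exact: continuous_subspaceT].
pose Phi (N s : R) := \int[mu]_(y in `[- N, s]) g y.
have DPhi N s : - N < s -> is_derive s 1 (Phi N) (g s).
  move=> Ns; have su : s < s + 1 by rewrite ltrDl.
  have [D E] : derivable (Phi N) s 1 /\ derive1 (Phi N) s = g s.
    by apply: (continuous_FTC1 su (ig _ _) _ (cg s)); rewrite lte_fin.
  by apply: (DeriveDef D); rewrite -E derive1E.
have cstPhi N N' s s' : N <= N' -> - N <= s -> - N <= s' ->
    Phi N' s - Phi N s = Phi N' s' - Phi N s'.
  move=> NN'; have E r : - N <= r -> Phi N' r - Phi N r = Phi N' (- N).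
    move=> Nr; have := @Rintegral_itvB R g (BLeft (- N')) (BRight r) (- N) (ig _ _).
    rewrite !bnd_simp lerN2 => /(_ NN' Nr).
    rewrite Rintegral_itv_obnd_cbnd; first by rewrite /Phi; lra.
    by apply: integrableS (ig (- N) r) => //; apply: subset_itvr; rewrite bnd_simp.
  by move=> Ns Ns'; rewrite !E.
pose P s := Phi (`|s| + `|t| + 1) s - Phi (`|s| + `|t| + 1) t.
exists P; split; first by rewrite /P subrr.
move=> s0; pose N := `|s0| + `|t| + 2.
have : is_derive s0 1 (fun s => Phi N s - Phi N t) (g s0).
  have : is_derive s0 1 (Phi N) (g s0).
    by apply: DPhi; rewrite /N; have := ler_norm (- s0); rewrite normrN;
      have := normr_ge0 t; lra.
  by move=> D; rewrite -[g s0]subr0; apply: is_deriveB.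
apply: near_eq_is_derive => //.
near=> s.
have ds : `|s0 - s| < 1.
  by near: s; have /cvgrPdist_lt/(_ 1 ltr01) := @cvg_id _ (nbhs s0).
have sN : `|s| <= `|s0| + 1.
  by rewrite -lerBlDl (le_trans (lerB_dist _ _)) // distrC ltW.
have i1 : `|s| + `|t| + 1 <= N.
  by rewrite /N; have -> : (2 : R) = 1 + 1 by []; rewrite addrA lerD2r addrAC lerD2r.
have i2 : - (`|s| + `|t| + 1) <= s.
  by rewrite lerNl (le_trans (ler_norm _)) // normrN -addrA lerDl addr_ge0.
have i3 : - (`|s| + `|t| + 1) <= t.
  by rewrite lerNl (le_trans (ler_norm _)) // normrN addrAC lerDr addr_ge0.
have := cstPhi _ _ _ _ i1 i2 i3; rewrite /P.
move: (Phi N s) (Phi N t) (Phi _ s) (Phi _ t) => q1 q2 q3 q4 Ec.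
by clear - Ec; lra.
Unshelve. all: by end_near. Qed.

Lemma convex_min u u1 u2 t s : (forall s, is_derive s 1 u (u1 s)) ->
  (forall s, is_derive s 1 u1 (u2 s)) -> (forall s, 0 <= u2 s) ->
  u1 t = 0 -> 0 <= u t -> 0 <= u s.
Proof.
move=> D1 D2 p u1t ut; apply: le_trans ut _.
have mono r r' : r <= r' -> u1 r <= u1 r'.
  by move=> rr'; apply: derive_ge0_le D2 _.
have [ts|/ltW st] := leP t s.
  by apply: derive_ge0_le D1 _ => // r /andP[/ltW tr _]; rewrite -u1t mono.
have DN : forall s, is_derive s 1 (\- u) (- u1 s) by move=> r; exact: is_deriveN.
have := derive_ge0_le st DN; rewrite /= lerN2; apply => r /andP[_ /ltW rt].
by rewrite oppr_ge0 -u1t mono.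
Qed.

(** Twice the hyperbolic cosine of c (s - t): a weight equal to c^-2 times its
    second derivative, and critical at s = t. *)
Definition expsym c t (s : R) := expR (c * (s - t)) + expR ((- c) * (s - t)).

Lemma expsym_ge1 c t s : 1 <= expsym c t s.
Proof.
rewrite /expsym; have := expR_ge1Dx (c * (s - t)).
by have := expR_ge1Dx ((- c) * (s - t)); rewrite mulNr; lra.
Qed.

Lemma expsym_ge c t s : 1 <= c -> `|s - t| <= expsym c t s.
Proof.
move=> c1; rewrite /expsym.
have := expR_ge1Dx (c * (s - t)); have := expR_ge1Dx ((- c) * (s - t)).
have := expR_gt0 (c * (s - t)); have := expR_gt0 ((- c) * (s - t)).
rewrite ler_norml => H1 H2 H3 H4.
apply/andP; split.
  have [st|st] := leP 0 (s - t); first lra.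
  suff : - (s - t) <= - c * (s - t) by lra.
  by rewrite mulNr lerN2 -subr_ge0 (_ : _ - _ = (c - 1) * - (s - t)); [rewrite mulr_ge0 //; lra|ring].
have [st|st] := leP (s - t) 0; first lra.
suff : (s - t) <= c * (s - t) by lra.
by rewrite ler_peMl // ltW.
Qed.

(** Both B * expsym + h and B * expsym - h are convex, and nonnegative and
    critical at t. Applied to differences of Picard iterates, the factor c^-2
    gained here gives a contraction on both sides of t and for all times. *)
Lemma double_antiderivative_bound h h1 g c t B s :
  (forall s, is_derive s 1 h (h1 s)) -> (forall s, is_derive s 1 h1 (g s)) ->
  h t = 0 -> h1 t = 0 -> 0 <= B ->
  (forall s, `|g s| <= B * c ^+ 2 * expsym c t s) -> `|h s| <= B * expsym c t s.
Proof.
move=> D1 D2 ht h1t B0 H.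
pose w1 s := B * (c * expR (c * (s - t)) - c * expR ((- c) * (s - t))).
have Dw r : is_derive r 1 (fun s => B * expsym c t s) (w1 r).
  apply: (@is_deriveZ R R R (expsym c t) B r 1).
  by rewrite -mulNr; apply: is_deriveD; exact: is_derive_expR_affine.
have Dw1 r : is_derive r 1 w1 (B * c ^+ 2 * expsym c t r).
  rewrite -mulrA; apply: (@is_deriveZ R R R _ B r 1).
  have -> : c ^+ 2 * expsym c t r =
      c * (c * expR (c * (r - t))) - c * (- c * expR (- c * (r - t))).
    by rewrite /expsym; ring.
  by apply: is_deriveB; apply: (@is_deriveZ R R R _ c r 1); exact: is_derive_expR_affine.
have w1t : w1 t = 0 by rewrite /w1 subrr !mulr0 subrr mulr0.
have wt : 0 <= B * expsym c t t by rewrite mulr_ge0 // (le_trans ler01) // expsym_ge1.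
rewrite ler_norml; apply/andP; split.
  rewrite -subr_ge0 opprK.
  apply: (@convex_min _ _ _ t s (fun s => is_deriveD (D1 s) (Dw s))
    (fun s => is_deriveD (D2 s) (Dw1 s))) => /=.
  - by move=> r; move: (H r); rewrite ler_norml => /andP[+ _]; lra.
  - by rewrite h1t w1t addr0.
  - by rewrite fctE ht add0r.
rewrite -subr_ge0.
apply: (@convex_min _ _ _ t s (fun s => is_deriveB (Dw s) (D1 s))
  (fun s => is_deriveB (Dw1 s) (D2 s))) => /=.
- by move=> r; move: (H r); rewrite ler_norml => /andP[_ +]; lra.
- by rewrite h1t w1t subr0.
- by rewrite !fctE ht subr0.
Qed.

End Ode.

(** * Second-order differential equations *)

Section OdeExistence.
Context {R : realType}.
Implicit Types (u g : R -> R) (a b c t x v e s r y : R).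

Notation half := (2^-1 : R).

(** Picard iteration for Z'' = G s Z, written with two successive
    antiderivatives. In the weight expsym c t with c = 2 K + 1 one step
    contracts differences by a factor 1 / 2, so the solution is global. *)
Lemma ode_exists (G : R -> R -> R) (K M t x v : R) : cont2 G -> 0 <= K ->
  (forall s y y', `|G s y - G s y'| <= K * `|y - y'|) ->
  (forall s, `|G s 0| <= M) ->
  exists Z V : R -> R, [/\ Z t = x, V t = v,
    forall s, is_derive s 1 Z (V s) & forall s, is_derive s 1 V (G s (Z s))].
Proof.
move=> cG K0 lipG bG.
have M0 : 0 <= M by apply: le_trans (bG 0).
have /choice[P HP] : forall g, exists P : R -> R, continuous g ->
    P t = 0 /\ forall s, is_derive s 1 P (g s).
  move=> g; have [cg|ncg] := pselect (continuous g); last by exists g.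
  by have [P HP] := antiderivative t cg; exists P.
have cP g : continuous g -> continuous (P g).
  by move=> /HP[_ /is_derive_continuousT].
have cGy (y : R -> R) : continuous y -> continuous (fun s => G s (y s)).
  by move=> cy; apply: cont2_comp cG _ cy => s; exact: cvg_id.
pose y0 s := x + v * (s - t).
have Dy0 s : is_derive s 1 y0 v.
  rewrite -[v in is_derive _ _ _ v]add0r; apply: is_deriveD.
  have : is_derive s 1 (fun s => v *: (s - t)) (v *: (1 - 0)).
    by apply: is_deriveZ; apply: is_deriveB.
  by rewrite subr0 scaler1 /GRing.scale /=.
have cy0 : continuous y0 := is_derive_continuousT Dy0.
pose PP (y : R -> R) := P (P (fun s => G s (y s))).
pose Y n := iter n (fun (y : R -> R) s => y0 s + PP y s) y0.
have cY n : continuous (Y n).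
  elim: n => [//|n IH] s /=; apply: cvgD; first exact: cy0.
  exact: (cP _ (cP _ (cGy _ IH))) s.
pose c := 2 * K + 1.
have c1 : 1 <= c by rewrite /c; lra.
have cc : 2 * K <= c ^+ 2 by rewrite /c; nra.
pose w := expsym c t.
have w1 s : 1 <= w s := expsym_ge1 c t s.
have PPB (y z : R -> R) B : continuous y -> continuous z -> 0 <= B ->
    (forall s, `|y s - z s| <= B * w s) ->
    forall s, `|PP y s - PP z s| <= B * half * w s.
  move=> cy cz B0 yz s.
  have [P1y P2y] := HP _ (cGy _ cy); have [P1z P2z] := HP _ (cGy _ cz).
  have [P3y P4y] := HP _ (cP _ (cGy _ cy)).
  have [P3z P4z] := HP _ (cP _ (cGy _ cz)).
  have B0' : 0 <= B * half by rewrite mulr_ge0.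
  apply: (@double_antiderivative_bound _ (fun s => PP y s - PP z s) _ _ c t _ s
    (fun s => is_deriveB (P4y s) (P4z s)) (fun s => is_deriveB (P2y s) (P2z s))) => //.
  - by rewrite /PP P3y P3z subrr.
  - by rewrite P1y P1z subrr.
  - move=> r; apply: le_trans (lipG _ _ _) _.
    apply: le_trans (ler_wpM2l K0 (yz r)) _.
    rewrite mulrA; apply: ler_wpM2r; first exact: le_trans ler01 (w1 r).
    have -> : K * B = (2 * K) * (B * half) by field.
    by rewrite mulrC ler_wpM2l.
pose B := M + K * (`|x| + `|v|).
have B0 : 0 <= B by rewrite addr_ge0 // mulr_ge0 // addr_ge0.
have Y01 s : `|Y 1%N s - Y 0%N s| <= B * w s.
  rewrite /= addrC addKr.
  have [P1 P2] := HP _ (cGy _ cy0); have [P3 P4] := HP _ (cP _ (cGy _ cy0)).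
  apply: (@double_antiderivative_bound _ (PP y0) _ _ c t _ s P4 P2) => // r.
  have e1 := w1 r; have e2 := expsym_ge t r c1.
  have h1 : `|y0 r| <= (`|x| + `|v|) * w r.
    rewrite /y0 (le_trans (ler_normD _ _)) // normrM mulrDl lerD //.
      by rewrite ler_peMr.
    by rewrite ler_wpM2l.
  have h2 : `|G r (y0 r)| <= M + K * `|y0 r|.
    have := lipG r (y0 r) 0; have := bG r; rewrite subr0 !ler_norml; lra.
  apply: le_trans h2 _; rewrite -mulrA.
  have cw : w r <= c ^+ 2 * w r by apply: ler_peMl; [lra|nra].
  apply: le_trans (_ : B * w r <= _); last by rewrite ler_wpM2l.
  by rewrite /B mulrDl lerD // -?mulrA ?ler_wpM2l // ler_peMr.
have YS n s : `|Y n.+1 s - Y n s| <= B * half ^+ n * w s.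
  elim: n s => [|n IH] s; first by rewrite expr0 mulr1; exact: Y01.
  have -> : Y n.+2 s - Y n.+1 s = PP (Y n.+1) s - PP (Y n) s.
    by rewrite /Y /=; ring.
  rewrite exprSr mulrA; apply: PPB => //.
  by rewrite mulr_ge0 // exprn_ge0.
have /choice[Z HZ] : forall s, exists l, forall n,
    `|Y n s - l| <= 2 * (B * w s) * half ^+ n.
  by move=> s; apply: geometric_limit => n; rewrite mulrAC; exact: YS.
have HZ' n s : `|Y n s - Z s| <= 2 * B * half ^+ n * w s.
  by apply: le_trans (HZ s n) _; rewrite -!mulrA (mulrC (w s)).
have cw : continuous w.
  move=> s; rewrite /w /expsym; apply: cvgD;
  exact: is_derive_continuous (is_derive_expR_affine _ _ _).
have cZ : continuous Z by apply: geometric_limit_continuous cY cw HZ'.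
have fix_Z s : Z s = y0 s + PP Z s.
  apply/eqP; rewrite -subr_eq0 -normr_eq0; apply/eqP/le_anti/andP; split => //.
  apply: (@geometric_le0 R (4 * B * w s)) => n.
  have h0 : 0 <= half ^+ n by rewrite exprn_ge0.
  have h1 : `|PP (Y n) s - PP Z s| <= (2 * B * half ^+ n) * half * w s.
    by apply: PPB => //; rewrite !mulr_ge0.
  have h2 := HZ' n.+1 s; rewrite exprS /= in h2.
  have h3 : 0 <= B * half ^+ n * w s by rewrite !mulr_ge0 // (le_trans ler01).
  by move: h1 h2; rewrite !ler_norml /=; lra.
have [P1 P2] := HP _ (cGy _ cZ); have [P3 P4] := HP _ (cP _ (cGy _ cZ)).
exists Z, (fun s => v + P (fun s => G s (Z s)) s); split.
- by rewrite fix_Z /PP P3 /y0 subrr mulr0 !addr0.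
- by rewrite P1 addr0.
- move=> s; have E : (fun s => y0 s + PP Z s) = Z by apply/funext.
  rewrite -{1}E.
  exact: (is_deriveD (Dy0 s) (P4 s)).
- move=> s; rewrite -[G s (Z s)]add0r.
  exact: (is_deriveD (is_derive_cst v s 1) (P2 s)).
Qed.

Definition growth (K l : R) : R := 2 * expR ((K + 2) * l).

Lemma growth_ge0 K l : 0 <= growth K l.
Proof. by rewrite /growth mulr_ge0 // ltW // expR_gt0. Qed.

(** Gronwall's argument in both time directions: the logarithmic derivative of
    the energy u^2 + u1^2 + e^2 is at most K + 2 in absolute value, and the
    energy is at most 3 e^2 at time t. *)
Lemma energy_bound u u1 g a b t K e :
  (forall s, is_derive s 1 u (u1 s)) -> (forall s, is_derive s 1 u1 (g s)) ->
  a <= t <= b -> 0 <= K -> 0 <= e ->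
  (forall s, a <= s <= b -> `|g s| <= K * `|u s| + e) ->
  `|u t| <= e -> `|u1 t| <= e ->
  forall s, a <= s <= b ->
    `|u s| <= growth K (b - a) * e /\ `|u1 s| <= growth K (b - a) * e.
Proof.
move=> Du Du1 /andP[at_ tb] K0 e0 H ut u1t s /andP[as_ sb].
pose w r := u r * u r + u1 r * u1 r + e * e.
pose w1 r := u r * u1 r + u r * u1 r + (u1 r * g r + u1 r * g r) + 0.
have Dw r : is_derive r 1 w (w1 r).
  by apply: is_deriveD; apply: is_deriveD; apply: is_deriveM.
have w0 r : 0 <= w r by rewrite /w; nra.
have w1w r : a <= r <= b -> `|w1 r| <= (K + 2) * w r.
  move=> /H hr; rewrite /w1 /w addr0.
  have h1 : `|u1 r * g r| <= `|u1 r| * (K * `|u r| + e).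
    by rewrite normrM ler_wpM2l.
  have h2 : `|u r * u1 r| = `|u r| * `|u1 r| by rewrite normrM.
  have q1 : u r * u r = `|u r| * `|u r| by rewrite -!expr2 real_normK ?num_real.
  have q2 : u1 r * u1 r = `|u1 r| * `|u1 r| by rewrite -!expr2 real_normK ?num_real.
  rewrite q1 q2 (le_trans (ler_normD _ _)) //.
  apply: (@le_trans _ _ (2 * `|u r * u1 r| + 2 * `|u1 r * g r|)).
    have := ler_normD (u r * u1 r) (u r * u1 r).
    have := ler_normD (u1 r * g r) (u1 r * g r); lra.
  rewrite h2; move: (normr_ge0 (u r)) (normr_ge0 (u1 r)) h1.
  move: `|u r| `|u1 r| `|u1 r * g r| => p q m p0 q0.
  have : 0 <= K * (p - q) ^+ 2 by rewrite mulr_ge0 // sqr_ge0.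
  have := sqr_ge0 (p - q); have := sqr_ge0 (q - e).
  have : 0 <= K * (e * e) by rewrite !mulr_ge0.
  have : 0 <= p * p by rewrite mulr_ge0.
  have : 0 <= q * q by rewrite mulr_ge0.
  rewrite !expr2; nra.
have wt : w t <= 3 * (e * e).
  have sq p : `|p| <= e -> p * p <= e * e.
    move=> pe; have -> : p * p = `|p| * `|p| by rewrite -!expr2 real_normK ?num_real.
    by rewrite ler_pM.
  by rewrite /w; have := sq _ ut; have := sq _ u1t; lra.
pose E := expR ((K + 2) * (b - a)).
have E1 : 1 <= E by rewrite -expR0 ler_expR mulr_ge0 //; lra.
have ws : w s <= w t * E.
  have [ts|st] := leP t s.
    have D r : is_derive r 1 (fun r => w r * expR (- (K + 2) * (r - t)))
        (w r * (- (K + 2) * expR (- (K + 2) * (r - t))) +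
         expR (- (K + 2) * (r - t)) * w1 r).
      by apply: is_deriveM; exact: is_derive_expR_affine.
    have : (\- (fun r => w r * expR (- (K + 2) * (r - t)))) t <=
           (\- (fun r => w r * expR (- (K + 2) * (r - t)))) s.
      apply: derive_ge0_le ts (fun r => is_deriveN (D r)) _ => r /andP[tr rs].
      have rab : a <= r <= b by lra.
      have := w1w r rab; rewrite ler_norml.
      have := expR_gt0 (- (K + 2) * (r - t)); nra.
    rewrite /= subrr mulr0 expR0 mulr1 lerN2 => le.
    rewrite -[w s](@mulfK _ (expR (- (K + 2) * (s - t)))); last by rewrite gt_eqF // expR_gt0.
    rewrite -expRN -!mulNr opprK ler_pM ?mulr_ge0 ?expR_ge0 //.
    by rewrite ler_expR ler_wpM2l //; lra.
  have D r : is_derive r 1 (fun r => w r * expR ((K + 2) * (r - t)))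
      (w r * ((K + 2) * expR ((K + 2) * (r - t))) +
       expR ((K + 2) * (r - t)) * w1 r).
    by apply: is_deriveM; exact: is_derive_expR_affine.
  have le : w s * expR ((K + 2) * (s - t)) <= w t * expR ((K + 2) * (t - t)).
    apply: (derive_ge0_le (ltW st) D) => r /andP[sr rt].
    have rab : a <= r <= b by lra.
    have := w1w r rab; rewrite ler_norml.
    have := expR_gt0 ((K + 2) * (r - t)); nra.
  rewrite subrr mulr0 expR0 mulr1 in le.
  rewrite -[w s](@mulfK _ (expR ((K + 2) * (s - t)))); last by rewrite gt_eqF // expR_gt0.
  rewrite -expRN ler_pM ?mulr_ge0 ?expR_ge0 //.
  by rewrite ler_expR -mulrN ler_wpM2l //; lra.
have main p : p * p <= w s -> `|p| <= growth K (b - a) * e.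
  move=> ps; rewrite -(@ler_pXn2r _ 2%N) ?nnegrE //; last first.
    by rewrite mulr_ge0 // growth_ge0.
  rewrite real_normK ?num_real // /growth -/E !expr2 (le_trans ps) // (le_trans ws) //.
  have : w t * E <= 3 * (e * e) * E by rewrite ler_wpM2r //; lra.
  have : 0 <= (e * e) * E * (E - 1) by rewrite !mulr_ge0 //; lra.
  have : 0 <= (e * e) * E by rewrite !mulr_ge0 //; lra.
  nra.
by split; apply: main; rewrite /w; nra.
Qed.

End OdeExistence.

(** * Functions with continuous partial derivatives *)

Section ChainRule.
Context {R : realType}.
Implicit Types (f g : R -> R) (a b c t x v e s r y l : R).

Lemma is_derive_slopeP f x l : is_derive x 1 f l <->
  (forall e, 0 < e -> exists2 d : R, 0 < d & forall y, `|y - x| < d ->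
     `|f y - f x - l * (y - x)| <= e * `|y - x|).
Proof.
split=> [Df e e0|H].
  have [dfx <-] := Df.
  have /cvg_ex[/= l' cl'] : cvg ((fun h => h^-1 *: (f (h *: 1 + x) - f x)) @ 0^') := dfx.
  have El : 'D_1 f x = l' by apply/cvg_lim.
  rewrite El.
  have /cvgrPdist_le/(_ e e0)/nbhs_ballP[d /= d0 Hd] := cl'.
  exists d => // y yx.
  have [->|ne] := eqVneq y x; first by rewrite !subrr mulr0 subrr normr0 mulr0.
  have ne0 : y - x != 0 by rewrite subr_eq0.
  have := Hd (y - x); rewrite /ball /= sub0r normrN => /(_ yx ne0).
  rewrite /GRing.scale /= mulr1 subrK => le.
  have -> : f y - f x - l' * (y - x) =
      - (l' - (y - x)^-1 * (f y - f x)) * (y - x) by field.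
  by rewrite normrM normrN ler_wpM2r.
suff cl : (fun h => h^-1 *: (f (h *: 1 + x) - f x)) @ 0^' --> l.
  apply: DeriveDef; first by apply/cvg_ex; exists l.
  exact/cvg_lim.
apply/cvgrPdist_le => e e0; have [d d0 Hd] := H e e0.
apply/nbhs_ballP; exists d => //= h; rewrite /ball /= sub0r normrN => hd h0.
have := Hd (h + x); rewrite addrK => /(_ hd) le.
rewrite /GRing.scale /= mulr1 -(@ler_pM2r _ `|h|) ?normr_gt0 // -normrM.
rewrite (_ : (l - _) * h = - (f (h + x) - f x - l * h)) ?normrN //.
by field.
Qed.

(** The time derivative is required only inside the time interval: a function
    given on [0, d] fits this definition once its time argument is clamped to
    [0, d], and it is then continuous on the whole space. *)
Definition C1on (d : R) (f ft fx fv : R -> R -> R -> R) : Prop :=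
  [/\ cont3 f, cont3 ft, cont3 fx, cont3 fv &
   [/\ forall t x v, 0 < t < d -> is_derive t 1 (fun s => f s x v) (ft t x v),
       forall t x v, is_derive x 1 (fun y => f t y v) (fx t x v) &
       forall t x v, is_derive v 1 (f t x) (fv t x v)]].

(** First-order expansion in (x, v), uniform in the time t' close to t: move
    first in v, then in x, and use the mean value theorem twice. *)
Lemma increment3 (f fx fv : R -> R -> R -> R) t x v e :
  cont3 fx -> cont3 fv ->
  (forall t x v, is_derive x 1 (fun y => f t y v) (fx t x v)) ->
  (forall t x v, is_derive v 1 (f t x) (fv t x v)) -> 0 < e ->
  exists2 d : R, 0 < d & forall t' x' v',
    `|t' - t| < d -> `|x' - x| < d -> `|v' - v| < d ->
    `|f t' x' v' - f t' x v - fx t x v * (x' - x) - fv t x v * (v' - v)| <=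
    e * (`|x' - x| + `|v' - v|).
Proof.
move=> /cont3P cx /cont3P cv Dx Dv e0.
have [d1 d10 H1] := cx t x v e e0; have [d2 d20 H2] := cv t x v e e0.
exists (Num.min d1 d2); first by rewrite lt_min d10.
move=> t' x' v'; rewrite !lt_min => /andP[t1 t2] /andP[x1 x2] /andP[v1 v2].
have [y [yx _ Ey]] := mean_value x x' (fun y => Dx t' y v').
have [u [uv _ Eu]] := mean_value v v' (fun u => Dv t' x u).
have -> : f t' x' v' - f t' x v - fx t x v * (x' - x) - fv t x v * (v' - v) =
  (fx t' y v' - fx t x v) * (x' - x) + (fv t' x u - fv t x v) * (v' - v).
  have -> : f t' x' v' - f t' x v =
    (f t' x' v' - f t' x v') + (f t' x v' - f t' x v) by ring.
  by rewrite Ey Eu; ring.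
rewrite (le_trans (ler_normD _ _)) // !normrM mulrDr lerD // ler_wpM2r // ltW //.
  by apply: H1 => //; apply: le_lt_trans yx _.
by apply: H2; rewrite ?subrr ?normr0 //; exact: le_lt_trans uv _.
Qed.

Lemma cont3_of_cont2 (g : R -> R -> R) : cont2 g -> cont3 (fun _ => g).
Proof.
move=> cg; apply: cont2_comp cg _ _.
  by move=> z; apply: (@cvg_comp _ _ _ fst snd); [exact: cvg_fst|exact: cvg_snd].
by move=> z; exact: cvg_snd.
Qed.

Lemma chain2 (g gx gv : R -> R -> R) (z w : R -> R) y a b :
  cont2 gx -> cont2 gv ->
  (forall x v, is_derive x 1 (g^~ v) (gx x v)) ->
  (forall x v, is_derive v 1 (g x) (gv x v)) ->
  is_derive y 1 z a -> is_derive y 1 w b ->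
  is_derive y 1 (fun s => g (z s) (w s)) (gx (z y) (w y) * a + gv (z y) (w y) * b).
Proof.
move=> cx cv Dx Dv Dz Dw.
have cz := is_derive_continuous Dz; have cw := is_derive_continuous Dw.
apply/is_derive_slopeP => e e0.
pose p := gx (z y) (w y); pose q := gv (z y) (w y).
pose k := `|a| + `|b| + 2; pose m := `|p| + `|q| + 1.
have k0 : 0 < k by rewrite /k; have := normr_ge0 a; have := normr_ge0 b; lra.
have m0 : 0 < m by rewrite /m; have := normr_ge0 p; have := normr_ge0 q; lra.
have e1 : 0 < e / (2 * k) by rewrite divr_gt0 // mulr_gt0.
have e2 : 0 < Num.min 1 (e / (2 * m)) by rewrite lt_min ltr01 divr_gt0 // mulr_gt0.
have [d1 d10 H1] := @increment3 (fun _ => g) (fun _ => gx) (fun _ => gv)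
  0 (z y) (w y) _ (cont3_of_cont2 cx) (cont3_of_cont2 cv)
  (fun _ => Dx) (fun _ => Dv) e1.
have [d2 d20 H2] := (is_derive_slopeP z y a).1 Dz _ e2.
have [d3 d30 H3] := (is_derive_slopeP w y b).1 Dw _ e2.
have /cvgrPdist_lt/(_ _ d10)/nbhs_ballP[d4 /= d40 H4] := cz.
have /cvgrPdist_lt/(_ _ d10)/nbhs_ballP[d5 /= d50 H5] := cw.
exists (Num.min (Num.min d2 d3) (Num.min d4 d5)).
  by rewrite !lt_min d20 d30 d40.
move=> s; rewrite !lt_min => /andP[/andP[s2 s3] /andP[s4 s5]].
have z1 : `|z s - z y| < d1 by rewrite distrC; apply: H4; rewrite /ball /= distrC.
have w1 : `|w s - w y| < d1 by rewrite distrC; apply: H5; rewrite /ball /= distrC.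
have h1 := H1 0 (z s) (w s) ltac:(by rewrite subrr normr0) z1 w1.
have h2 := H2 s s2; have h3 := H3 s s3.
have n0 := normr_ge0 (s - y).
have min1 : Num.min 1 (e / (2 * m)) <= 1 by rewrite ge_min lexx.
have min2 : Num.min 1 (e / (2 * m)) <= e / (2 * m) by rewrite ge_min lexx orbT.
move: h1 h2 h3 min1 min2 => {H1 H2 H3 H4 H5 z1 w1}.
set mn := Num.min 1 _ => h1 h2 h3 min1 min2.
have zs : `|z s - z y| <= (`|a| + 1) * `|s - y|.
  have -> : z s - z y = (z s - z y - a * (s - y)) + a * (s - y) by ring.
  rewrite (le_trans (ler_normD _ _)) // mulrDl addrC lerD ?normrM //.
  by rewrite (le_trans h2) // ler_wpM2r.
have wsy : `|w s - w y| <= (`|b| + 1) * `|s - y|.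
  have -> : w s - w y = (w s - w y - b * (s - y)) + b * (s - y) by ring.
  rewrite (le_trans (ler_normD _ _)) // mulrDl addrC lerD ?normrM //.
  by rewrite (le_trans h3) // ler_wpM2r.
rewrite -/p -/q in h1 *.
have -> : g (z s) (w s) - g (z y) (w y) - (p * a + q * b) * (s - y) =
  (g (z s) (w s) - g (z y) (w y) - p * (z s - z y) - q * (w s - w y)) +
  (p * (z s - z y - a * (s - y)) + q * (w s - w y - b * (s - y))) by ring.
rewrite (le_trans (ler_normD _ _)) //.
have -> : e * `|s - y| = e / 2 * `|s - y| + e / 2 * `|s - y| by field.
apply: lerD.
  apply: le_trans h1 _; apply: (@le_trans _ _ (e / (2 * k) * (k * `|s - y|))).
    rewrite ler_wpM2l ?(ltW e1) //.
    have -> : k * `|s - y| = (`|a| + 1) * `|s - y| + (`|b| + 1) * `|s - y|.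
      by rewrite /k; ring.
    exact: lerD.
  by rewrite mulrA (_ : e / (2 * k) * k = e / 2) //; field; rewrite gt_eqF.
rewrite (le_trans (ler_normD _ _)) // !normrM.
apply: (@le_trans _ _ (m * (e / (2 * m) * `|s - y|))).
  have h2' : `|z s - z y - a * (s - y)| <= e / (2 * m) * `|s - y|.
    by rewrite (le_trans h2) // ler_wpM2r.
  have h3' : `|w s - w y - b * (s - y)| <= e / (2 * m) * `|s - y|.
    by rewrite (le_trans h3) // ler_wpM2r.
  have := ler_wpM2l (normr_ge0 p) h2'; have := ler_wpM2l (normr_ge0 q) h3'.
  have : 0 <= e / (2 * m) * `|s - y| by rewrite mulr_ge0 // divr_ge0 ?mulr_ge0 // ltW.
  move: (e / (2 * m) * `|s - y|) => D D0 A1 A2.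
  by apply: le_trans (lerD A2 A1) _; rewrite /m !mulrDl mul1r lerDl.
by rewrite mulrA (_ : m * (e / (2 * m)) = e / 2) //; field; rewrite gt_eqF.
Qed.

End ChainRule.

(** * The characteristic flow and its first variation *)

Section Flow.
Context {R : realType}.
Implicit Types (a b c t x v e s y l : R).

Context (E r : R -> R -> R) (K M : R).
Context (cE : cont2 E) (cr : cont2 r).
Context (DE : forall t x, is_derive x 1 (E t) (r t x)).
Context (bE : forall t x, `|E t x| <= M) (br : forall t x, `|r t x| <= K).

Let K0 : 0 <= K := le_trans (normr_ge0 _) (br 0 0).

Let lipE s y y' : `|E s y - E s y'| <= K * `|y - y'|.
Proof. exact: lipschitz_of_derive (DE s) (br s). Qed.

Lemma linear_ode_exists (q : R -> R) t a b : continuous q ->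
  (forall s, `|q s| <= K) ->
  exists A B : R -> R, [/\ A t = a, B t = b,
    forall s, is_derive s 1 A (B s) & forall s, is_derive s 1 B (- (q s * A s))].
Proof.
move=> cq bq; apply: (@ode_exists R (fun s y => - (q s * y)) K 0) => //.
- move=> z; apply: cvgN; apply: cvgM; last exact: cvg_snd.
  by apply: (@cvg_comp _ _ _ fst q); [exact: cvg_fst|exact: cq].
- move=> s y y'; have -> : - (q s * y) - - (q s * y') = - q s * (y - y') by ring.
  by rewrite normrM normrN ler_wpM2r.
- by move=> s; rewrite mulr0 oppr0 normr0.
Qed.

(** Z t x v s and V t x v s are the position and the velocity at time s of the
    particle that has position x and velocity v at time t. Time s may precede
    or follow t. *)
Definition is_flow (Z V : R -> R -> R -> R -> R) : Prop :=
  forall t x v, [/\ Z t x v t = x, V t x v t = v,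
    forall s, is_derive s 1 (Z t x v) (V t x v s) &
    forall s, is_derive s 1 (V t x v) (- E s (Z t x v s))].

Lemma flow_exists : exists Z V, is_flow Z V.
Proof.
have /choice[f Hf] : forall p : R * R * R, exists ZV : (R -> R) * (R -> R),
    [/\ ZV.1 p.1.1 = p.1.2, ZV.2 p.1.1 = p.2,
      forall s, is_derive s 1 ZV.1 (ZV.2 s) &
      forall s, is_derive s 1 ZV.2 (- E s (ZV.1 s))].
  move=> [[t x] v]; have [|s y y'|s|Z [V H]] := @ode_exists R (fun s y => - E s y) K M t x v _ K0.
  - by move=> z; apply: cvgN; exact: cE.
  - by rewrite -opprD normrN.
  - by rewrite normrN.
  - by exists (Z, V).
exists (fun t x v => (f (t, x, v)).1), (fun t x v => (f (t, x, v)).2).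
by move=> t x v; exact: (Hf (t, x, v)).
Qed.

Context (Z V : R -> R -> R -> R -> R) (HZ : is_flow Z V).

Let Zt t x v : Z t x v t = x. Proof. by have [] := HZ t x v. Qed.
Let Vt t x v : V t x v t = v. Proof. by have [] := HZ t x v. Qed.
Let DZ t x v s : is_derive s 1 (Z t x v) (V t x v s).
Proof. by have [_ _ + _] := HZ t x v; apply. Qed.
Let DV t x v s : is_derive s 1 (V t x v) (- E s (Z t x v s)).
Proof. by have [_ _ _] := HZ t x v; apply. Qed.
Let cZ t x v : continuous (Z t x v).
Proof. exact: is_derive_continuousT (DZ t x v). Qed.

(** The difference of two trajectories solves an equation to which the energy
    estimate applies; the second trajectory is compared with the first one at
    its own starting time t'. *)
Lemma flow_dependence t x v t' x' v' a b e : a <= t' <= b -> 0 <= e ->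
  `|x' - Z t x v t'| <= e -> `|v' - V t x v t'| <= e ->
  forall s, a <= s <= b ->
    `|Z t' x' v' s - Z t x v s| <= growth K (b - a) * e /\
    `|V t' x' v' s - V t x v s| <= growth K (b - a) * e.
Proof.
move=> ab e0 ex ev; have Du s := is_deriveB (DZ t' x' v' s) (DZ t x v s).
have Du1 s := is_deriveB (DV t' x' v' s) (DV t x v s).
apply: (energy_bound Du Du1 ab K0 e0).
- move=> s _; rewrite -opprD normrN (le_trans (lipE _ _ _)) //.
  by rewrite lerDl.
- by rewrite !fctE Zt.
- by rewrite Vt.
Qed.

Lemma flow_group t x v t' s :
  Z t' (Z t x v t') (V t x v t') s = Z t x v s /\
  V t' (Z t x v t') (V t x v t') s = V t x v s.
Proof.
pose a := Num.min t' s; pose b := Num.max t' s.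
have tab : a <= t' <= b by rewrite ge_min lexx le_max lexx.
have sab : a <= s <= b by rewrite ge_min lexx orbT le_max lexx orbT.
have z0 y : `|y - y| <= 0 by rewrite subrr normr0.
have [] := flow_dependence tab (lexx 0) (z0 (Z t x v t')) (z0 (V t x v t')) sab.
rewrite mulr0 !normr_le0 !subr_eq0 => /eqP -> /eqP ->; split => //.
Qed.

Lemma flow_velocity t x v s : `|V t x v s - v| <= M * `|s - t|.
Proof.
have [c [_ _]] := mean_value t s (DV t x v); rewrite Vt => ->.
by rewrite normrM normrN ler_wpM2r.
Qed.

Lemma flow_position t x v s : `|Z t x v s - x| <= (`|v| + M * `|s - t|) * `|s - t|.
Proof.
have [c [ct _]] := mean_value t s (DZ t x v); rewrite Zt => ->.
rewrite normrM ler_wpM2r //.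
have -> : V t x v c = v + (V t x v c - v) by ring.
rewrite (le_trans (ler_normD _ _)) // lerD2l (le_trans (flow_velocity _ _ _ _)) //.
by rewrite ler_wpM2l // (le_trans _ (bE 0 0)).
Qed.

(** The difference of the solutions solves the equation with coefficient q',
    up to the source (q' - q) A. This gives both the convergence of difference
    quotients of the flow and the continuity of their limits. *)
Lemma linear_dependence (u u1 A B q q' : R -> R) a b t e :
  (forall s, is_derive s 1 u (u1 s)) ->
  (forall s, is_derive s 1 u1 (- (q' s * u s))) ->
  (forall s, is_derive s 1 A (B s)) ->
  (forall s, is_derive s 1 B (- (q s * A s))) ->
  a <= t <= b -> 0 <= e ->
  (forall s, `|q' s| <= K) ->
  (forall s, a <= s <= b -> `|q' s - q s| * `|A s| <= e) ->
  `|u t - A t| <= e -> `|u1 t - B t| <= e ->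
  forall s, a <= s <= b ->
    `|u s - A s| <= growth K (b - a) * e /\ `|u1 s - B s| <= growth K (b - a) * e.
Proof.
move=> Du Du1 DA DB ab e0 bq qq ut u1t.
have Dw s := is_deriveB (Du s) (DA s); have Dw1 s := is_deriveB (Du1 s) (DB s).
apply: (energy_bound Dw Dw1 ab K0 e0) => // s sab.
have -> : - (q' s * u s) - - (q s * A s) =
  - (q' s * (u s - A s) + (q' s - q s) * A s) by ring.
rewrite normrN (le_trans (ler_normD _ _)) // lerD ?normrM ?qq //.
by rewrite ler_wpM2r.
Qed.


Lemma coefficient_near t x v a b e : 0 < e ->
  exists2 d : R, 0 < d & forall s y, a <= s <= b -> `|y - Z t x v s| < d ->
    `|r s y - r s (Z t x v s)| < e.
Proof.
move=> e0.
have ch : continuous (fun z : R * R => r z.1 (Z t x v z.1 + z.2)).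
  apply: (cont2_comp cr); first by move=> z; exact: cvg_fst.
  move=> z; apply: cvgD; last exact: cvg_snd.
  by apply: (@cvg_comp _ _ _ fst (Z t x v)); [exact: cvg_fst|exact: cZ].
have /nbhs_ballP[d /= d0 Hd] := @tube R R _ 0 a b e ch e0.
exists d => // s y sab yd.
have := Hd (y - Z t x v s); rewrite /ball /= sub0r normrN => /(_ yd s sab) /=.
have -> : Z t x v s + (y - Z t x v s) = y by ring.
by rewrite addr0.
Qed.

(** A t x v a b and its derivative B t x v a b are the derivatives of the
    trajectory Z t x v and of its velocity V t x v when the initial data (x, v)
    move in the direction (a, b): they solve the linearized equation along the
    trajectory. *)
Definition is_variation (A B : R -> R -> R -> R -> R -> R -> R) : Prop :=
  forall t x v a b, [/\ A t x v a b t = a, B t x v a b t = b,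
    forall s, is_derive s 1 (A t x v a b) (B t x v a b s) &
    forall s, is_derive s 1 (B t x v a b) (- (r s (Z t x v s) * A t x v a b s))].

Lemma variation_exists : exists A B, is_variation A B.
Proof.
have /choice[f Hf] : forall p : R * R * R * R * R, exists AB : (R -> R) * (R -> R),
    let: (t, x, v, a, b) := p in
    [/\ AB.1 t = a, AB.2 t = b,
      forall s, is_derive s 1 AB.1 (AB.2 s) &
      forall s, is_derive s 1 AB.2 (- (r s (Z t x v s) * AB.1 s))].
  move=> [[[[t x] v] a] b].
  have cq : continuous (fun s => r s (Z t x v s)).
    by apply: (@cont2_comp _ _ r id (Z t x v) cr _ (cZ (t := t) (x := x) (v := v))) => s;
      exact: cvg_id.
  have [A [B H]] := linear_ode_exists t a b cq (fun s => br s (Z t x v s)).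
  by exists (A, B).
exists (fun t x v a b => (f (t, x, v, a, b)).1),
  (fun t x v a b => (f (t, x, v, a, b)).2).
by move=> t x v a b; exact: (Hf (t, x, v, a, b)).
Qed.

Context (A B : R -> R -> R -> R -> R -> R -> R) (HA : is_variation A B).

Let At t x v a b : A t x v a b t = a. Proof. by have [] := HA t x v a b. Qed.
Let Bt t x v a b : B t x v a b t = b. Proof. by have [] := HA t x v a b. Qed.
Let DA t x v a b s : is_derive s 1 (A t x v a b) (B t x v a b s).
Proof. by have [_ _ + _] := HA t x v a b; apply. Qed.
Let DB t x v a b s :
  is_derive s 1 (B t x v a b) (- (r s (Z t x v s) * A t x v a b s)).
Proof. by have [_ _ _] := HA t x v a b; apply. Qed.

Lemma variation_bound t x v al be a b s : a <= t <= b -> a <= s <= b ->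
  `|A t x v al be s| <= growth K (b - a) * (`|al| + `|be|) /\
  `|B t x v al be s| <= growth K (b - a) * (`|al| + `|be|).
Proof.
move=> tab sab.
have e0 : 0 <= `|al| + `|be| by rewrite addr_ge0.
apply: (energy_bound (DA t x v al be) (DB t x v al be) tab K0 e0) => //.
- move=> s' _; rewrite normrN normrM (@le_trans _ _ (K * `|A t x v al be s'|)) //.
    by rewrite ler_wpM2r.
  by rewrite lerDl.
- by rewrite At lerDl.
- by rewrite Bt lerDr.
Qed.

(** The difference quotient of the flow solves the linearized equation exactly,
    except that the coefficient r is taken at a point between the two
    trajectories. These points tend uniformly to the trajectory, and
    linear_dependence applies. *)
Lemma variation_slope t x v al be s e : 0 < e ->
  exists2 d : R, 0 < d & forall h : R, `|h| < d ->
   `|Z t (x + h * al) (v + h * be) s - Z t x v s - A t x v al be s * h| <= e * `|h| /\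
   `|V t (x + h * al) (v + h * be) s - V t x v s - B t x v al be s * h| <= e * `|h|.
Proof.
move=> e0; pose a := Num.min t s; pose b := Num.max t s.
have tab : a <= t <= b by rewrite ge_min lexx le_max lexx.
have sab : a <= s <= b by rewrite ge_min lexx orbT le_max lexx orbT.
pose G := growth K (b - a); have G0 : 0 <= G := growth_ge0 _ _.
pose c : R := `|al| + `|be|; have c0 : 0 <= c by rewrite addr_ge0.
pose e' := e / (G + 1).
have e'0 : 0 < e' by rewrite divr_gt0 // ltr_wpDl.
have Gc0 : 0 <= G * c by rewrite mulr_ge0.
have e1 : 0 < e' / (G * c + 1) by rewrite divr_gt0 // ltr_wpDl.
have [d1 d10 H1] := @coefficient_near t x v a b _ e1.
exists (d1 / (G * c + 1)); first by rewrite divr_gt0 // ltr_wpDl.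
move=> h hd; have [->|h0] := eqVneq h 0.
  by rewrite !mul0r !addr0 !subrr !mulr0 !subr0 normr0 mulr0.
set Z' := Z t (x + h * al) (v + h * be); set V' := V t (x + h * al) (v + h * be).
have near_Z s' : a <= s' <= b -> `|Z' s' - Z t x v s'| <= G * (`|h| * c).
  move=> sab'; have hc0 : 0 <= `|h| * c by rewrite mulr_ge0.
  have hx : `|x + h * al - Z t x v t| <= `|h| * c.
    by rewrite Zt addrC addKr normrM ler_wpM2l // lerDl.
  have hv : `|v + h * be - V t x v t| <= `|h| * c.
    by rewrite Vt addrC addKr normrM ler_wpM2l // lerDr.
  by have [] := flow_dependence tab hc0 hx hv sab'.
have small s' : a <= s' <= b -> `|Z' s' - Z t x v s'| < d1.
  move=> /near_Z le; apply: le_lt_trans le _.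
  rewrite mulrCA; apply: (@le_lt_trans _ _ (`|h| * (G * c + 1))).
    by rewrite ler_wpM2l // lerDl.
  by rewrite -ltr_pdivlMr // ltr_wpDl.
(* y s' is the intermediate point at which r is taken *)
have /choice[y Hy] : forall s', exists y, `|y - Z t x v s'| <= `|Z' s' - Z t x v s'| /\
    E s' (Z' s') - E s' (Z t x v s') = r s' y * (Z' s' - Z t x v s').
  by move=> s'; have [y [y1 _ y2]] := mean_value (Z t x v s') (Z' s') (DE s'); exists y.
pose u (s' : R) : R := h^-1 * (Z' s' - Z t x v s').
pose u1 (s' : R) : R := h^-1 * (V' s' - V t x v s').
have Du s' : is_derive s' 1 u (u1 s').
  by apply: is_deriveZ; apply: is_deriveB; exact: DZ.
have Du1 s' : is_derive s' 1 u1 (- (r s' (y s') * u s')).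
  have -> : - (r s' (y s') * u s') = h^-1 * (- E s' (Z' s') - - E s' (Z t x v s')).
    by rewrite -opprD mulrN (Hy s').2 /u; ring.
  by apply: is_deriveZ; apply: is_deriveB; exact: DV.
have z1 s' : a <= s' <= b ->
    `|r s' (y s') - r s' (Z t x v s')| * `|A t x v al be s'| <= e'.
  move=> sab'.
  have le1 : `|r s' (y s') - r s' (Z t x v s')| <= e' / (G * c + 1).
    by apply/ltW/H1 => //; apply: le_lt_trans (Hy s').1 (small _ sab').
  have [le2 _] := @variation_bound t x v al be a b s' tab sab'.
  apply: (@le_trans _ _ (e' / (G * c + 1) * (G * c))); first by rewrite ler_pM.
  rewrite mulrAC ler_pdivrMr ?ltr_wpDl // ler_wpM2l ?(ltW e'0) //.
  by rewrite lerDl.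
have h1E (p q : R) : h^-1 * (p + h * q - p) - q = 0 by field.
have z2 : `|u t - A t x v al be t| <= e'.
  rewrite At /u /Z' !Zt h1E normr0.
  exact: ltW.
have z3 : `|u1 t - B t x v al be t| <= e'.
  rewrite Bt /u1 /V' !Vt h1E normr0.
  exact: ltW.
have [] := linear_dependence Du Du1 (DA _ _ _ _ _) (DB _ _ _ _ _) tab (ltW e'0)
  (fun s' => br s' (y s')) z1 z2 z3 sab.
have Ge : G * e' <= e.
  by rewrite /e' mulrCA ler_piMr ?(ltW e0) // ler_pdivrMr ?ltr_wpDl // mul1r lerDl.
have quot p q l : `|h^-1 * (p - q) - l| <= G * e' -> `|p - q - l * h| <= e * `|h|.
  move=> le; have -> : p - q - l * h = (h^-1 * (p - q) - l) * h by field.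
  by rewrite normrM ler_wpM2r // (le_trans le).
by move=> /quot le1 /quot le2.
Qed.

Lemma flow_near t x v a b e : a < t < b -> 0 < e ->
  exists2 d : R, 0 < d & forall t' x' v',
    `|t' - t| < d -> `|x' - x| < d -> `|v' - v| < d ->
    a <= t' <= b /\ forall s, a <= s <= b ->
      `|Z t' x' v' s - Z t x v s| < e /\ `|V t' x' v' s - V t x v s| < e.
Proof.
move=> /andP[at_ tb] e0.
pose G := growth K (b - a); have G0 : 0 <= G := growth_ge0 _ _.
pose e' := e / (G + 1) / 2.
have e'0 : 0 < e' by rewrite !divr_gt0 // ltr_wpDl.
have Ge : G * (e' + e') < e.
  rewrite /e' -splitr mulrA ltr_pdivrMr ?ltr_wpDl // mulrC ltr_pM2l // ltrDl //.
have cZt : {for t, continuous (Z t x v)} := is_derive_continuous (DZ t x v t).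
have cVt : {for t, continuous (V t x v)} := is_derive_continuous (DV t x v t).
have /cvgrPdist_lt/(_ _ e'0)/nbhs_ballP[d1 /= d10 H1] := cZt.
have /cvgrPdist_lt/(_ _ e'0)/nbhs_ballP[d2 /= d20 H2] := cVt.
exists (Num.min (Num.min d1 d2) (Num.min (Num.min (t - a) (b - t)) e')).
  by rewrite !lt_min d10 d20 !subr_gt0 at_ tb.
move=> t' x' v'; rewrite !lt_min => /andP[/andP[t1 t2] /andP[/andP[t3 t4] t5]].
move=> /andP[_ /andP[_ x5]] /andP[_ /andP[_ v5]].
have tab : a <= t' <= b by move: t3 t4; rewrite !ltr_norml; lra.
split => // s sab.
have z1 : `|x' - Z t x v t'| <= e' + e'.
  have := H1 t'; rewrite /ball /= distrC Zt => /(_ t1).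
  by move: x5; rewrite !ltr_norml ler_norml; lra.
have v1 : `|v' - V t x v t'| <= e' + e'.
  have := H2 t'; rewrite /ball /= distrC Vt => /(_ t2).
  by move: v5; rewrite !ltr_norml ler_norml; lra.
have ee0 : 0 <= e' + e' by rewrite addr_ge0 ?ltW.
have [h1 h2] := flow_dependence tab ee0 z1 v1 sab.
by split; [apply: le_lt_trans h1 _|apply: le_lt_trans h2 _].
Qed.

Lemma flow_continuous s : cont3 (fun t x v => Z t x v s) /\ cont3 (fun t x v => V t x v s).
Proof.
have H t x v e : 0 < e -> exists2 d : R, 0 < d & forall t' x' v',
    `|t' - t| < d -> `|x' - x| < d -> `|v' - v| < d ->
    `|Z t' x' v' s - Z t x v s| < e /\ `|V t' x' v' s - V t x v s| < e.
  move=> e0; pose a := Num.min (t - 1) s; pose b := Num.max (t + 1) s.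
  have tab : a < t < b by rewrite gt_min lt_max ltrDl ltr01 ltrBlDr ltrDl ltr01.
  have sab : a <= s <= b by rewrite ge_min lexx orbT le_max lexx orbT.
  have [d d0 Hd] := flow_near x v tab e0.
  by exists d => // t' x' v' ht hx hv; have [_] := Hd t' x' v' ht hx hv; apply.
split; apply/cont3P => t x v e e0; have [d d0 Hd] := H t x v e e0;
  by exists d => // t' x' v' ht hx hv; have [] := Hd t' x' v' ht hx hv.
Qed.

Lemma variation_continuous al be s :
  cont3 (fun t x v => A t x v al be s) /\ cont3 (fun t x v => B t x v al be s).
Proof.
have H t x v e : 0 < e -> exists2 d : R, 0 < d & forall t' x' v',
    `|t' - t| < d -> `|x' - x| < d -> `|v' - v| < d ->
    `|A t' x' v' al be s - A t x v al be s| < e /\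
    `|B t' x' v' al be s - B t x v al be s| < e.
  move=> e0; pose a := Num.min (t - 1) s; pose b := Num.max (t + 1) s.
  have tab : a < t < b by rewrite gt_min lt_max ltrDl ltr01 ltrBlDr ltrDl ltr01.
  have sab : a <= s <= b by rewrite ge_min lexx orbT le_max lexx orbT.
  have tab' : a <= t <= b by move: tab; lra.
  pose G := growth K (b - a); have G0 : 0 <= G := growth_ge0 _ _.
  pose c : R := `|al| + `|be|; have c0 : 0 <= c by rewrite addr_ge0.
  have Gc0 : 0 <= G * c by rewrite mulr_ge0.
  pose e' := e / (G + 1).
  have e'0 : 0 < e' by rewrite divr_gt0 // ltr_wpDl.
  have Ge : G * e' < e.
    by rewrite /e' mulrA ltr_pdivrMr ?ltr_wpDl // mulrC ltr_pM2l // ltrDl.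
  have e1 : 0 < e' / (G * c + 1) by rewrite divr_gt0 // ltr_wpDl.
  have [d1 d10 H1] := @coefficient_near t x v a b _ e1.
  have [d2 d20 H2] := flow_near x v tab d10.
  have cA : {for t, continuous (A t x v al be)} := is_derive_continuous (DA _ _ _ _ _ _).
  have cB : {for t, continuous (B t x v al be)} := is_derive_continuous (DB _ _ _ _ _ _).
  have /cvgrPdist_lt/(_ _ e'0)/nbhs_ballP[d3 /= d30 H3] := cA.
  have /cvgrPdist_lt/(_ _ e'0)/nbhs_ballP[d4 /= d40 H4] := cB.
  exists (Num.min d2 (Num.min d3 d4)); first by rewrite !lt_min d20 d30.
  move=> t' x' v'; rewrite !lt_min => /andP[t2 /andP[t3 t4]] /andP[x2 _] /andP[v2 _].
  have [tab2 HZ2] := H2 t' x' v' t2 x2 v2.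
  have z1 s' : a <= s' <= b -> `|r s' (Z t' x' v' s') - r s' (Z t x v s')| *
      `|A t x v al be s'| <= e'.
    move=> sab'.
    have le1 : `|r s' (Z t' x' v' s') - r s' (Z t x v s')| <= e' / (G * c + 1).
      by apply/ltW/H1 => //; have [] := HZ2 s' sab'.
    have [le2 _] := @variation_bound t x v al be a b s' tab' sab'.
    apply: (@le_trans _ _ (e' / (G * c + 1) * (G * c))); first by rewrite ler_pM.
    rewrite mulrAC ler_pdivrMr ?ltr_wpDl // ler_wpM2l ?(ltW e'0) //.
    by rewrite lerDl.
  have z2 : `|A t' x' v' al be t' - A t x v al be t'| <= e'.
    by have := H3 t'; rewrite /ball /= distrC !At => /(_ t3)/ltW.
  have z3 : `|B t' x' v' al be t' - B t x v al be t'| <= e'.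
    by have := H4 t'; rewrite /ball /= distrC !Bt => /(_ t4)/ltW.
  have [h1 h2] := @linear_dependence (A t' x' v' al be) (B t' x' v' al be)
    (A t x v al be) (B t x v al be) (fun s => r s (Z t x v s))
    (fun s => r s (Z t' x' v' s)) a b t' e'
    (DA _ _ _ _ _) (DB _ _ _ _ _) (DA _ _ _ _ _) (DB _ _ _ _ _)
    tab2 (ltW e'0) (fun s => br s _) z1 z2 z3 s sab.
  by split; [apply: le_lt_trans h1 _|apply: le_lt_trans h2 _].
split; apply/cont3P => t x v e e0; have [d d0 Hd] := H t x v e e0;
  by exists d => // t' x' v' ht hx hv; have [] := Hd t' x' v' ht hx hv.
Qed.

End Flow.

(** * The linear transport equation *)

Section Transport.
Context {R : realType}.
Implicit Types (a b c t x v e s y l : R).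

Lemma cont2_slice (h : R -> R -> R -> R) t : cont3 h -> cont2 (h t).
Proof.
move=> ch; apply: (@cont3_comp _ _ h (fun=> t) fst snd ch).
- by move=> z; exact: cvg_cst.
- by move=> z; exact: cvg_fst.
- by move=> z; exact: cvg_snd.
Qed.

Lemma cont3_proj : [/\ cont3 (fun t x v : R => t), cont3 (fun t x v : R => x) &
  cont3 (fun t x v : R => v)].
Proof.
split.
- by move=> z; apply: (@cvg_comp _ _ _ fst fst); exact: cvg_fst.
- by move=> z; apply: (@cvg_comp _ _ _ fst snd); [exact: cvg_fst|exact: cvg_snd].
- by move=> z; exact: cvg_snd.
Qed.

Lemma is_derive_vanish (g : R -> R) l v P : is_derive v 1 g l ->
  (forall u, P < `|u| -> g u = 0) -> P < `|v| -> l = 0.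
Proof.
move=> [_ <-] g0 Pv; rewrite -(derive_cst (0 : R) v (1 : R)).
apply: near_eq_derive.
have Pv0 : 0 < `|v| - P by rewrite subr_gt0.
have /cvgrPdist_lt/(_ _ Pv0) : (fun u : R => `|u|) @ v --> `|v| by apply: cvg_norm; exact: cvg_id.
by apply: filterS => u; rewrite ltr_norml => /andP[_ h]; apply: g0; move: h; lra.
Qed.

Context (E r : R -> R -> R) (K M : R) (om : R -> R).
Context (cE : cont2 E) (cr : cont2 r).
Context (DE : forall t x, is_derive x 1 (E t) (r t x)).
Context (bE : forall t x, `|E t x| <= M) (br : forall t x, `|r t x| <= K * om x).
Context (om0 : forall x, 0 <= om x) (om1 : forall x, om x <= 1) (K0 : 0 <= K).

Let M0 : 0 <= M := le_trans (normr_ge0 _) (bE 0 0).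

Let br' t x : `|r t x| <= K.
Proof. by rewrite (le_trans (br t x)) // ler_piMr. Qed.

(** Moving the starting time t' away from t while keeping (x, v) amounts, to
    first order, to following the trajectory backwards. *)
Lemma flow_time_derive (Z V : R -> R -> R -> R -> R) t x v : is_flow E Z V ->
  is_derive t 1 (fun t' => Z t' x v t) (- v) /\
  is_derive t 1 (fun t' => V t' x v t) (E t x).
Proof.
move=> HZ; split; apply/is_derive_slopeP => e e0.
  have d0 : 0 < e / (M + 1) by rewrite divr_gt0 // ltr_wpDl.
  exists (e / (M + 1)) => // t' td; have [Zt Vt DZ DV] := HZ t' x v.
  have [Zt0 _ _ _] := HZ t x v; rewrite Zt0.
  have [s [s1 _ Es]] := mean_value t' t DZ; rewrite Zt in Es.
  have -> : Z t' x v t - x - - v * (t' - t) = (V t' x v s - v) * (t - t').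
    by rewrite Es; ring.
  rewrite normrM (distrC t' t) ler_wpM2r // (le_trans (flow_velocity bE HZ _ _ _ _)) //.
  apply: (@le_trans _ _ (M * (e / (M + 1)))).
    by rewrite ler_wpM2l // (le_trans s1) // distrC ltW.
  by rewrite mulrCA ler_piMr ?(ltW e0) // ler_pdivrMr ?ltr_wpDl // mul1r lerDl.
have /cont2P/(_ t x e e0)[d1 d10 H1] := cE.
pose k := `|v| + M + 1.
have k0 : 0 < k by rewrite ltr_wpDl // addr_ge0.
have d0 : 0 < Num.min 1 (Num.min d1 (d1 / k)) by rewrite !lt_min ltr01 d10 divr_gt0.
exists (Num.min 1 (Num.min d1 (d1 / k))) => // t'.
rewrite !lt_min => /andP[td1 /andP[td2 td3]]; have [Zt Vt DZ DV] := HZ t' x v.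
have [_ Vt0 _ _] := HZ t x v; rewrite Vt0.
have [s [s1 s2 Es]] := mean_value t' t DV; rewrite Vt in Es.
have -> : V t' x v t - v - E t x * (t' - t) = (E s (Z t' x v s) - E t x) * (t' - t).
  by rewrite Es; ring.
rewrite normrM ler_wpM2r // ltW // H1 //.
  by apply: le_lt_trans s2 _; rewrite distrC.
apply: le_lt_trans (flow_position bE HZ _ _ _ _) _.
have s3 : `|s - t'| <= `|t' - t| by rewrite (distrC t' t).
apply: (@le_lt_trans _ _ (k * `|t' - t|)); last by rewrite mulrC -ltr_pdivlMr.
rewrite ler_pM // ?addr_ge0 ?mulr_ge0 // /k -addrA lerD2l.
rewrite (@le_trans _ _ M) ?lerDl // ler_piMr //.
by rewrite (le_trans s3) // ltW.
Qed.

Context (f0 gx gv : R -> R -> R) (S P b0 a0 c0 : R).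
Context (cf0 : cont2 f0) (cgx : cont2 gx) (cgv : cont2 gv).
Context (Dgx : forall x v, is_derive x 1 (f0^~ v) (gx x v)).
Context (Dgv : forall x v, is_derive v 1 (f0 x) (gv x v)).
Context (bf0 : forall x v, `|f0 x v| <= S).
Context (suppf0 : forall x v, P < `|v| -> f0 x v = 0).
Context (bgx : forall x v, `|gx x v| <= b0 * om x).
Context (bgv : forall x v, `|gv x v| <= a0).
Context (b00 : 0 <= b0) (c00 : 0 <= c0).
Context (omc : forall x y, `|y - x| <= P + 2 * M -> om y <= c0 * om x).

(** The solution is f t x v = f0 (Z t x v 0) (V t x v 0), constant along
    characteristics. By the group property it is also f t at the point where
    the particle starting from (x, v) at time t' is at time t, which gives its
    time derivative from its derivatives in (x, v). The factor om x in the bound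
    on fx has two sources: gx carries it, and gv is multiplied by the variation
    of the velocity, which is an integral of r along the trajectory. Velocities
    are bounded on the support, so positions change by a bounded amount and the
    weight by a bounded factor c0. *)
Lemma transport_exists : exists f ft fx fv : R -> R -> R -> R,
  [/\ forall d, C1on d f ft fx fv,
    forall t x v, is_derive t 1 (fun s => f s x v) (ft t x v),
    forall t x v, ft t x v + v * fx t x v - E t x * fv t x v = 0,
    forall x v, f 0 x v = f0 x v &
    forall t x v, 0 <= t <= 1 ->
      [/\ `|f t x v| <= S, P + M < `|v| -> f t x v = 0,
          `|fx t x v| <= c0 * (b0 + a0 * K) * growth K 1 * om x &
          `|fv t x v| <= (b0 + a0) * growth K 1]].
Proof.
have [Z [V HZ]] := flow_exists cE DE bE br'.
have [A [B HA]] := variation_exists cr br' HZ.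
have [cZ cV] := flow_continuous DE br' HZ 0.
pose f t x v := f0 (Z t x v 0) (V t x v 0).
pose fx t x v := gx (Z t x v 0) (V t x v 0) * A t x v 1 0 0 +
                 gv (Z t x v 0) (V t x v 0) * B t x v 1 0 0.
pose fv t x v := gx (Z t x v 0) (V t x v 0) * A t x v 0 1 0 +
                 gv (Z t x v 0) (V t x v 0) * B t x v 0 1 0.
pose ft t x v := - v * fx t x v + E t x * fv t x v.
have comp (h : R -> R -> R) : cont2 h -> cont3 (fun t x v => h (Z t x v 0) (V t x v 0)).
  by move=> ch; exact: cont2_comp ch cZ cV.
have cfx : cont3 fx.
  have [cA cB] := variation_continuous cr DE br' HZ HA 1 0 0.
  move=> z; apply: cvgD; apply: cvgM; [exact: (comp _ cgx)|exact: cA|exact: (comp _ cgv)|exact: cB].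
have cfv : cont3 fv.
  have [cA cB] := variation_continuous cr DE br' HZ HA 0 1 0.
  move=> z; apply: cvgD; apply: cvgM; [exact: (comp _ cgx)|exact: cA|exact: (comp _ cgv)|exact: cB].
have [ct cx cv] := cont3_proj.
have cft : cont3 ft.
  move=> z; apply: cvgD; apply: cvgM.
  - by apply: cvgN; exact: cv.
  - exact: cfx.
  - by have : cont3 (fun t x v => E t x) := cont2_comp cE ct cx; exact.
  - exact: cfv.
(* derivatives of the flow in the direction (al, be) *)
have Dflow t x v al be (p q : R -> R) y : p y = x -> q y = v ->
    (forall s, p s = x + (s - y) * al) -> (forall s, q s = v + (s - y) * be) ->
    is_derive y 1 (fun s => Z t (p s) (q s) 0) (A t x v al be 0) /\
    is_derive y 1 (fun s => V t (p s) (q s) 0) (B t x v al be 0).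
  move=> py qy Ep Eq; split; apply/is_derive_slopeP => e e0;
  have [d d0 Hd] := variation_slope cr DE br' HZ HA t x v al be 0 e0;
  exists d => // s sd; have [h1 h2] := Hd _ sd; by rewrite py qy Ep Eq.
have Dfx t x v : is_derive x 1 (fun y => f t y v) (fx t x v).
  have [||s|s|D1 D2] := Dflow t x v 1 0 id (fun=> v) x => //.
  - by rewrite mulr1 addrC subrK.
  - by rewrite mulr0 addr0.
  - exact: (chain2 cgx cgv Dgx Dgv D1 D2).
have Dfv t x v : is_derive v 1 (f t x) (fv t x v).
  have [||s|s|D1 D2] := Dflow t x v 0 1 (fun=> x) id v => //.
  - by rewrite mulr0 addr0.
  - by rewrite mulr1 addrC subrK.
  - exact: (chain2 cgx cgv Dgx Dgv D1 D2).
have Dft t x v : is_derive t 1 (fun s => f s x v) (ft t x v).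
  have [D1 D2] := flow_time_derive t x v HZ.
  have Ef : (fun s => f t (Z s x v t) (V s x v t)) = fun s => f s x v.
    apply/funext => s; rewrite /f.
    by have [-> ->] := flow_group DE br' HZ s x v t 0.
  have := chain2 (cont2_slice (t := t) cfx) (cont2_slice (t := t) cfv) (Dfx t) (Dfv t) D1 D2.
  have [Zt Vt _ _] := HZ t x v.
  rewrite Ef Zt Vt /ft [- v * _]mulrC [E t x * _]mulrC; exact.
exists f, ft, fx, fv; split.
- move=> d; split=> //; first exact: comp.
- by [].
- by move=> t x v; rewrite /ft; ring.
- by move=> x v; rewrite /f; have [-> -> _ _] := HZ 0 x v.
move=> t x v /andP[t0 t1].
have V0 s : 0 <= s <= 1 -> `|V t x v s - v| <= M.
  move=> /andP[s0 s1]; rewrite (le_trans (flow_velocity bE HZ _ _ _ _)) //.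
  by rewrite ler_piMr // ler_norml; lra.
have sup0 : P + M < `|v| -> P < `|V t x v 0|.
  move=> vP; have := V0 0 ltac:(lra); have := lerB_dist v (V t x v 0).
  by rewrite distrC; lra.
have Z0 s : `|v| <= P + M -> 0 <= s <= 1 -> om (Z t x v s) <= c0 * om x.
  move=> vP /andP[s0 s1]; apply: omc.
  have st : `|s - t| <= 1 by rewrite ler_norml; lra.
  rewrite (le_trans (flow_position bE HZ _ _ _ _)) //.
  apply: (@le_trans _ _ (`|v| + M)); last lra.
  rewrite (@le_trans _ _ (`|v| + M * `|s - t|)) //.
    by rewrite ler_piMr // addr_ge0 // mulr_ge0.
  by rewrite lerD2l ler_piMr.
have G0 : 0 <= growth K 1 := growth_ge0 _ _.
have a00 : 0 <= a0 := le_trans (normr_ge0 _) (bgv 0 0).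
have AB al be s : 0 <= s <= 1 ->
    `|A t x v al be s| <= growth K 1 * (`|al| + `|be|) /\
    `|B t x v al be s| <= growth K 1 * (`|al| + `|be|).
  move=> s01; rewrite -[X in growth K X]subr0.
  by apply: (variation_bound br' HA) => //; lra.
have gz : P + M < `|v| ->
    gx (Z t x v 0) (V t x v 0) = 0 /\ gv (Z t x v 0) (V t x v 0) = 0.
  move=> /sup0 vP; split; last exact: is_derive_vanish (Dgv _ _) (suppf0 _) vP.
  have := Dgx (Z t x v 0) (V t x v 0).
  have -> : f0^~ (V t x v 0) = cst 0 by apply/funext => y; exact: suppf0.
  by move=> [_ <-]; rewrite derive_cst.
have s01 : 0 <= (0 : R) <= 1 by rewrite lexx ler01.
have gvB p q : `|gv (Z t x v 0) (V t x v 0)| <= p -> `|q| <= growth K 1 ->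
    `|gv (Z t x v 0) (V t x v 0) * q| <= p * growth K 1.
  by move=> hp hq; rewrite normrM ler_pM.
split.
- exact: bf0.
- by move=> vP; rewrite /f suppf0 // sup0.
- have [vP|vP] := leP `|v| (P + M); last first.
    have [g1 g2] := gz vP; rewrite /fx g1 g2 !mul0r addr0 normr0.
    by rewrite !mulr_ge0 // addr_ge0 // mulr_ge0.
  have [A1 _] := AB 1 0 0 s01; rewrite normr1 normr0 addr0 mulr1 in A1.
  have B1 : `|B t x v 1 0 0| <= K * (c0 * om x) * growth K 1.
    have [At Bt _ DB] := HA t x v 1 0.
    have [s [h1 h2 h3]] := mean_value t 0 DB; move: h3; rewrite Bt subr0 => ->.
    have s01' : 0 <= s <= 1.
      by move: h1 h2; rewrite subr0 sub0r normrN (ger0_norm t0) !ler_norml; lra.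
    have [A2 _] := AB 1 0 s s01'; rewrite normr1 normr0 addr0 mulr1 in A2.
    rewrite sub0r mulrN mulNr opprK !normrM (ger0_norm t0).
    apply: (@le_trans _ _ (`|r s (Z t x v s)| * `|A t x v 1 0 s|)).
      by rewrite ler_piMr // mulr_ge0.
    rewrite ler_pM // (le_trans (br _ _)) // ler_wpM2l // Z0 //.
  rewrite /fx (le_trans (ler_normD _ _)) //.
  have -> : c0 * (b0 + a0 * K) * growth K 1 * om x =
    b0 * (c0 * om x) * growth K 1 + a0 * (K * (c0 * om x) * growth K 1) by ring.
  rewrite !normrM lerD // ler_pM //.
  by rewrite (le_trans (bgx _ _)) // ler_wpM2l // Z0.
- have [A1 B1] := AB 0 1 0 s01; rewrite normr1 normr0 add0r mulr1 in A1 B1.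
  rewrite /fv (le_trans (ler_normD _ _)) // mulrDl !normrM lerD // ler_pM //.
  by rewrite (le_trans (bgx _ _)) // ler_piMr.
Qed.

End Transport.

(** * Comparison on backward cones *)

Section Comparison.
Context {R : realType}.
Implicit Types (a b c d t x v e s y l M : R).

(** A maximum principle on the backward cone
    |v - v0| <= M (t0 - s), |x - x0| <= c (t0 - s) of the point (t0, x0, v0),
    with c = |v0| + M t0. Since c bounds the velocities and M the force in the cone, a backward
    characteristic step stays inside; at a maximum of w - B - eta s with s > 0
    such a step would increase the function. The field E enters only through
    its value at the maximum, so a bound on E is enough. *)
Lemma comparison_strict d (w wt wx wv : R -> R -> R -> R) (E : R -> R -> R) M
    (B b : R -> R) t0 x0 v0 :
  C1on d w wt wx wv -> 0 <= M -> (forall t x, 0 <= t <= d -> `|E t x| <= M) ->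
  (forall s, is_derive s 1 B (b s)) ->
  (forall t x v, 0 < t < d -> wt t x v + v * wx t x v - E t x * wv t x v <= b t) ->
  (forall x v, `|v - v0| <= M * t0 -> w 0 x v <= B 0) ->
  0 <= t0 -> t0 < d -> w t0 x0 v0 <= B t0.
Proof.
move=> [cw cwt cwx cwv [Dt Dx Dv]] M0 bE DB sub ini t00 t0d.
have half_lt (y : R) : 0 < y -> y / 2 < y by move=> y0; lra.
rewrite leNgt; apply/negP => gap.
pose eta := (w t0 x0 v0 - B t0) / (t0 + 1).
have eta0 : 0 < eta by rewrite divr_gt0 ?subr_gt0 // ltr_wpDl.
have etat : eta * t0 < w t0 x0 v0 - B t0.
  by rewrite /eta mulrAC ltr_pdivrMr ?ltr_wpDl // ltr_pM2l ?subr_gt0 // ltrDl.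
pose phi (z : R * R * R) := w z.1.1 z.1.2 z.2 - B z.1.1 - eta * z.1.1.
pose c := `|v0| + M * t0.
have c0 : 0 <= c by rewrite addr_ge0 // mulr_ge0.
pose gx (z : R * R * R) := c * (t0 - z.1.1) - `|z.1.2 - x0|.
pose gv (z : R * R * R) := M * (t0 - z.1.1) - `|z.2 - v0|.
have [ct cx cv] := @cont3_proj R.
have cgx : continuous gx.
  move=> z; apply: cvgB.
    by apply: cvgMr; apply: cvgB; [exact: cvg_cst|exact: ct].
  by apply: cvg_norm; apply: cvgB; [exact: cx|exact: cvg_cst].
have cgv : continuous gv.
  move=> z; apply: cvgB.
    by apply: cvgMr; apply: cvgB; [exact: cvg_cst|exact: ct].
  by apply: cvg_norm; apply: cvgB; [exact: cv|exact: cvg_cst].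
pose D := ((`[0, t0] `*` `[x0 - c * t0, x0 + c * t0]) `*` `[v0 - M * t0, v0 + M * t0])
  `&` (gx @^-1` [set y | 0 <= y] `&` gv @^-1` [set y | 0 <= y]).
have inD s x v : 0 <= s <= t0 -> `|x - x0| <= c * (t0 - s) ->
    `|v - v0| <= M * (t0 - s) -> D (s, x, v).
  move=> /andP[s0 st] hx hv; rewrite /D /gx /gv /= !in_itv /= !subr_ge0.
  have hx' : `|x - x0| <= c * t0 by rewrite (le_trans hx) // ler_wpM2l //; lra.
  have hv' : `|v - v0| <= M * t0 by rewrite (le_trans hv) // ler_wpM2l //; lra.
  rewrite s0 st hx hv; move: hx' hv'; rewrite !ler_norml => /andP[? ?] /andP[? ?].
  by split => //; split; [split => //|]; apply/andP; split; lra.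
have cD : compact D.
  apply: compact_closedI.
    by apply: compact_setX; [apply: compact_setX|]; exact: segment_compact.
  by apply: closedI; apply: preimage_closed => //; try exact: closed_ge.
have Dtop : D (t0, x0, v0).
  by apply: inD; rewrite ?subrr ?normr0 ?mulr0 ?lexx ?t00.
have cphi : {within D, continuous phi}.
  apply: continuous_subspaceT => z; apply: cvgB; last by apply: cvgMr; exact: ct.
  apply: cvgB; first exact: (cw z).
  apply: (@cvg_comp _ _ _ (fun z : R * R * R => z.1.1) B); first exact: ct.
  exact: is_derive_continuous (DB _).
have [[[s x] v]] := compact_EVT_max (ex_intro _ _ Dtop) cD cphi.
rewrite inE => -[[[/= s01 _] _] []]; rewrite /gx /gv /= !subr_ge0 => hx hv maxphi.
move: s01; rewrite in_itv /= => /andP[s0 st].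
have pos : 0 < phi (s, x, v).
  apply: lt_le_trans (maxphi (t0, x0, v0) _); last by rewrite inE.
  by rewrite /phi /=; lra.
have {s0}s0 : 0 < s.
  rewrite lt_neqAle s0 andbT; apply/eqP => s0'; move: pos.
  rewrite /phi /= -s0' mulr0 subr0 subr_gt0 ltNge ini //.
  by move: hv; rewrite -s0' subr0.
have vb : `|v| <= c.
  have := ler_distD v0 v 0; rewrite !subr0.
  have ts : t0 - s <= t0 by rewrite gerBl ltW.
  by have := ler_wpM2l M0 ts; move: hv; rewrite /c; clear; lra.
pose e := E s x.
have eM : `|e| <= M by apply: bE; rewrite ltW // (le_trans st) // ltW.
pose k := `|v| + `|e| + 3.
have k0 : 0 < k by rewrite /k ltr_wpDl // addr_ge0.
pose eps := eta / k.
have eps0 : 0 < eps by rewrite divr_gt0.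
have sd : 0 < s < d by rewrite s0 (le_lt_trans st).
have [d1 d10 H1] := @increment3 R w wx wv s x v eps cwx cwv Dx Dv eps0.
have [d2 d20 H2] := (is_derive_slopeP _ _ _).1 (Dt s x v sd) _ eps0.
have [d3 d30 H3] := (is_derive_slopeP _ _ _).1 (DB s) _ eps0.
pose h := Num.min s (Num.min (d1 / k / 2) (Num.min (d2 / 2) (d3 / 2))).
have h0 : 0 < h by rewrite /h !lt_min s0 !divr_gt0.
have hs : h <= s by rewrite /h ge_min lexx.
have hd1 : h * k < d1.
  have : h <= d1 / k / 2 by rewrite /h !ge_min lexx !orbT.
  rewrite -(ler_pM2r k0) => /le_lt_trans; apply.
  by rewrite mulrAC divfK ?gt_eqF // ltr_pdivrMr // ltr_pMr // ltr1n.
have hd2 : h < d2.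
  by apply: le_lt_trans (half_lt _ d20); rewrite /h !ge_min lexx !orbT.
have hd3 : h < d3.
  by apply: le_lt_trans (half_lt _ d30); rewrite /h !ge_min lexx !orbT.
have hh : `|s - h - s| = h by rewrite addrAC subrr sub0r normrN gtr0_norm.
have hvh : `|x - h * v - x| = h * `|v|.
  by rewrite addrAC subrr sub0r normrN normrM gtr0_norm.
have heh : `|v + h * e - v| = h * `|e|.
  by rewrite addrAC subrr add0r normrM gtr0_norm.
have := maxphi (s - h, x - h * v, v + h * e); rewrite inE.
have Dh : D (s - h, x - h * v, v + h * e).
  apply: inD.
  - by rewrite subr_ge0 hs (le_trans _ st) // lerBlDr lerDl ltW.
  - have -> : x - h * v - x0 = (x - x0) - h * v by ring.
    rewrite (le_trans (ler_normB _ _)) // normrM (gtr0_norm h0).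
    have := ler_wpM2l (ltW h0) vb; move: hx; clear; lra.
  - have -> : v + h * e - v0 = (v - v0) + h * e by ring.
    rewrite (le_trans (ler_normD _ _)) // normrM (gtr0_norm h0).
    have := ler_wpM2l (ltW h0) eM; move: hv; clear; lra.
move=> /(_ Dh); rewrite /phi /=; apply/negP; rewrite -ltNge.
have n1 : `|w (s - h) (x - h * v) (v + h * e) - w (s - h) x v - wx s x v * (- (h * v)) -
    wv s x v * (h * e)| <= eps * (h * (`|v| + `|e|)).
  have := H1 (s - h) (x - h * v) (v + h * e).
  rewrite hh hvh heh -mulrDr.
  have -> : x - h * v - x = - (h * v) by ring.
  have -> : v + h * e - v = h * e by ring.
  have a1 : 0 <= h * `|v| by rewrite mulr_ge0 // ltW.
  have a2 : 0 <= h * `|e| by rewrite mulr_ge0 // ltW.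
  have h3 : 0 <= h * 3 by rewrite mulr_ge0 // ltW.
  move: hd1; rewrite /k !mulrDr => hd1; clear - hd1 h0 a1 a2 h3.
  by apply; lra.
have n2 := H2 (s - h); rewrite hh in n2; have {}n2 := n2 hd2.
have n3 := H3 (s - h); rewrite hh in n3; have {}n3 := n3 hd3.
have hsub := ler_wpM2l (ltW h0) (sub s x v sd); rewrite -/e in hsub.
have sums : eps * (h * (`|v| + `|e|)) + eps * h + eps * h < eta * h.
  have -> : eta * h = eps * k * h by rewrite /eps divfK // gt_eqF.
  have : 0 < eps * h by rewrite mulr_gt0.
  by rewrite /k; clear; lra.
have Es : s - h - s = - h by ring.
move: n1 n2 n3; rewrite Es !ler_norml => /andP[n1 _] /andP[n2 _] /andP[_ n3].
by clear - n1 n2 n3 hsub sums; lra.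
Qed.


(** At t0 = d, where the time derivative may fail to exist, the inequality
    follows by continuity. *)
Lemma comparison d (w wt wx wv : R -> R -> R -> R) (E : R -> R -> R) M
    (B b : R -> R) t0 x0 v0 :
  C1on d w wt wx wv -> 0 <= M -> (forall t x, 0 <= t <= d -> `|E t x| <= M) ->
  (forall s, is_derive s 1 B (b s)) ->
  (forall t x v, 0 < t < d -> wt t x v + v * wx t x v - E t x * wv t x v <= b t) ->
  (forall x v, `|v - v0| <= M * t0 -> w 0 x v <= B 0) ->
  0 <= t0 <= d -> w t0 x0 v0 <= B t0.
Proof.
move=> Cw M0 bE DB sub ini /andP[t00]; rewrite le_eqVlt => /predU1P[t0d|t0d];
  last exact: comparison_strict Cw M0 bE DB sub ini t00 t0d.
move: t00; rewrite le_eqVlt => /predU1P[t00|t00].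
  by rewrite -t00; apply: ini; rewrite subrr normr0 mulr_ge0 // -t00.
rewrite leNgt; apply/negP => gap.
pose e := (w t0 x0 v0 - B t0) / 2.
have e0 : 0 < e by rewrite divr_gt0 // subr_gt0.
have [/cont3P/(_ t0 x0 v0 e e0)[d1 d10 H1] _ _ _ _] := Cw.
have cB : {for t0, continuous B} := is_derive_continuous (DB t0).
have /cvgrPdist_lt/(_ _ e0)/nbhs_ballP[d2 /= d20 H2] := cB.
pose h := Num.min (t0 / 2) (Num.min (d1 / 2) (d2 / 2)).
have h0 : 0 < h by rewrite /h !lt_min !divr_gt0.
have hd1 : h < d1.
  by apply: (@le_lt_trans _ _ (d1 / 2)); [rewrite /h !ge_min lexx !orbT|lra].
have hd2 : h < d2.
  by apply: (@le_lt_trans _ _ (d2 / 2)); [rewrite /h !ge_min lexx !orbT|lra].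
have ht : h <= t0 / 2 by rewrite /h ge_min lexx.
have le : w (t0 - h) x0 v0 <= B (t0 - h).
  apply: (@comparison_strict d w wt wx wv E M B b (t0 - h) x0 v0 Cw M0 bE DB sub);
    [move=> x v hv|lra..].
  by apply: ini; rewrite (le_trans hv) // ler_wpM2l //; lra.
have Eh : `|t0 - h - t0| = h by rewrite addrAC subrr sub0r normrN gtr0_norm.
have := H1 (t0 - h) x0 v0; rewrite Eh !subrr normr0 => /(_ hd1 d10 d10).
have := H2 (t0 - h); rewrite /ball /= distrC Eh => /(_ hd2).
by rewrite !ltr_norml /e; lra.
Qed.

Lemma cont3B (f g : R -> R -> R -> R) : cont3 f -> cont3 g ->
  cont3 (fun t x v => f t x v - g t x v).
Proof. by move=> cf cg z; apply: cvgB; [exact: cf|exact: cg]. Qed.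

Lemma cont3N (f : R -> R -> R -> R) : cont3 f -> cont3 (fun t x v => - f t x v).
Proof. by move=> cf z; apply: cvgN; exact: cf. Qed.

Lemma C1onB d (f ft fx fv g gt gx gv : R -> R -> R -> R) :
  C1on d f ft fx fv -> C1on d g gt gx gv ->
  C1on d (fun t x v => f t x v - g t x v) (fun t x v => ft t x v - gt t x v)
    (fun t x v => fx t x v - gx t x v) (fun t x v => fv t x v - gv t x v).
Proof.
move=> [c1 c2 c3 c4 [D1 D2 D3]] [e1 e2 e3 e4 [G1 G2 G3]].
split; [exact: cont3B..|split=> [t x v td|t x v|t x v]].
- exact: is_deriveB (D1 t x v td) (G1 t x v td).
- exact: is_deriveB (D2 t x v) (G2 t x v).
- exact: is_deriveB (D3 t x v) (G3 t x v).
Qed.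

Lemma C1onN d (f ft fx fv : R -> R -> R -> R) : C1on d f ft fx fv ->
  C1on d (fun t x v => - f t x v) (fun t x v => - ft t x v)
    (fun t x v => - fx t x v) (fun t x v => - fv t x v).
Proof.
move=> [c1 c2 c3 c4 [D1 D2 D3]].
split; [exact: cont3N..|split=> [t x v td|t x v|t x v]].
- exact: is_deriveN (D1 t x v td).
- exact: is_deriveN (D2 t x v).
- exact: is_deriveN (D3 t x v).
Qed.

Lemma comparison_norm d (w wt wx wv : R -> R -> R -> R) (E : R -> R -> R) M
    (B b : R -> R) t0 x0 v0 :
  C1on d w wt wx wv -> 0 <= M -> (forall t x, 0 <= t <= d -> `|E t x| <= M) ->
  (forall s, is_derive s 1 B (b s)) ->
  (forall t x v, 0 < t < d -> `|wt t x v + v * wx t x v - E t x * wv t x v| <= b t) ->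
  (forall x v, `|v - v0| <= M * t0 -> `|w 0 x v| <= B 0) ->
  0 <= t0 <= d -> `|w t0 x0 v0| <= B t0.
Proof.
move=> Cw M0 bE DB sub ini t0d; rewrite ler_norml; apply/andP; split.
  rewrite lerNl; apply: (@comparison d _ _ _ _ E M B b t0 x0 v0 (C1onN Cw) M0 bE DB) => //.
    by move=> t x v td; have := sub t x v td; rewrite ler_norml; lra.
  by move=> x v hv; have := ini x v hv; rewrite ler_norml; lra.
apply: (@comparison d _ _ _ _ E M B b t0 x0 v0 Cw M0 bE DB) => //.
  by move=> t x v td; have := sub t x v td; rewrite ler_norml; lra.
by move=> x v hv; have := ini x v hv; rewrite ler_norml; lra.
Qed.

Lemma transport_support d (f ft fx fv : R -> R -> R -> R) (E : R -> R -> R) M P t0 x0 v0 :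
  C1on d f ft fx fv -> 0 <= M -> (forall t x, 0 <= t <= d -> `|E t x| <= M) ->
  (forall t x v, 0 < t < d -> ft t x v + v * fx t x v - E t x * fv t x v = 0) ->
  (forall x v, P < `|v| -> f 0 x v = 0) ->
  0 <= t0 <= d -> P + M * t0 < `|v0| -> f t0 x0 v0 = 0.
Proof.
move=> Cf M0 bE eqn supp t0d Pv; apply/normr0_eq0/le_anti/andP; split => //.
apply: (@comparison_norm _ _ _ _ _ _ _ (cst 0) (cst 0) _ _ _ Cf M0 bE) => //.
- by move=> t x v td; rewrite eqn // normr0.
- move=> x v hv; rewrite supp ?normr0 //.
  by have := lerB_dist v0 v; rewrite distrC; lra.
Qed.

(** The difference f - g is transported by the field E2 with the source
    (E1 - E2) fv; the barrier is the primitive of A N exp (la t). *)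
Lemma transport_stability d (f ft fx fv g gt gx gv : R -> R -> R -> R)
    (E1 E2 : R -> R -> R) M A N la t0 x0 v0 :
  C1on d f ft fx fv -> C1on d g gt gx gv ->
  (forall t x v, 0 < t < d -> ft t x v + v * fx t x v - E1 t x * fv t x v = 0) ->
  (forall t x v, 0 < t < d -> gt t x v + v * gx t x v - E2 t x * gv t x v = 0) ->
  (forall x v, f 0 x v = g 0 x v) ->
  (forall t x, 0 <= t <= d -> `|E2 t x| <= M) ->
  (forall t x v, 0 <= t <= d -> `|fv t x v| <= A) ->
  (forall t x, 0 <= t <= d -> `|E1 t x - E2 t x| <= N * expR (la * t)) ->
  0 < la -> 0 <= N -> 0 <= t0 <= d ->
  `|f t0 x0 v0 - g t0 x0 v0| <= A / la * N * expR (la * t0).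
Proof.
move=> Cf Cg ef eg ini bE bA bN la0 N0 t0d.
have d0 : 0 <= d by move: t0d; lra.
have M0 : 0 <= M by apply: le_trans (bE 0 0 _); rewrite ?lexx.
have A0 : 0 <= A by apply: le_trans (bA 0 0 0 _); rewrite ?lexx.
pose B s := A / la * N * expR (la * s).
apply: (@comparison_norm _ _ _ _ _ E2 M B (fun s => A * N * expR (la * s))
  _ _ _ (C1onB Cf Cg)) => //.
- move=> s; have -> : A * N * expR (la * s) = A / la * N * (la * expR (la * s)).
    by field; rewrite gt_eqF.
  have := is_derive_expR_affine la 0 s; rewrite subr0 => D.
  have -> : B = fun s => A / la * N *: expR (la * (s - 0)).
    by apply/funext => r; rewrite subr0.
  exact: is_deriveZ.
- move=> t x v td; have td' : 0 <= t <= d by move: td; lra.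
  have -> : ft t x v - gt t x v + v * (fx t x v - gx t x v) -
      E2 t x * (fv t x v - gv t x v) = (E1 t x - E2 t x) * fv t x v.
    by have := ef t x v td; have := eg t x v td; lra.
  rewrite normrM mulrC -mulrA ler_pM //; [exact: bA|exact: bN].
- move=> x v _; rewrite ini subrr normr0 /B.
  by rewrite !mulr_ge0 ?expR_ge0 // invr_ge0 ltW.
Qed.

End Comparison.

(** * Integrals over segments *)

Section SegmentIntegral.
Context {R : realType}.
Implicit Types (a b c d t x v e s y l lo hi : R) (g h : R -> R).

Notation mu := (@lebesgue_measure R).

Definition itg a b g : R := \int[mu]_(y in `[a, b]) g y.

Lemma itg_integrable a b g : continuous g ->
  mu.-integrable `[a, b] (EFin \o g).
Proof.
move=> cg; apply: continuous_compact_integrable; first exact: segment_compact.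
exact: continuous_subspaceT.
Qed.

Lemma itgB a b g h : continuous g -> continuous h ->
  itg a b (fun y => g y - h y) = itg a b g - itg a b h.
Proof. by move=> cg ch; apply: RintegralB => //; exact: itg_integrable. Qed.

Lemma itgZ a b c g : continuous g -> itg a b (fun y => c * g y) = c * itg a b g.
Proof. by move=> cg; apply: RintegralZl => //; exact: itg_integrable. Qed.

Lemma itg_cst a b c : a <= b -> itg a b (fun=> c) = c * (b - a).
Proof.
move=> ab; rewrite /itg Rintegral_cst //.
have := @lebesgue_measure_itv R `[a, b]; rewrite /= lte_fin => E.
rewrite [X in fine X](_ : _ = if a < b then (b - a)%:E else 0%E); last exact: E.
by case: ltP => // ba; rewrite (@le_anti _ _ a b) ?ab // subrr.
Qed.

Lemma eq_itg a b g h : (forall y, a <= y <= b -> g y = h y) ->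
  itg a b g = itg a b h.
Proof.
by move=> gh; apply: eq_Rintegral => y; rewrite inE /= in_itv /= => /gh.
Qed.

Lemma itg_norm_le a b c g : a <= b -> continuous g ->
  (forall y, a <= y <= b -> `|g y| <= c) -> `|itg a b g| <= c * (b - a).
Proof.
move=> ab cg le; have ig := @itg_integrable a b g cg.
rewrite (le_trans (le_normr_Rintegral _ ig)) // -itg_cst //.
apply: le_Rintegral => //.
- by apply: (@itg_integrable a b (fun y => `|g y|)) => y; apply: cvg_norm; exact: cg.
- by apply: (@itg_integrable a b (fun=> c)) => y; exact: cvg_cst.
Qed.

Lemma itg_derive a b (G g : R -> R) : a <= b -> continuous g ->
  (forall y, is_derive y 1 G (g y)) -> itg a b g = G b - G a.
Proof.
rewrite le_eqVlt => /predU1P[->|ab] cg DG.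
  by rewrite /itg set_itv1 Rintegral_set1 subrr.
have cG := is_derive_continuousT DG.
rewrite /itg /Rintegral (@continuous_FTC2 _ g G a b ab) //.
- exact: continuous_subspaceT.
- split => [y _||].
  + by have [] := DG y.
  + exact/cvg_at_right_filter/cG.
  + exact/cvg_at_left_filter/cG.
- by move=> y _; rewrite derive1E; have [_ ->] := DG y.
Qed.

Lemma itg_param_continuous (T : topologicalType) a b (h : R * T -> R) : a <= b ->
  continuous h -> continuous (fun p => itg a b (fun s => h (s, p))).
Proof.
move=> ab ch p0; apply/cvgrPdist_le => e e0.
have e1 : 0 < e / (b - a + 1) by rewrite divr_gt0 // ltr_wpDl // subr_ge0.
have cs p : continuous (fun s => h (s, p)).
  move=> s; apply: (@cvg_comp _ _ _ (fun s => (s, p)) h _ (nbhs (s, p))).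
    exact: (cvg_pair (@cvg_id _ (nbhs s)) (@cvg_cst _ p _ _ _)).
  exact: (ch (s, p)).
have := tube p0 a b ch e1; apply: filterS => p Hp.
rewrite -itgB //; apply: (@le_trans _ _ (e / (b - a + 1) * (b - a))).
  apply: itg_norm_le => //; first by move=> s; apply: cvgB; exact: cs.
  by move=> s sab; rewrite distrC ltW // Hp.
rewrite mulrAC ler_pdivrMr ?ltr_wpDl ?subr_ge0 // ler_wpM2l ?(ltW e0) //.
by rewrite lerDl.
Qed.

Lemma mean_value_oo (f df : R -> R) lo hi s t :
  (forall x, lo < x < hi -> is_derive x 1 f (df x)) ->
  lo < s < hi -> lo < t < hi ->
  exists c, [/\ `|c - s| <= `|t - s|, `|c - t| <= `|t - s| &
    f t - f s = df c * (t - s)].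
Proof.
move=> Df.
suff H p q : p <= q -> lo < p < hi -> lo < q < hi ->
    exists c, p <= c <= q /\ f q - f p = df c * (q - p).
  move=> shi thi; have [st|/ltW ts] := leP s t.
    have [c [/andP[sc ct] E]] := H s t st shi thi; exists c; split => //;
    by rewrite ler_norml (ger0_norm (x := t - s)) ?subr_ge0//; lra.
  have [c [/andP[sc ct] E]] := H t s ts thi shi; exists c; split; last lra;
  by rewrite ler_norml (ler0_norm (x := t - s)) ?subr_le0//; lra.
move=> pq phi qhi.
have Dpq x : x \in `]p, q[ -> is_derive x 1 f (df x).
  by rewrite in_itv /= => xpq; apply: Df; lra.
have cf : {within `[p, q], continuous f}.
  apply: derivable_within_continuous => x; rewrite in_itv /= => xpq.
  by have [] := Df x ltac:(lra).
have [c] := MVT_segment pq Dpq cf.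
by rewrite in_itv /= => cpq E; exists c.
Qed.

(** Differentiation under the integral sign: the mean value theorem in s and
    the tube lemma make the difference quotient converge uniformly in y. *)
Lemma itg_param_derive a b (h ht : R -> R -> R) lo hi t : a <= b ->
  cont2 h -> cont2 ht ->
  (forall s y, lo < s < hi -> is_derive s 1 (h^~ y) (ht s y)) -> lo < t < hi ->
  is_derive t 1 (fun s => itg a b (h s)) (itg a b (ht t)).
Proof.
move=> ab ch cht Dh thi; apply/is_derive_slopeP => e e0.
have cs (k : R -> R -> R) s : cont2 k -> continuous (k s).
  move=> ck; apply: (@cont2_comp _ _ k (fun=> s) id ck).
    by move=> y; exact: cvg_cst.
  by move=> y; exact: cvg_id.
have e1 : 0 < e / (b - a + 1) by rewrite divr_gt0 // ltr_wpDl // subr_ge0.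
have ch' : continuous (fun z : R * R => ht z.2 z.1).
  by apply: (cont2_comp cht) => z; [exact: cvg_snd|exact: cvg_fst].
have /nbhs_ballP[d1 /= d10 H1] := tube t a b ch' e1.
pose d := Num.min d1 (Num.min (t - lo) (hi - t)).
have d0 : 0 < d by rewrite !lt_min d10 !subr_gt0.
exists d => // s; rewrite !lt_min => /andP[sd1 /andP[sd2 sd3]].
have shi : lo < s < hi by move: sd2 sd3; rewrite !ltr_norml; lra.
rewrite -itgB; [|exact: cs..].
have -> : itg a b (fun y => h s y - h t y) - itg a b (ht t) * (s - t) =
    itg a b (fun y => (h s y - h t y) - (s - t) * ht t y).
  rewrite (@itgB a b (fun y => h s y - h t y) (fun y => (s - t) * ht t y)).
  - by rewrite itgZ; [ring|exact: cs].
  - by move=> y; apply: cvgB; exact: cs.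
  - by move=> y; apply: cvgMr; exact: cs.
apply: (@le_trans _ _ ((e / (b - a + 1) * `|s - t|) * (b - a))).
  apply: itg_norm_le => //.
    move=> y; apply: cvgB; last by apply: cvgMr; exact: cs.
    by apply: cvgB; exact: cs.
  move=> y yab; have [c [c1 c2 ->]] := mean_value_oo (fun s => @Dh s y) thi shi.
  have -> : ht c y * (s - t) - (s - t) * ht t y = (ht c y - ht t y) * (s - t) by ring.
  rewrite normrM ler_wpM2r // ltW // (H1 c) //=.
  by rewrite /ball /= distrC; apply: le_lt_trans c1 _.
rewrite -mulrA (mulrC `|s - t|) mulrA ler_wpM2r //.
rewrite mulrAC ler_pdivrMr ?ltr_wpDl ?subr_ge0 // ler_wpM2l ?(ltW e0) //.
by rewrite lerDl.
Qed.

End SegmentIntegral.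

(** * Integrals over the line and half-lines *)

Section LineIntegral.
Context {R : realType}.
Implicit Types (a b c d t x v e s y l : R) (g : R -> R).

Notation mu := (@lebesgue_measure R).

Lemma Rintegral_exhaust (D : set R) g : measurable D ->
  mu.-integrable D (EFin \o g) ->
  (fun n : nat => \int[mu]_(y in D `&` `[- n%:R, n%:R]) g y) @ \oo -->
  \int[mu]_(y in D) g y.
Proof.
move=> mD ig; have /integrableP[mg _] := ig.
pose F (n : nat) : R -> \bar R := EFin \o (g \_ `[- n%:R, n%:R]).
have [|||||_ _] := @dominated_convergence _ _ _ mu D mD F (EFin \o g) (abse \o (EFin \o g)).
- move=> n; apply/measurable_EFinP; apply/measurable_restrict => //.
  apply: measurable_funS (_ : measurable_fun D g) => //.
  exact/measurable_EFinP.
- by [].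
- apply: aeW => x Dx; apply: cvg_near_cst; near=> n.
  rewrite /F /= patchE mem_set // /= in_itv /= -ler_norml.
  by near: n; exact: nbhs_infty_ger.
- exact: integrable_abse.
- apply: aeW => x n Dx; rewrite /F /= patchE; case: ifPn => // _.
  by rewrite normr0 lee_fin.
rewrite -(fineK (@integrable_fin_num _ _ _ mu D mD _ ig)) => /fine_cvg.
apply: cvg_trans; apply: near_eq_cvg; near=> n.
rewrite /= /Rintegral integral_mkcondr; congr fine; apply: eq_integral => y _.
by rewrite /F /= !patchE; case: ifPn.
Unshelve. all: by end_near. Qed.


(** The half-line integrals are limits of integrals over the segments cut out
    by [- n, n], by dominated convergence. *)
Lemma halfline_integrals_le g x c : mu.-integrable setT (EFin \o g) ->
  (forall a b, a <= b -> `|itg a b g| <= c) ->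
  `|\int[mu]_(y in `]-oo, x]) g y| <= c /\ `|\int[mu]_(y in `[x, +oo[) g y| <= c.
Proof.
move=> ig H.
have main (D : set R) : measurable D -> (\forall n \near \oo,
    exists a b, a <= b /\ D `&` `[- n%:R, n%:R] = [set` `[a, b]]) ->
    `|\int[mu]_(y in D) g y| <= c.
  move=> mD near_D.
  have igD : mu.-integrable D (EFin \o g) by apply: integrableS ig.
  have /cvg_norm cv := Rintegral_exhaust mD igD.
  have E := cvg_lim (@Rhausdorff R) cv; rewrite -E.
  apply: limr_le; first by apply/cvg_ex; eexists; exact: cv.
  by apply: filterS near_D => n [a [b [ab Dab]]]; rewrite Dab; exact: H.
split; apply: main => //.
  near=> n; exists (- n%:R), x.
  have xn : `|x| <= n%:R by near: n; exact: nbhs_infty_ger.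
  split; first by move: xn; rewrite ler_norml => /andP[].
  apply/seteqP; split => y /=; rewrite !in_itv /=.
    by move=> [-> /andP[-> _]].
  move=> /andP[ny yx]; split => //; rewrite ny /= (le_trans yx) //.
  exact: le_trans (ler_norm _) xn.
near=> n; exists x, (n%:R).
have xn : `|x| <= n%:R by near: n; exact: nbhs_infty_ger.
split; first exact: le_trans (ler_norm _) xn.
apply/seteqP; split => y /=; rewrite !in_itv /= ?andbT.
  by move=> [-> /andP[_ ->]].
move=> /andP[xy yn]; split => //; rewrite yn andbT (le_trans _ xy) //.
by move: xn; rewrite ler_norml => /andP[].
Unshelve. all: by end_near. Qed.

Lemma Rintegral_support Q g : (forall y, Q < `|y| -> g y = 0) ->
  \int[mu]_y g y = itg (- Q) Q g.
Proof.
move=> g0; rewrite /itg [RHS]Rintegral_mkcond; apply: eq_Rintegral => y _.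
rewrite patchE; case: ifPn => //; rewrite notin_setE /= in_itv /= -ler_norml => /negP.
by rewrite -ltNge => /g0.
Qed.

Lemma integrable_support Q g : continuous g -> (forall y, Q < `|y| -> g y = 0) ->
  mu.-integrable setT (EFin \o g).
Proof.
move=> cg g0; have /integrable_mkcond : mu.-integrable `[- Q, Q] (EFin \o g).
  exact: itg_integrable.
move=> /(_ (measurable_itv _)); apply: eq_integrable => // y _.
rewrite /= patchE; case: ifPn => //; rewrite notin_setE /= in_itv /= -ler_norml => /negP.
by rewrite -ltNge => /g0 ->.
Qed.

End LineIntegral.

(** * The spatial weight *)

Section Weight.
Context {R : realType}.
Implicit Types (x y p D : R).

Notation mu := (@lebesgue_measure R).

Lemma weight_ge1 x : 1 <= weight x.
Proof.
by rewrite /weight -[leLHS]sqrtr1 ler_sqrt ?ltr_wpDr // lerDl sqr_ge0.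
Qed.

Lemma weight_gt0 x : 0 < weight x.
Proof. exact: lt_le_trans (weight_ge1 x). Qed.

Definition decay p x : R := weight x `^ (- p).

Lemma decay_gt0 p x : 0 < decay p x.
Proof. by rewrite powR_gt0 // weight_gt0. Qed.

Lemma decay_le1 p x : 0 <= p -> decay p x <= 1.
Proof.
move=> p0; rewrite /decay powRN invf_le1 ?powR_gt0 ?weight_gt0 //.
have e : 1 = 1 `^ p :> R by rewrite powR1.
rewrite [leLHS]e; apply: ge0_ler_powR => //; rewrite ?nnegrE ?ler01 ?(ltW (weight_gt0 _)) //.
exact: weight_ge1.
Qed.

Lemma le_decay p c x a : a * weight x `^ p <= c <-> a <= c * decay p x.
Proof.
by rewrite /decay powRN ler_pdivlMr // powR_gt0 // weight_gt0.
Qed.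

Lemma weight_shift D x y : `|y - x| <= D -> weight x <= (1 + D) * weight y.
Proof.
move=> yx; have D0 : 0 <= D by apply: le_trans yx.
rewrite -(ler_pXn2r (ltn0Sn 1)) ?nnegrE ?mulr_ge0 ?sqrtr_ge0 ?addr_ge0 //.
rewrite exprMn !sqr_sqrtr ?addr_ge0 ?sqr_ge0 //.
have h : `|x| <= `|y| + D.
  by have := lerB_dist x y; rewrite distrC; lra.
have h2 : `|x| ^+ 2 <= (`|y| + D) ^+ 2.
  by rewrite ler_pXn2r ?nnegrE // addr_ge0.
have := sqr_ge0 (`|y| - 1); have := normr_ge0 y.
move: h2; rewrite !expr2; move: `|y| `|x| => b a h2 b0 h3.
have : 0 <= D * (1 + b * b - 2 * b) by rewrite mulr_ge0 //; lra.
have : 0 <= (D * D) * (b * b) by rewrite !mulr_ge0.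
have : 0 <= D * (b * b) by rewrite !mulr_ge0.
nra.
Qed.

Lemma decay_shift p D x y : 0 <= p -> `|y - x| <= D ->
  decay p y <= (1 + D) `^ p * decay p x.
Proof.
move=> p0 yx; have D0 : 0 <= D by apply: le_trans yx.
have yD := weight_shift yx.
have wx := weight_gt0 x; have wy := weight_gt0 y.
rewrite /decay !powRN ler_pdivlMr ?powR_gt0 // mulrC.
rewrite ler_pdivrMr ?powR_gt0 // -powRM ?addr_ge0 ?(ltW wy) //.
apply: ge0_ler_powR => //; rewrite nnegrE ?mulr_ge0 ?addr_ge0 // ltW //.
Qed.

Lemma decay_continuous p : continuous (decay p).
Proof.
move=> x; apply: (@cvg_comp _ _ _ (@weight R) (fun a => a `^ (- p)) _
  (nbhs (weight x))); last first.
  exact: is_derive_continuous (is_derive1_powR (- p) (weight_gt0 x)).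
apply: (@cvg_comp _ _ _ (fun x => 1 + `|x| * `|x|) Num.sqrt); last exact: sqrt_continuous.
by apply: cvgD; [exact: cvg_cst|apply: cvgM; apply: cvg_norm; exact: cvg_id].
Qed.

(** On [0, +oo[ the primitive (1 + x)^(1 - p) / (1 - p) is explicit and tends
    to 0 because p > 1. *)
Lemma power_decay_integrable p : 1 < p ->
  mu.-integrable setT (EFin \o (fun x => (1 + `|x|) `^ (- p))).
Proof.
move=> p1; pose psi x := (1 + `|x|) `^ (- p).
have base x : 0 < 1 + `|x| by rewrite ltr_wpDr.
have psi0 x : 0 <= psi x by rewrite powR_ge0.
have cpsi : continuous psi.
  move=> x; apply: (@cvg_comp _ _ _ (fun x => 1 + `|x|) (fun a => a `^ (- p))).
    by apply: cvgD; [exact: cvg_cst|apply: cvg_norm; exact: cvg_id].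
  exact: is_derive_continuous (is_derive1_powR (- p) (base x)).
have mpsi : measurable_fun setT psi by exact: continuous_measurable_fun.
apply/integrableP; split; first exact/measurable_EFinP.
under eq_integral do rewrite /= ger0_norm //.
rewrite ge0_symfun_integralT //; last by move=> x; rewrite /psi /= normrN.
rewrite -set_itvcy.
pose Psi x := (1 + x) `^ (1 - p) / (1 - p).
have q0 : 1 - p < 0 by lra.
have DPsi x : 0 <= x -> is_derive x 1 Psi (psi x).
  move=> x0; have x1 : 0 < 1 + x by rewrite ltr_wpDr.
  have D1 : is_derive x 1 (fun x : R => 1 + x) 1.
    by rewrite -[X in is_derive _ _ _ X]add0r; apply: is_deriveD.
  have D2 := @is_derive1_comp _ _ _ _ _ _ (is_derive1_powR (1 - p) x1) D1.
  have -> : psi x = (1 - p)^-1 *: ((1 - p) * (1 + x) `^ (1 - p - 1) * 1).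
    rewrite /psi ger0_norm // mulr1 /GRing.scale /= mulrA mulVf ?lt_eqF // mul1r.
    by congr powR; lra.
  have -> : Psi = fun y => (1 - p)^-1 *: ((1 + y) `^ (1 - p)).
    by apply/funext => y; rewrite /Psi /= /GRing.scale /= mulrC.
  exact: is_deriveZ D2.
rewrite (@ge0_continuous_FTC2y _ psi Psi 0 0) //.
- by rewrite -EFinB -EFinM ltry.
- exact: continuous_subspaceT.
- apply/cvgrPdist_lt => e e0.
  pose T := (e * (p - 1))^-1 `^ (p - 1)^-1.
  have ep : 0 < e * (p - 1) by rewrite mulr_gt0 //; lra.
  have T0 : 0 < T by rewrite powR_gt0 // invr_gt0.
  near=> x.
  have xT : T < 1 + x by rewrite -ltrBlDl; near: x; apply: nbhs_pinfty_gt; exact: num_real.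
  have x0 : 0 <= x by near: x; apply: nbhs_pinfty_ge; exact: num_real.
  have h : (e * (p - 1))^-1 < (1 + x) `^ (p - 1).
    have -> : (e * (p - 1))^-1 = T `^ (p - 1).
      rewrite /T -powRrM mulVf ?gt_eqF ?subr_gt0 // powRr1 // invr_ge0 ltW //.
    by apply: gt0_ltr_powR; rewrite ?nnegrE ?subr_gt0 // ltW // ltr_wpDr.
  rewrite sub0r normrN /Psi normrM normfV (ltr0_norm q0) opprB.
  rewrite ger0_norm ?powR_ge0 // ltr_pdivrMr ?subr_gt0 //.
  have -> : 1 - p = - (p - 1) by lra.
  by rewrite powRN -[ltRHS]invrK ltf_pV2 ?posrE ?invr_gt0 // powR_gt0 // ltr_wpDr.
- by move=> x /ltW/DPsi[].
- apply: cvg_at_right_filter; exact: is_derive_continuous (DPsi 0 (lexx 0)).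
- by move=> x; rewrite in_itv /= andbT => /ltW/DPsi[_ <-]; rewrite derive1E.
Unshelve. all: by end_near. Qed.

Lemma decay_integrable p : 1 < p -> mu.-integrable setT (EFin \o decay p).
Proof.
move=> p1; have p0 : 0 <= p by lra.
have := integrableZl measurableT (2 `^ p) (power_decay_integrable p1).
apply: le_integrable => //.
  by apply/measurable_EFinP; apply: continuous_measurable_fun; exact: decay_continuous.
move=> x _ /=; rewrite lee_fin (ger0_norm (powR_ge0 _ _)).
rewrite [leRHS]ger0_norm ?mulr_ge0 ?powR_ge0 //.
have x1 : 0 < 1 + `|x| by rewrite ltr_wpDr.
have le : 1 + `|x| <= 2 * weight x.
  rewrite -(ler_pXn2r (ltn0Sn 1)) ?nnegrE ?mulr_ge0 ?sqrtr_ge0 ?addr_ge0 //.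
  rewrite exprMn sqr_sqrtr ?addr_ge0 ?sqr_ge0 // !expr2.
  by have := normr_ge0 x; have := sqr_ge0 (`|x| - 1); rewrite expr2; nra.
rewrite /decay !powRN ler_pdivlMr ?powR_gt0 //.
rewrite mulrC ler_pdivrMr ?powR_gt0 ?weight_gt0 //.
rewrite -powRM // ?(ltW (weight_gt0 _)) //.
by apply: ge0_ler_powR; rewrite ?nnegrE ?mulr_ge0 // ltW // weight_gt0.
Qed.

End Weight.

(** * The field of a density on the line *)

Section HalfLineField.
Context {R : realType}.
Implicit Types (a b c K t x v e s y : R) (g h : R -> R).

Notation mu := (@lebesgue_measure R).

Definition field_of g x : R :=
  2^-1 * (\int[mu]_(y in `]-oo, x]) g y - \int[mu]_(y in `[x, +oo[) g y).

Lemma field_of_dist_le g h x c :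
  mu.-integrable setT (EFin \o g) -> mu.-integrable setT (EFin \o h) ->
  (forall a b, a <= b -> `|itg a b (fun y => g y - h y)| <= c) ->
  `|field_of g x - field_of h x| <= c.
Proof.
move=> ig ih H.
have igh : mu.-integrable setT (EFin \o (fun y => g y - h y)).
  have := integrableB measurableT ig ih.
  by apply: eq_integrable => // y _ /=; rewrite EFinB.
have [h1 h2] := halfline_integrals_le x igh H.
rewrite /field_of -mulrBr.
have sub (D : set R) : measurable D -> \int[mu]_(y in D) (g y - h y) =
    \int[mu]_(y in D) g y - \int[mu]_(y in D) h y.
  move=> mD; apply: RintegralB => //.
    by apply: integrableS ig.
  by apply: integrableS ih.
move: h1 h2; rewrite !sub //.
set p := \int[mu]_(y in `]-oo, x]) g y; set q := \int[mu]_(y in `]-oo, x]) h y.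
set p' := \int[mu]_(y in `[x, +oo[) g y; set q' := \int[mu]_(y in `[x, +oo[) h y.
by rewrite !ler_norml; lra.
Qed.

(** The field is the integral over ]-oo, x] minus half of the total charge. *)
Lemma field_of_derive g x : continuous g -> mu.-integrable setT (EFin \o g) ->
  is_derive x 1 (field_of g) (g x).
Proof.
move=> cg ig.
have -> : field_of g = fun x => \int[mu]_(y in `]-oo, x]) g y - 2^-1 * \int[mu]_y g y.
  apply/funext => z; rewrite /field_of.
  have := @Rintegral_itvB R g -oo%O +oo%O z; rewrite set_itvNyy => /(_ ig isT isT).
  rewrite Rintegral_itv_obnd_cbnd; last by apply: integrableS ig.
  by move=> <-; field.
have [D E] : derivable (fun x => \int[mu]_(y in `]-oo, x]) g y) x 1 /\
    derive1 (fun x => \int[mu]_(y in `]-oo, x]) g y) x = g x.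
  apply: (@continuous_FTC1 R g -oo%O x (x + 1)) => //; first by rewrite ltrDl.
  - by apply: integrableS ig.
  - by rewrite ltNyr.
  - exact: cg.
rewrite -[g x]subr0; apply: is_deriveB.
by apply: (DeriveDef D); rewrite -derive1E.
Qed.

Lemma field_of_le g (om : R -> R) K x : measurable_fun setT g -> 0 <= K ->
  mu.-integrable setT (EFin \o om) ->
  (forall y, `|g y| <= K * om y) ->
  mu.-integrable setT (EFin \o g) /\ `|field_of g x| <= K * \int[mu]_y om y.
Proof.
move=> mg K0 iom le.
have iKom : mu.-integrable setT (EFin \o (fun y => K * om y)).
  have := integrableZl measurableT K iom.
  by apply: eq_integrable => // y _ /=; rewrite EFinM.
have ig : mu.-integrable setT (EFin \o g).
  apply: le_integrable iKom => //; first exact/measurable_EFinP.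
  move=> y _; rewrite /= lee_fin (le_trans (le y)) //; exact: ler_norm.
split => //.
have bnd (D : set R) : measurable D -> `|\int[mu]_(y in D) g y| <= K * \int[mu]_y om y.
  move=> mD; have igD : mu.-integrable D (EFin \o g) by apply: integrableS ig.
  rewrite (le_trans (le_normr_Rintegral _ igD)) // Rintegral_mkcond -RintegralZl //.
  have ian : mu.-integrable setT (EFin \o (fun y => `|g y|)).
    by apply: integrable_norm.
  apply: le_Rintegral => //.
    have /integrable_mkcond : mu.-integrable D (EFin \o (fun y => `|g y|)).
      by apply: integrableS ian.
    by move=> /(_ mD); apply: eq_integrable => // y _; rewrite /= restrict_EFin.
  move=> y _; rewrite patchE; case: ifPn => _ //.
  exact: le_trans (normr_ge0 _) (le y).
have h1 := bnd `]-oo, x]%classic (measurable_itv _).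
have h2 := bnd `[x, +oo[%classic (measurable_itv _).
rewrite /field_of; move: h1 h2.
move: (K * _) (\int[mu]_(y in `]-oo, x]) g y) (\int[mu]_(y in `[x, +oo[) g y) => k q q'.
by rewrite !ler_norml; lra.
Qed.

End HalfLineField.

(** * Conservation of charge *)

Section Charge.
Context {R : realType}.
Implicit Types (a b c d Q t x v e s y : R) (w wt wx wv f ft fx fv : R -> R -> R -> R).

Lemma cont3_v f t x : cont3 f -> continuous (f t x).
Proof.
move=> cf; apply: (@cont3_comp _ _ f (fun=> t) (fun=> x) id cf).
- by move=> z; exact: cvg_cst.
- by move=> z; exact: cvg_cst.
- by move=> z; exact: cvg_id.
Qed.

Lemma cont3_vmul f : cont3 f -> cont3 (fun t x v => v * f t x v).
Proof.
move=> cf z; apply: cvgM; last exact: cf.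
by have [_ _ cv] := @cont3_proj R; exact: cv.
Qed.

Lemma cont3_tv f x : cont3 f -> cont2 (fun t v => f t x v).
Proof.
move=> cf; apply: (@cont3_comp _ _ f fst (fun=> x) snd cf).
- by move=> z; exact: cvg_fst.
- by move=> z; exact: cvg_cst.
- by move=> z; exact: cvg_snd.
Qed.

Lemma cont2_itg f a b : a <= b -> cont3 f -> cont2 (fun t x => itg a b (f t x)).
Proof.
move=> ab cf.
have ch : continuous (fun z : R * (R * R) => f z.2.1 z.2.2 z.1).
  apply: (cont3_comp cf); last by move=> z; exact: cvg_fst.
  - by move=> z; apply: (@cvg_comp _ _ _ snd fst); [exact: cvg_snd|exact: cvg_fst].
  - by move=> z; apply: (@cvg_comp _ _ _ snd snd); exact: cvg_snd.
exact: (itg_param_continuous ab ch).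
Qed.

Lemma cont2_snd (h : R -> R -> R) t : cont2 h -> continuous (h t).
Proof.
move=> ch; apply: (@cont2_comp _ _ h (fun=> t) id ch).
- by move=> z; exact: cvg_cst.
- by move=> z; exact: cvg_id.
Qed.

Lemma cont2_fst (h : R -> R -> R) x : cont2 h -> continuous (h^~ x).
Proof.
move=> ch; apply: (@cont2_comp _ _ h id (fun=> x) ch).
- by move=> z; exact: cvg_id.
- by move=> z; exact: cvg_cst.
Qed.

(** The force term E fv integrates to zero in v, since E does not depend on v
    and f vanishes at both ends. *)
Lemma mass_conservation d Q f ft fx fv (E : R -> R -> R) t x : 0 <= Q ->
  C1on d f ft fx fv ->
  (forall t x v, 0 < t < d -> ft t x v + v * fx t x v - E t x * fv t x v = 0) ->
  (forall t x v, 0 <= t <= d -> Q <= `|v| -> f t x v = 0) -> 0 < t < d ->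
  itg (- Q) Q (ft t x) = - itg (- Q) Q (fun v => v * fx t x v).
Proof.
move=> Q0 [cf cft cfx cfv [_ _ Dv]] eqn supp td.
have QQ : - Q <= Q by lra.
have td' : 0 <= t <= d by lra.
have cvx : continuous (fun v => v * fx t x v) := cont3_v (cont3_vmul cfx).
have Ev : itg (- Q) Q (fun v => E t x * fv t x v) = 0.
  rewrite itgZ; last exact: cont3_v.
  rewrite (itg_derive QQ (cont3_v cfv) (Dv t x)).
  by rewrite !supp ?subrr ?mulr0 // ?normrN ger0_norm.
have -> : itg (- Q) Q (ft t x) =
    itg (- Q) Q (fun v => E t x * fv t x v - v * fx t x v).
  by apply: eq_itg => v _; have := eqn t x v td; lra.
rewrite itgB ?Ev ?sub0r //.
by move=> v; apply: cvgMr; exact: cont3_v.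
Qed.

Lemma density_derive d Q w wt wx wv t x : 0 <= Q -> C1on d w wt wx wv -> 0 < t < d ->
  is_derive t 1 (fun s => itg (- Q) Q (w s x)) (itg (- Q) Q (wt t x)).
Proof.
move=> Q0 [cw cwt _ _ [Dt _ _]] td; have QQ : - Q <= Q by lra.
apply: (@itg_param_derive R (- Q) Q (fun s v => w s x v) (fun s v => wt s x v) 0 d) => //.
- exact: cont3_tv.
- exact: cont3_tv.
Qed.

Lemma flux_bound Q c (g : R -> R) : 0 <= Q -> 0 <= c -> continuous g ->
  (forall v, - Q <= v <= Q -> `|g v| <= c) ->
  `|itg (- Q) Q (fun v => v * g v)| <= 2 * Q ^+ 2 * c.
Proof.
move=> Q0 c0 cg le; have QQ : - Q <= Q by lra.
have -> : 2 * Q ^+ 2 * c = (Q * c) * (Q - - Q) by ring.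
apply: itg_norm_le => //.
  by move=> v; apply: cvgM; [exact: cvg_id|exact: cg].
by move=> v vQ; rewrite normrM ler_pM // ?le // ler_norml.
Qed.

(** The time derivative of the density is minus the integral of v wx, so a
    bound on wx at x bounds the change of the density at x. *)
Lemma density_growth d Q w wt wx wv t x L : 0 <= Q -> C1on d w wt wx wv ->
  (forall t x, 0 < t < d ->
    itg (- Q) Q (wt t x) = - itg (- Q) Q (fun v => v * wx t x v)) ->
  0 <= L -> (forall t v, 0 <= t <= d -> `|wx t x v| <= L) -> 0 <= t <= d ->
  `|itg (- Q) Q (w t x) - itg (- Q) Q (w 0 x)| <= 2 * Q ^+ 2 * L * t.
Proof.
move=> Q0 Cw cons L0 bL /andP[t0 td]; have QQ : - Q <= Q by lra.
have [cw _ cwx _ _] := Cw.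
pose c := 2 * Q ^+ 2 * L.
have Dlin s : is_derive s 1 (fun s => c * s) c.
  by rewrite -[X in is_derive _ _ _ X]mulr1; apply: is_deriveZ.
have -> : 2 * Q ^+ 2 * L * t = c * t - c * 0 by rewrite mulr0 subr0.
apply: (@increment_norm_le R (fun s => itg (- Q) Q (w s x))
  (fun s => itg (- Q) Q (wt s x)) (fun s => c * s) (fun=> c) 0 t t0 _
  (is_derive_continuousT Dlin) _ (fun s _ => Dlin s)).
- exact: (cont2_fst (cont2_itg QQ cw)).
- by move=> s sd; apply: (density_derive x Q0 Cw); lra.
- move=> s sd /=; rewrite cons ?normrN; last lra.
  by apply: flux_bound => //; [exact: cont3_v|move=> v _; apply: bL; lra].
Qed.

(** The charge of a segment only changes through the fluxes at its two ends,
    and these are bounded by the supremum of w alone. This controls the field,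
    which is an integral over the whole line. Decay of w in x could not be used
    instead: far away the solutions are close to F translated in v by time
    integrals of the fields, and two fields may have different limits there. *)
Lemma charge_growth d Q w wt wx wv (G b : R -> R) a c t1 t2 : 0 <= Q ->
  C1on d w wt wx wv ->
  (forall t x, 0 < t < d ->
    itg (- Q) Q (wt t x) = - itg (- Q) Q (fun v => v * wx t x v)) ->
  (forall t x v, 0 <= t <= d -> `|w t x v| <= b t) ->
  (forall t, is_derive t 1 G (4 * Q ^+ 2 * b t)) ->
  a <= c -> 0 <= t1 -> t1 <= t2 -> t2 <= d ->
  `|itg a c (fun y => itg (- Q) Q (w t2 y)) - itg a c (fun y => itg (- Q) Q (w t1 y))|
    <= G t2 - G t1.
Proof.
move=> Q0 Cw cons bw DG ac t10 t12 t2d; have QQ : - Q <= Q by lra.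
have [cw cwt cwx _ [_ Dx _]] := Cw.
have cI : cont2 (fun t y => itg (- Q) Q (w t y)) := cont2_itg QQ cw.
have cIt : cont2 (fun t y => itg (- Q) Q (wt t y)) := cont2_itg QQ cwt.
have DI t : 0 < t < d -> is_derive t 1 (fun t => itg a c (fun y => itg (- Q) Q (w t y)))
    (itg a c (fun y => itg (- Q) Q (wt t y))).
  move=> td; apply: (itg_param_derive ac cI cIt _ td) => s y sd.
  exact: density_derive Q0 Cw sd.
have cII : continuous (fun t => itg a c (fun y => itg (- Q) Q (w t y))).
  have ch : continuous (fun z : R * R => itg (- Q) Q (w z.2 z.1)).
    by apply: (cont2_comp cI) => z; [exact: cvg_snd|exact: cvg_fst].
  exact: (itg_param_continuous ac ch).
apply: (@increment_norm_le R _ (fun t => itg a c (fun y => itg (- Q) Q (wt t y)))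
  G _ t1 t2 t12 cII (is_derive_continuousT DG) _ (fun s _ => DG s)).
- by move=> t td; apply: DI; lra.
move=> t td /=; have td1 : 0 < t < d by lra.
have td2 : 0 <= t <= d by lra.
have b0 : 0 <= b t by apply: le_trans (bw t 0 0 td2).
pose J y := itg (- Q) Q (fun v => v * w t y v).
have DJ y : is_derive y 1 J (itg (- Q) Q (fun v => v * wx t y v)).
  have cs (k : R -> R -> R -> R) : cont3 k -> cont2 (fun y v => v * k t y v).
    by move=> ck; exact: (cont2_slice (t := t) (cont3_vmul ck)).
  apply: (@itg_param_derive R (- Q) Q (fun y v => v * w t y v)
    (fun y v => v * wx t y v) (y - 1) (y + 1) y QQ (cs _ cw) (cs _ cwx)); lra.
have -> : itg a c (fun y => itg (- Q) Q (wt t y)) = - (J c - J a).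
  have <- : itg a c (fun y => itg (- Q) Q (fun v => v * wx t y v)) = J c - J a.
    by apply: itg_derive => //; exact: (cont2_snd (cont2_itg QQ (cont3_vmul cwx))).
  rewrite -[RHS]mulN1r -itgZ; last exact: (cont2_snd (cont2_itg QQ (cont3_vmul cwx))).
  by apply: eq_itg => y _; rewrite cons // mulN1r.
rewrite normrN (le_trans (ler_normB _ _)) //.
have -> : 4 * Q ^+ 2 * b t = 2 * Q ^+ 2 * b t + 2 * Q ^+ 2 * b t by ring.
by apply: lerD; apply: flux_bound => //; try exact: cont3_v; move=> v _; apply: bw.
Qed.

End Charge.

(** * Stability of the self-consistent field *)

Section Stability.
Context {R : realType}.
Implicit Types (a b c d Q S t x v e s y u la : R) (f ft fx fv g gt gx gv : R -> R -> R -> R).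

Notation mu := (@lebesgue_measure R).
Notation half := (2^-1 : R).

(** The mean value theorem bounds the increments of g n by values of r n, and
    the bound passes to the limit. *)
Lemma limit_derive (g r : nat -> R -> R) (G rho : R -> R) B B' x :
  (forall n x, is_derive x 1 (g n) (r n x)) ->
  (forall n x, `|g n x - G x| <= B * half ^+ n) ->
  (forall n x, `|r n x - rho x| <= B' * half ^+ n) ->
  continuous rho -> is_derive x 1 G (rho x).
Proof.
move=> Dg gG rrho crho; apply/is_derive_slopeP => e e0.
have /cvgrPdist_lt/(_ _ e0)/nbhs_ballP[d /= d0 Hd] := crho x.
exists d => // y yd; rewrite -subr_le0.
apply: (@geometric_le0 R (2 * B + B' * `|y - x|)) => n.
have [c [cx _ Ec]] := mean_value x y (Dg n).
have h1 : `|rho c - rho x| <= e.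
  by rewrite distrC ltW // Hd // /ball /= distrC; apply: le_lt_trans cx yd.
have -> : G y - G x - rho x * (y - x) =
    (r n c - rho c) * (y - x) + (rho c - rho x) * (y - x)
    - (g n y - G y) + (g n x - G x) by move: Ec; lra.
have n1 : `|(r n c - rho c) * (y - x)| <= B' * half ^+ n * `|y - x|.
  by rewrite normrM ler_wpM2r.
have n2 : `|(rho c - rho x) * (y - x)| <= e * `|y - x|.
  by rewrite normrM ler_wpM2r.
have n3 := gG n y; have n4 := gG n x.
rewrite lerBlDr; move: n1 n2 n3 n4; rewrite !ler_norml; lra.
Qed.

Lemma rho_itg (F : R -> R) f Q t x : (forall v, Q < `|v| -> F v = 0) ->
  (forall v, Q < `|v| -> f t x v = 0) ->
  rho F f t x = itg (- Q) Q (fun v => F v - f t x v).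
Proof.
by move=> F0 f0; apply: Rintegral_support => v vQ; rewrite F0 // f0 // subrr.
Qed.

(** The background F cancels in the difference of the densities. *)
Lemma efield_dist_le (F : R -> R) f g Q t s x c : continuous F -> 0 <= Q ->
  (forall v, Q < `|v| -> F v = 0) ->
  cont3 f -> cont3 g ->
  (forall x v, Q < `|v| -> f t x v = 0) -> (forall x v, Q < `|v| -> g s x v = 0) ->
  mu.-integrable setT (fun x => (rho F f t x)%:E) ->
  mu.-integrable setT (fun x => (rho F g s x)%:E) ->
  (forall a b, a <= b ->
    `|itg a b (fun y => itg (- Q) Q (f t y)) - itg a b (fun y => itg (- Q) Q (g s y))| <= c) ->
  `|efield F f t x - efield F g s x| <= c.
Proof.
move=> cF Q0 F0 cf cg f0 g0 irf irg H; have QQ : - Q <= Q by lra.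
have cif : continuous (fun y => itg (- Q) Q (f t y)) := cont2_snd (cont2_itg QQ cf).
have cig : continuous (fun y => itg (- Q) Q (g s y)) := cont2_snd (cont2_itg QQ cg).
apply: (@field_of_dist_le R (rho F f t) (rho F g s) x c irf irg) => a b ab.
have -> : itg a b (fun y => rho F f t y - rho F g s y) =
    itg a b (fun y => itg (- Q) Q (g s y) - itg (- Q) Q (f t y)).
  apply: eq_itg => y _; rewrite (@rho_itg F f Q t y F0 (f0 y)) (@rho_itg F g Q s y F0 (g0 y)).
  have cft : continuous (f t y) := cont3_v cf.
  have cgs : continuous (g s y) := cont3_v cg.
  by rewrite !itgB //; ring.
by rewrite itgB // distrC; exact: H.
Qed.

Lemma scaled_exp_derive c la t :
  is_derive t 1 (fun t => c * expR (la * t)) (c * (la * expR (la * t))).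
Proof.
have -> : (fun t => c * expR (la * t)) = fun t => c *: expR (la * (t - 0)).
  by apply/funext => s; rewrite subr0.
have := is_derive_expR_affine la 0 t; rewrite subr0 => D.
exact: is_deriveZ.
Qed.

(** The difference of the fields is controlled by the supremum of f - g through
    charge_growth; integrating the barrier in time gains a factor 1 / la. *)
Lemma field_stability (F : R -> R) d Q f ft fx fv g gt gx gv (E1 E2 : R -> R -> R) B la t x :
  continuous F -> 0 <= Q -> (forall v, Q < `|v| -> F v = 0) ->
  C1on d f ft fx fv -> C1on d g gt gx gv ->
  (forall t x v, 0 < t < d -> ft t x v + v * fx t x v - E1 t x * fv t x v = 0) ->
  (forall t x v, 0 < t < d -> gt t x v + v * gx t x v - E2 t x * gv t x v = 0) ->
  (forall t x v, 0 <= t <= d -> Q <= `|v| -> f t x v = 0) ->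
  (forall t x v, 0 <= t <= d -> Q <= `|v| -> g t x v = 0) ->
  (forall x v, f 0 x v = g 0 x v) ->
  (forall t, 0 <= t <= d -> mu.-integrable setT (fun x => (rho F f t x)%:E)) ->
  (forall t, 0 <= t <= d -> mu.-integrable setT (fun x => (rho F g t x)%:E)) ->
  0 < la -> 0 <= B ->
  (forall t x v, 0 <= t <= d -> `|f t x v - g t x v| <= B * expR (la * t)) ->
  0 <= t <= d ->
  `|efield F f t x - efield F g t x| <= 4 * Q ^+ 2 / la * B * expR (la * t).
Proof.
move=> cF Q0 F0 Cf Cg ef eg sf sg ini irf irg la0 B0 bw td.
have QQ : - Q <= Q by lra.
have [cf cft cfx _ _] := Cf; have [cg cgt cgx _ _] := Cg.
have cif s : continuous (fun y => itg (- Q) Q (f s y)) := cont2_snd (cont2_itg QQ cf).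
have cig s : continuous (fun y => itg (- Q) Q (g s y)) := cont2_snd (cont2_itg QQ cg).
apply: (@efield_dist_le F f g Q t t x _ cF Q0 F0 cf cg _ _ (irf t td) (irg t td)).
- by move=> y v /ltW; exact: sf.
- by move=> y v /ltW; exact: sg.
move=> a b ab.
have cons s y : 0 < s < d -> itg (- Q) Q (fun v => ft s y v - gt s y v) =
    - itg (- Q) Q (fun v => v * (fx s y v - gx s y v)).
  move=> sd.
  have c1 : continuous (ft s y) := cont3_v cft.
  have c2 : continuous (gt s y) := cont3_v cgt.
  have c3 : continuous (fun v => v * fx s y v) := cont3_v (cont3_vmul cfx).
  have c4 : continuous (fun v => v * gx s y v) := cont3_v (cont3_vmul cgx).
  rewrite itgB // (mass_conservation y Q0 Cf ef sf sd) (mass_conservation y Q0 Cg eg sg sd).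
  rewrite -opprD; congr (- _); rewrite -itgB //.
  by apply: eq_itg => v _; ring.
pose G s := 4 * Q ^+ 2 / la * B * expR (la * s).
have DG s : is_derive s 1 G (4 * Q ^+ 2 * (B * expR (la * s))).
  have -> : 4 * Q ^+ 2 * (B * expR (la * s)) =
      4 * Q ^+ 2 / la * B * (la * expR (la * s)) by field; rewrite gt_eqF.
  exact: scaled_exp_derive.
have /andP[t0 td'] := td.
have := charge_growth Q0 (C1onB Cf Cg) cons bw DG ab (lexx 0) t0 td'.
have -> : itg a b (fun y => itg (- Q) Q (fun v => f 0 y v - g 0 y v)) = 0.
  have -> : itg a b (fun y => itg (- Q) Q (fun v => f 0 y v - g 0 y v)) =
      itg a b (fun=> 0).
    apply: eq_itg => y _; have -> : itg (- Q) Q (fun v => f 0 y v - g 0 y v) =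
        itg (- Q) Q (fun=> 0) by apply: eq_itg => v _; rewrite ini subrr.
    by rewrite itg_cst // mul0r.
  by rewrite itg_cst // mul0r.
have -> : itg a b (fun y => itg (- Q) Q (fun v => f t y v - g t y v)) =
    itg a b (fun y => itg (- Q) Q (f t y)) - itg a b (fun y => itg (- Q) Q (g t y)).
  rewrite -itgB //; apply: eq_itg => y _.
  have c1 : continuous (f t y) := cont3_v cf.
  have c2 : continuous (g t y) := cont3_v cg.
  by rewrite itgB.
rewrite subr0 => H; apply: le_trans H _.
rewrite /G lerBlDr lerDl mulr_ge0 ?expR_ge0 // mulr_ge0 // divr_ge0 ?(ltW la0) //.
by rewrite mulr_ge0 // sqr_ge0.
Qed.

Lemma field_time_lipschitz (F : R -> R) d Q f ft fx fv (E : R -> R -> R) S t s x :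
  continuous F -> 0 <= Q -> (forall v, Q < `|v| -> F v = 0) ->
  C1on d f ft fx fv ->
  (forall t x v, 0 < t < d -> ft t x v + v * fx t x v - E t x * fv t x v = 0) ->
  (forall t x v, 0 <= t <= d -> Q <= `|v| -> f t x v = 0) ->
  (forall t, 0 <= t <= d -> mu.-integrable setT (fun x => (rho F f t x)%:E)) ->
  (forall t x v, 0 <= t <= d -> `|f t x v| <= S) ->
  0 <= s <= d -> 0 <= t <= d ->
  `|efield F f t x - efield F f s x| <= 4 * Q ^+ 2 * S * `|t - s|.
Proof.
move=> cF Q0 F0 Cf ef sf irf bS.
wlog st : s t / s <= t => [H sd td|sd td].
  have [st|/ltW ts] := leP s t; first exact: H.
  by rewrite distrC (distrC t s); exact: H.
have [cf cft cfx _ _] := Cf.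
apply: (@efield_dist_le F f f Q t s x _ cF Q0 F0 cf cf _ _ (irf t td) (irf s sd)).
- by move=> y v /ltW; exact: sf.
- by move=> y v /ltW; exact: sf.
move=> a b ab.
pose c := 4 * Q ^+ 2 * S.
have DG u : is_derive u 1 (fun u => c * u) (4 * Q ^+ 2 * (fun=> S) u).
  by rewrite -[X in is_derive _ _ _ X]mulr1; apply: is_deriveZ.
have /andP[s0 sd'] := sd; have /andP[t0 td'] := td.
have := @charge_growth R d Q f ft fx fv (fun u => c * u) (fun=> S) a b s t Q0 Cf
  (fun u y => mass_conservation y Q0 Cf ef sf) bS DG ab s0 st td'.
by rewrite (ger0_norm (x := t - s)) ?subr_ge0 // mulrBr.
Qed.

End Stability.

(** * Extension beyond the time interval *)

Section Clamp.
Context {R : realType}.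
Implicit Types (d t s : R).

Definition clamp d t : R := Num.max 0 (Num.min t d).

Lemma clamp_itv d t : 0 <= d -> 0 <= clamp d t <= d.
Proof. by move=> d0; rewrite /clamp le_max lexx ge_max d0 ge_min lexx orbT. Qed.

Lemma clamp_id d t : 0 <= t <= d -> clamp d t = t.
Proof. by move=> /andP[t0 td]; rewrite /clamp min_l // max_r. Qed.

Lemma clamp_lipschitz d t s : `|clamp d t - clamp d s| <= `|t - s|.
Proof.
have Hmax (a b c : R) : `|Num.max c a - Num.max c b| <= `|a - b|.
  have := ler_norm (a - b); have := ler_norm (b - a); rewrite (distrC b a) => h1 h2.
  by case: (leP c a) => ?; case: (leP c b) => ?; rewrite ler_norml; lra.
have Hmin (a b c : R) : `|Num.min a c - Num.min b c| <= `|a - b|.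
  have := ler_norm (a - b); have := ler_norm (b - a); rewrite (distrC b a) => h1 h2.
  by case: (leP a c) => ?; case: (leP b c) => ?; rewrite ler_norml; lra.
exact: le_trans (Hmax _ _ _) (Hmin _ _ _).
Qed.

Lemma clamp_continuous d : continuous (clamp d).
Proof.
move=> t; apply/cvgrPdist_le => e e0; apply/nbhs_ballP; exists e => // s.
by rewrite /ball /= => ts; rewrite (le_trans (clamp_lipschitz _ _ _)) // ltW.
Qed.

End Clamp.

(** * From a field to the next field *)

Section LocalExistence.
Context {R : realType}.
Implicit Types (d t x v y : R) (E r : R -> R -> R) (f ft fx fv : R -> R -> R -> R).

Notation mu := (@lebesgue_measure R).
Notation half := (2^-1 : R).

Definition mass (om : R -> R) : R := \int[mu]_y om y.

Definition field_ok (K M : R) (om : R -> R) E r : Prop :=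
  [/\ cont2 E, cont2 r, forall t x, is_derive x 1 (E t) (r t x),
      forall t x, `|E t x| <= M & forall t x, `|r t x| <= K * om x].

(** What transport_exists provides, with constants that do not depend on the
    field. The time 1 is an upper bound for the lengths of time considered. *)
Definition transported (Q S L A : R) (om : R -> R) (f0 : R -> R -> R) E f ft fx fv : Prop :=
  [/\ forall d, C1on d f ft fx fv,
      forall t x v, is_derive t 1 (fun s => f s x v) (ft t x v),
      forall t x v, ft t x v + v * fx t x v - E t x * fv t x v = 0,
      forall x v, f 0 x v = f0 x v &
      forall t x v, 0 <= t <= 1 ->
        [/\ `|f t x v| <= S, Q <= `|v| -> f t x v = 0,
            `|fx t x v| <= L * om x & `|fv t x v| <= A]].

Context (om : R -> R) (om_gt0 : forall x, 0 < om x) (om_le1 : forall x, om x <= 1).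
Context (iom : mu.-integrable setT (EFin \o om)).
Context (F : R -> R) (f0 : R -> R -> R) (Q S L A N0 d : R).
Context (cF : continuous F) (Q0 : 0 <= Q) (F0 : forall v, Q < `|v| -> F v = 0).
Context (L0 : 0 <= L) (N00 : 0 <= N0) (d0 : 0 < d) (d1 : d <= 1).
Context (small_d : 2 * Q ^+ 2 * L * d <= 1).
Context (init : forall x, `|itg (- Q) Q (fun v => F v - f0 x v)| <= N0 * om x).

Local Notation K := (N0 + 1).
Local Notation M := (K * mass om).
Let QQ : - Q <= Q. Proof. by rewrite (le_trans _ Q0) // oppr_le0. Qed.
Let K0 : 0 <= K. Proof. by rewrite addr_ge0. Qed.

Let dens f t x := itg (- Q) Q (fun v => F v - f t x v).
Let trans := transported Q S L A om f0.

Lemma transported_itv E f ft fx fv t x v : trans E f ft fx fv -> 0 <= t <= d ->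
  [/\ `|f t x v| <= S, Q <= `|v| -> f t x v = 0,
      `|fx t x v| <= L * om x & `|fv t x v| <= A].
Proof.
move=> [_ _ _ _ H] td; apply: H; move: td => /andP[-> td]; exact: le_trans td d1.
Qed.

(** The density is at most N0 om x at time 0 and grows by at most
    2 Q^2 L d om x <= om x on [0, d]. *)
Lemma transported_density E f ft fx fv t x : trans E f ft fx fv -> 0 <= t <= d ->
  rho F f t x = dens f t x /\ `|dens f t x| <= K * om x.
Proof.
move=> T td; split.
  by apply: rho_itg => // v /ltW; have [_ + _ _] := transported_itv x v T td; apply.
have [C1 _ eqn ini _] := T; have [cf cft cfx _ _] := C1 d.
have supp s y v : 0 <= s <= d -> Q <= `|v| -> f s y v = 0.
  by move=> sd; have [] := transported_itv y v T sd.
have cons s y : 0 < s < d -> itg (- Q) Q (ft s y) =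
    - itg (- Q) Q (fun v => v * fx s y v).
  by move=> sd; apply: (mass_conservation y Q0 (C1 d) _ supp sd) => *; exact: eqn.
have bfx s v : 0 <= s <= d -> `|fx s x v| <= L * om x.
  by move=> sd; have [] := transported_itv x v T sd.
have Lom : 0 <= L * om x by rewrite mulr_ge0 // ltW.
have := density_growth Q0 (C1 d) cons Lom bfx td.
have c1 s : continuous (f s x) := cont3_v cf.
have c0 : continuous (f0 x).
  have -> : f0 x = f 0 x by apply/funext => v; rewrite ini.
  exact: c1.
have -> : itg (- Q) Q (f 0 x) = itg (- Q) Q (f0 x) by apply: eq_itg => v _; exact: ini.
have := init x; rewrite /dens !itgB // => h1 h2.
have h3 : 2 * Q ^+ 2 * (L * om x) * t <= om x.
  have -> : 2 * Q ^+ 2 * (L * om x) * t = (2 * Q ^+ 2 * L * t) * om x by ring.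
  rewrite ler_piMl ?(ltW (om_gt0 x)) //; apply: le_trans small_d.
  by rewrite ler_wpM2l ?mulr_ge0 ?sqr_ge0 //; case/andP: td.
move: h1 h2 h3; rewrite mulrDl mul1r !ler_norml; lra.
Qed.

Lemma transported_rho E f ft fx fv t : trans E f ft fx fv -> 0 <= t <= d ->
  [/\ continuous (rho F f t), mu.-integrable setT (fun x => (rho F f t x)%:E) &
      forall x, `|efield F f t x| <= M].
Proof.
move=> T td; have [C1 _ _ _ _] := T; have [cf _ _ _ _] := C1 d.
have cd : cont3 (fun t x v => F v - f t x v).
  move=> z; apply: cvgB; last exact: cf.
  by apply: (@cvg_comp _ _ _ snd F); [exact: cvg_snd|exact: cF].
have Er : rho F f t = dens f t.
  by apply/funext => x; have [] := transported_density x T td.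
have cr : continuous (rho F f t) by rewrite Er; exact: (cont2_snd (cont2_itg QQ cd)).
have le x : `|rho F f t x| <= K * om x.
  by rewrite Er; have [] := transported_density x T td.
have mr : measurable_fun setT (rho F f t) by exact: continuous_measurable_fun.
split => //; first by have [] := field_of_le 0 mr K0 iom le.
by move=> x; have [_] := field_of_le x mr K0 iom le.
Qed.

(** The field generated by a transported density satisfies the same bounds as
    the field that transported it, so the iteration can go on. *)
Lemma next_field E f ft fx fv : trans E f ft fx fv ->
  field_ok K M om (fun t x => efield F f (clamp d t) x)
    (fun t x => dens f (clamp d t) x).
Proof.
move=> T; have [C1 _ eqn _ _] := T; have [cf _ _ _ _] := C1 d.
have cl t : 0 <= clamp d t <= d by apply: clamp_itv; exact: ltW.
have cd : cont3 (fun t x v => F v - f t x v).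
  move=> z; apply: cvgB; last exact: cf.
  by apply: (@cvg_comp _ _ _ snd F); [exact: cvg_snd|exact: cF].
have Er t : rho F f (clamp d t) = dens f (clamp d t).
  by apply/funext => x; have [] := transported_density x T (cl t).
have DE t x : is_derive x 1 (efield F f (clamp d t)) (dens f (clamp d t) x).
  have [cr ir _] := transported_rho T (cl t).
  by rewrite -Er; exact: (field_of_derive x cr ir).
have le t x : `|dens f (clamp d t) x| <= K.
  have [_ le] := transported_density x T (cl t).
  by rewrite (le_trans le) // ler_piMr.
have supp s y v : 0 <= s <= d -> Q <= `|v| -> f s y v = 0.
  by move=> sd; have [] := transported_itv y v T sd.
have bS s y v : 0 <= s <= d -> `|f s y v| <= S.
  by move=> sd; have [] := transported_itv y v T sd.
have irf s : 0 <= s <= d -> mu.-integrable setT (fun x => (rho F f s x)%:E).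
  by move=> sd; have [] := transported_rho T sd.
have lip t s x : `|efield F f (clamp d t) x - efield F f (clamp d s) x| <=
    4 * Q ^+ 2 * S * `|t - s|.
  apply: le_trans (@field_time_lipschitz R F d Q f ft fx fv E S _ _ x cF Q0 F0 (C1 d)
    (fun t x v _ => eqn t x v) supp irf bS (cl s) (cl t)) _.
  rewrite ler_wpM2l ?clamp_lipschitz //.
  by rewrite !mulr_ge0 ?sqr_ge0 // (le_trans (normr_ge0 _) (bS _ 0 0 (cl 0))).
split => //.
- apply/cont2P => t x e e0; pose k := 4 * Q ^+ 2 * S + K + 1.
  have S0 : 0 <= S by rewrite (le_trans (normr_ge0 _) (bS _ 0 0 (cl 0))).
  have QS0 : 0 <= 4 * Q ^+ 2 * S by rewrite !mulr_ge0 ?sqr_ge0.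
  have k0 : 0 < k by rewrite ltr_wpDl // addr_ge0.
  exists (e / k); first by rewrite divr_gt0.
  move=> t' x' ht hx.
  have h1 := lip t' t x'.
  have h2 := lipschitz_of_derive x x' (DE t) (le t).
  have h3 : 4 * Q ^+ 2 * S * `|t' - t| <= 4 * Q ^+ 2 * S * (e / k).
    by rewrite ler_wpM2l // ltW.
  have h4 : K * `|x' - x| <= K * (e / k) by rewrite ler_wpM2l // ltW.
  have h5 : e = (4 * Q ^+ 2 * S) * (e / k) + K * (e / k) + e / k.
    by rewrite -mulrDl -[X in _ + X]mul1r -mulrDl mulrC divfK // gt_eqF.
  apply: (@le_lt_trans _ _ (4 * Q ^+ 2 * S * (e / k) + K * (e / k))).
    apply: le_trans (ler_distD (efield F f (clamp d t) x') _ _) _.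
    exact: lerD (le_trans h1 h3) (le_trans h2 h4).
  by rewrite [ltRHS]h5 ltrDl divr_gt0.
- have ci : cont2 (dens f) := cont2_itg QQ cd.
  apply: (@cont2_comp _ _ (dens f) (fun z => clamp d z.1) snd ci).
    by move=> z; apply: (@cvg_comp _ _ _ fst (clamp d)); [exact: cvg_fst|exact: clamp_continuous].
  by move=> z; exact: cvg_snd.
- by move=> t x; have [_ _] := transported_rho T (cl t); apply.
- by move=> t x; have [] := transported_density x T (cl t).
Qed.

End LocalExistence.

(** * Local existence *)

Section Iteration.
Context {R : realType}.
Implicit Types (d t x v y la : R) (E r : R -> R -> R) (f ft fx fv : R -> R -> R -> R).

Notation mu := (@lebesgue_measure R).
Notation half := (2^-1 : R).

(** transport_stability and field_stability gain a factor 1 / la each, so in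
    the weight exp (la t) two fields come closer by a factor 1 / 2 as soon as
    la^2 >= 8 Q^2 A. *)
Lemma contraction (F : R -> R) (Q S L A : R) (om : R -> R) (f0 : R -> R -> R) d E1 E2
    f ft fx fv (g gt gx gv : R -> R -> R -> R) (M N : R) t :
  continuous F -> 0 <= Q -> (forall v, Q < `|v| -> F v = 0) -> 0 <= A -> 0 < d -> d <= 1 ->
  transported Q S L A om f0 E1 f ft fx fv -> transported Q S L A om f0 E2 g gt gx gv ->
  (forall t, 0 <= t <= d -> mu.-integrable setT (fun x => (rho F f t x)%:E)) ->
  (forall t, 0 <= t <= d -> mu.-integrable setT (fun x => (rho F g t x)%:E)) ->
  (forall t x, `|E2 t x| <= M) -> 0 <= N ->
  (forall t x, 0 <= t <= d -> `|E1 t x - E2 t x| <= N * expR ((1 + 8 * Q ^+ 2 * A) * t)) ->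
  0 <= t <= d ->
  (forall x v, `|f t x v - g t x v| <= A * N * expR ((1 + 8 * Q ^+ 2 * A) * t)) /\
  (forall x, `|efield F f t x - efield F g t x| <= half * N * expR ((1 + 8 * Q ^+ 2 * A) * t)).
Proof.
move=> cF Q0 F0 A0 d0 d1 Tf Tg irf irg bE N0 bN td.
have [Cf _ ef inif Hf] := Tf; have [Cg _ eg inig Hg] := Tg.
have QA : 0 <= 8 * Q ^+ 2 * A by rewrite !mulr_ge0 ?sqr_ge0.
set la := 1 + _ in bN *.
have la1 : 1 <= la by rewrite lerDl.
have la0 : 0 < la by apply: lt_le_trans la1.
have itv s : 0 <= s <= d -> 0 <= s <= 1.
  by move=> /andP[-> sd]; exact: le_trans sd d1.
have ini x v : f 0 x v = g 0 x v by rewrite inif inig.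
have bfv s x v : 0 <= s <= d -> `|fv s x v| <= A.
  by move=> /itv sd; have [] := Hf s x v sd.
have B0 : 0 <= A / la * N by rewrite mulr_ge0 // divr_ge0 // ltW.
have stab s x v : 0 <= s <= d -> `|f s x v - g s x v| <= A / la * N * expR (la * s).
  move=> sd; apply: (@transport_stability R d f ft fx fv g gt gx gv E1 E2 M A N la s x v
    (Cf d) (Cg d) _ _ ini _ bfv bN la0 N0 sd).
  - by move=> *; exact: ef.
  - by move=> *; exact: eg.
  - by move=> *; exact: bE.
split=> [x v|x].
  rewrite (le_trans (stab t x v td)) // ler_wpM2r ?expR_ge0 // ler_wpM2r //.
  by rewrite ler_pdivrMr // ler_peMr.
have sf s y v : 0 <= s <= d -> Q <= `|v| -> f s y v = 0.
  by move=> /itv sd; have [] := Hf s y v sd.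
have sg s y v : 0 <= s <= d -> Q <= `|v| -> g s y v = 0.
  by move=> /itv sd; have [] := Hg s y v sd.
apply: le_trans (field_stability x cF Q0 F0 (Cf d) (Cg d) (fun t x v _ => ef t x v)
  (fun t x v _ => eg t x v) sf sg ini irf irg la0 B0 stab td) _.
rewrite ler_wpM2r ?expR_ge0 //.
have -> : 4 * Q ^+ 2 / la * (A / la * N) = (8 * Q ^+ 2 * A) / (la * la) * (half * N).
  by field; rewrite gt_eqF.
rewrite ler_piMl ?mulr_ge0 // ler_pdivrMr ?mulr_gt0 // mul1r.
apply: (@le_trans _ _ la); first by rewrite /la lerDr.
by rewrite ler_peMr // ltW.
Qed.

(** Iterate E |-> field of the density transported by E, starting from E = 0.
    The fields converge uniformly, and so do the densities, which are the
    x-derivatives of the fields; hence the limit E is again continuous with a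
    continuous x-derivative and transports a classical solution. Being a fixed
    point of the iteration, E is the field of that solution. *)
Theorem local_existence (p : R) (F : R -> R) (f0 gx gv : R -> R -> R) (P S b0 a0 N0 : R) :
  1 < p -> continuous F -> (forall v, P < `|v| -> F v = 0) ->
  cont2 f0 -> cont2 gx -> cont2 gv ->
  (forall x v, is_derive x 1 (f0^~ v) (gx x v)) ->
  (forall x v, is_derive v 1 (f0 x) (gv x v)) ->
  (forall x v, `|f0 x v| <= S) -> (forall x v, P < `|v| -> f0 x v = 0) ->
  (forall x v, `|gx x v| <= b0 * decay p x) -> (forall x v, `|gv x v| <= a0) ->
  0 <= P -> 0 <= b0 -> 0 <= N0 ->
  (forall x, `|\int[mu]_v (F v - f0 x v)| <= N0 * decay p x) ->
  exists (d : R) (Q L A K M : R) E f ft fx fv,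
    [/\ [/\ 0 < d, d <= 1, 0 <= Q & forall v, Q < `|v| -> F v = 0],
      transported Q S L A (decay p) f0 E f ft fx fv,
      forall t x, `|E t x| <= M,
      forall t, 0 <= t <= d -> mu.-integrable setT (fun x => (rho F f t x)%:E) /\
        forall x, `|rho F f t x| <= K * decay p x &
      forall t x, 0 <= t <= d -> E t x = efield F f t x].
Proof.
move=> p1 cF F0 cf0 cgx cgv Dgx Dgv bf0 suppf0 bgx bgv P0 b00 N00 init.
have p0 : 0 <= p by apply: le_trans (ltW p1).
pose om := decay p.
have om_gt0 x : 0 < om x := decay_gt0 p x.
have om_le1 x : om x <= 1 := decay_le1 x p0.
have iom : mu.-integrable setT (EFin \o om) := decay_integrable p1.
pose K := N0 + 1; pose M := K * mass om.
have K0 : 0 <= K by rewrite addr_ge0.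
have M0 : 0 <= M.
  by rewrite mulr_ge0 // /mass; apply: Rintegral_ge0 => x _; exact: ltW.
(* the force is at most M and times at most 1, so Q bounds all velocities *)
pose Q := P + M + 1; pose c0 := (1 + (P + 2 * M)) `^ p.
have PQ : P + M < Q by rewrite ltrDl.
have Q0 : 0 <= Q by rewrite !addr_ge0.
have a00 : 0 <= a0 := le_trans (normr_ge0 _) (bgv 0 0).
pose L := c0 * (b0 + a0 * K) * growth K 1; pose A := (b0 + a0) * growth K 1.
have G0 : 0 <= growth K 1 := growth_ge0 K 1.
have c00 : 0 <= c0 := powR_ge0 _ _.
have L0 : 0 <= L by rewrite mulr_ge0 // mulr_ge0 // addr_ge0 // mulr_ge0.
have A0 : 0 <= A by rewrite mulr_ge0 // addr_ge0.
have FQ v : Q < `|v| -> F v = 0.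
  move=> vQ; apply: F0; apply: le_lt_trans vQ; apply: le_trans (ltW PQ).
  by rewrite lerDl.
pose k := 2 * Q ^+ 2 * L.
have k0 : 0 <= k by rewrite mulr_ge0 // mulr_ge0 // sqr_ge0.
(* so short that the weighted density bound grows by at most 1 *)
pose d := (k + 1)^-1.
have k1 : 0 < k + 1 by rewrite ltr_wpDl.
have d0 : 0 < d by rewrite invr_gt0.
have d1 : d <= 1 by rewrite invf_le1 // lerDr.
have small_d : 2 * Q ^+ 2 * L * d <= 1.
  by rewrite -/k /d ler_pdivrMr // mul1r lerDl.
have initQ x : `|itg (- Q) Q (fun v => F v - f0 x v)| <= N0 * om x.
  rewrite -(@Rintegral_support R Q (fun v => F v - f0 x v)) //.
  move=> v vQ; rewrite FQ // suppf0 ?subrr //.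
  apply: le_lt_trans vQ; apply: le_trans (ltW PQ); by rewrite lerDl.
have omc x y : `|y - x| <= P + 2 * M -> om y <= c0 * om x.
  by move=> xy; exact: decay_shift.
have solve E r : field_ok K M om E r ->
    exists f ft fx fv, transported Q S L A om f0 E f ft fx fv.
  move=> [cE cr DE bE br].
  have [f [ft [fx [fv [C1 Dt eqn ini H]]]]] := transport_exists cE cr DE bE br
    (fun x => ltW (om_gt0 x)) om_le1 K0 cf0 cgx cgv Dgx Dgv bf0 suppf0 bgx bgv
    b00 c00 omc.
  exists f, ft, fx, fv; split => // t x v t01; have [h1 h2 h3 h4] := H t x v t01.
  by split => // vQ; apply: h2; exact: lt_le_trans vQ.
have /choice[T HT] : forall E, exists f, (exists r, field_ok K M om E r) ->
    exists ft fx fv, transported Q S L A om f0 E f ft fx fv.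
  move=> E; have [[r ok]|no] := pselect (exists r, field_ok K M om E r).
    by have [f H] := solve E r ok; exists f.
  by exists (fun _ _ _ => 0) => /no.
pose Phi E := fun t x => efield F (T E) (clamp d t) x.
pose dens E := fun t x => itg (- Q) Q (fun v => F v - T E (clamp d t) x v).
have cl t : 0 <= clamp d t <= d by apply: clamp_itv; exact: ltW.
have next E r : field_ok K M om E r -> field_ok K M om (Phi E) (dens E).
  move=> ok; have [ft [fx [fv Tf]]] := HT E (ex_intro _ r ok).
  exact: (next_field om_gt0 om_le1 iom cF Q0 FQ L0 N00 d0 d1 small_d initQ Tf).
have rhoT E r t : field_ok K M om E r -> 0 <= t <= d ->
    [/\ mu.-integrable setT (fun x => (rho F (T E) t x)%:E),
      forall x, rho F (T E) t x = itg (- Q) Q (fun v => F v - T E t x v) &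
      forall x, `|rho F (T E) t x| <= K * om x].
  move=> ok td; have [ft [fx [fv Tf]]] := HT E (ex_intro _ r ok).
  have H x := transported_density om_gt0 cF Q0 FQ L0 d1 small_d initQ x Tf td.
  split.
  - by have [] := transported_rho om_gt0 iom cF Q0 FQ L0 N00 d1 small_d initQ Tf td.
  - by move=> x; have [] := H x.
  - by move=> x; have [-> ] := H x.
pose la := 1 + 8 * Q ^+ 2 * A.
have contr E1 r1 E2 r2 N t : field_ok K M om E1 r1 -> field_ok K M om E2 r2 -> 0 <= N ->
    (forall t x, 0 <= t <= d -> `|E1 t x - E2 t x| <= N * expR (la * t)) -> 0 <= t <= d ->
    (forall x v, `|T E1 t x v - T E2 t x v| <= A * N * expR (la * t)) /\
    (forall x, `|efield F (T E1) t x - efield F (T E2) t x| <= half * N * expR (la * t)).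
  move=> ok1 ok2 N0' bN td.
  have [ft [fx [fv Tf]]] := HT E1 (ex_intro _ r1 ok1).
  have [gt' [gx' [gv' Tg]]] := HT E2 (ex_intro _ r2 ok2).
  have [_ _ _ bE2 _] := ok2.
  apply: (contraction cF Q0 FQ A0 d0 d1 Tf Tg _ _ bE2 N0' bN td).
  - by move=> s sd; have [] := rhoT E1 r1 s ok1 sd.
  - by move=> s sd; have [] := rhoT E2 r2 s ok2 sd.
pose En n := iter n Phi (fun _ _ => 0).
(* rn n is the x-derivative of En n; the bound on consecutive differences
   starts at rank 1, the zero function rn 0 not being a density *)
pose rn n := if n is n'.+1 then dens (En n') else fun _ _ => 0.
have ok n : field_ok K M om (En n) (rn n).
  elim: n => [|n IH]; last exact: next IH.
  split => [z|z|t x|t x|t x] /=; [exact: cvg_cst|exact: cvg_cst| |by rewrite normr0|].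
    exact: is_derive_cst.
  by rewrite normr0 mulr_ge0 // ltW.
have la0 : 0 <= la.
  by rewrite /la addr_ge0 // (mulr_ge0 _ A0) // (mulr_ge0 _ (sqr_ge0 Q)).
have exp_ge1 t : 0 <= t -> 1 <= expR (la * t).
  by move=> t0; rewrite -expR0 ler_expR mulr_ge0.
have step n t x : 0 <= t <= d -> `|En n.+1 t x - En n t x| <= M * half ^+ n * expR (la * t).
  elim: n t x => [|n IH] t x td.
    rewrite expr0 mulr1 subr0; have [_ _ _ bE _] := ok 1%N.
    by rewrite (le_trans (bE t x)) // ler_peMr // exp_ge1 //; case/andP: td.
  have N0' : 0 <= M * half ^+ n by rewrite mulr_ge0 // ?exprn_ge0.
  have [_ H] := contr _ _ _ _ _ t (ok n.+1) (ok n) N0' IH td.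
  have -> : M * half ^+ n.+1 = half * (M * half ^+ n) by rewrite exprS; ring.
  by have := H x; rewrite /= /Phi clamp_id.
pose B := M * expR (la * d).
have exp_le t : 0 <= t <= d -> expR (la * t) <= expR (la * d).
  by move=> /andP[_ td]; rewrite ler_expR ler_wpM2l.
have Eclamp n t x : En n t x = En n (clamp d t) x.
  by case: n => [//|n]; rewrite /= /Phi (clamp_id (cl t)).
have stepE n t x : `|En n.+1 t x - En n t x| <= B * half ^+ n.
  rewrite (Eclamp n.+1) (Eclamp n) (le_trans (step n _ x (cl t))) // /B mulrAC.
  by rewrite ler_wpM2r ?exprn_ge0 // ler_wpM2l // exp_le.
pose B' := 2 * Q * (A * B).
have stepr n t x : `|rn n.+2 t x - rn n.+1 t x| <= B' * half ^+ n.
  have N0' : 0 <= M * half ^+ n by rewrite mulr_ge0 // ?exprn_ge0.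
  have [H _] := contr _ _ _ _ _ _ (ok n.+1) (ok n) N0' (step n) (cl t).
  have [ft [fx [fv [C1 _ _ _ _]]]] := HT _ (ex_intro _ _ (ok n.+1)).
  have [gt' [gx' [gv' [C1' _ _ _ _]]]] := HT _ (ex_intro _ _ (ok n)).
  have [cf _ _ _ _] := C1 d; have [cg _ _ _ _] := C1' d.
  have c1 : continuous (T (En n.+1) (clamp d t) x) := cont3_v cf.
  have c2 : continuous (T (En n) (clamp d t) x) := cont3_v cg.
  have -> : rn n.+2 t x - rn n.+1 t x = itg (- Q) Q (fun v =>
      T (En n) (clamp d t) x v - T (En n.+1) (clamp d t) x v).
    by rewrite /rn /dens !itgB //; ring.
  have -> : B' * half ^+ n = A * (M * half ^+ n) * expR (la * d) * (Q - - Q).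
    by rewrite /B' /B; ring.
  apply: itg_norm_le.
  - by rewrite (le_trans _ Q0) // oppr_le0.
  - by move=> v; apply: cvgB; [exact: c2|exact: c1].
  - move=> v _; rewrite distrC (le_trans (H x v)) // ler_wpM2l ?exp_le //.
    by rewrite mulr_ge0.
have /choice[Einf HE] : forall z : R * R, exists l, forall n,
    `|En n z.1 z.2 - l| <= 2 * B * half ^+ n.
  by move=> z; apply: geometric_limit => n; exact: stepE.
have /choice[rinf Hr] : forall z : R * R, exists l, forall n,
    `|rn n.+1 z.1 z.2 - l| <= 2 * B' * half ^+ n.
  by move=> z; apply: (@geometric_limit R (fun n => rn n.+1 z.1 z.2)) => n; exact: stepr.
pose E t x := Einf (t, x); pose r t x := rinf (t, x).
have HE1 n t x : `|En n.+1 t x - E t x| <= 2 * B * half ^+ n.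
  apply: le_trans (HE (t, x) n.+1) _; rewrite exprS.
  have : 0 <= 2 * B * half ^+ n by apply: le_trans (HE (t, x) n).
  by move=> h; rewrite mulrCA ler_piMl // invf_le1 // ler1n.
have okE : field_ok K M om E r.
  split.
  - apply: (@geometric_limit_continuous R _ (fun n z => En n z.1 z.2) _ (fun=> 1) (2 * B)).
    + by move=> n; have [] := ok n.
    + by move=> z; exact: cvg_cst.
    + by move=> n z; rewrite mulr1; have := HE z n; case: z.
  - apply: (@geometric_limit_continuous R _ (fun n z => rn n.+1 z.1 z.2) _ (fun=> 1) (2 * B')).
    + by move=> n; have [] := ok n.+1.
    + by move=> z; exact: cvg_cst.
    + by move=> n z; rewrite mulr1; have := Hr z n; case: z.
  - move=> t x; apply: (@limit_derive R (fun n => En n.+1 t) (fun n => rn n.+1 t)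
      (E t) (r t) (2 * B) (2 * B')).
    + by move=> n y; have [_ _ D _ _] := ok n.+1; exact: D.
    + by move=> n y; exact: HE1.
    + by move=> n y; exact: (Hr (t, y) n).
    + have : cont2 r.
        apply: (@geometric_limit_continuous R _ (fun n z => rn n.+1 z.1 z.2) _ (fun=> 1) (2 * B')).
        * by move=> n; have [] := ok n.+1.
        * by move=> z; exact: cvg_cst.
        * by move=> n z; rewrite mulr1; have := Hr z n; case: z.
      exact: cont2_snd.
  - move=> t x; rewrite -subr_le0; apply: (@geometric_le0 R (2 * B)) => n.
    have [_ _ _ bE _] := ok n; rewrite lerBlDr -lerBlDl.
    apply: le_trans (bE t x); rewrite lerBlDr.
    have h := HE (t, x) n; rewrite -lerBlDl; apply: le_trans h.
    by rewrite distrC; exact: lerB_dist.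
  - move=> t x; rewrite -subr_le0; apply: (@geometric_le0 R (2 * B')) => n.
    have [_ _ _ _ bE] := ok n.+1; rewrite lerBlDr -lerBlDl.
    apply: le_trans (bE t x); rewrite lerBlDr.
    have h := Hr (t, x) n; rewrite -lerBlDl; apply: le_trans h.
    by rewrite distrC; exact: lerB_dist.
have [ft [fx [fv Tf]]] := HT E (ex_intro _ r okE).
exists d, Q, L, A, K, M, E, (T E), ft, fx, fv; split => //.
- by have [_ _ _ bE _] := okE.
- by move=> t td; have [] := rhoT E r t okE td.
move=> t x td; apply/eqP; rewrite -subr_eq0 -normr_le0.
apply: (@geometric_le0 R (2 * B + B * expR (la * d))) => n.
have B0 : 0 <= B by rewrite mulr_ge0 // expR_ge0.
have h0 : 0 <= half ^+ n by rewrite exprn_ge0.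
have N0' : 0 <= 2 * B * half ^+ n.
  by apply: mulr_ge0 => //; apply: mulr_ge0.
have bnd s y : 0 <= s <= d -> `|E s y - En n s y| <= 2 * B * half ^+ n * expR (la * s).
  move=> sd; rewrite distrC (le_trans (HE (s, y) n)) // ler_peMr // exp_ge1 //.
  by case/andP: sd.
have [_ H] := contr _ _ _ _ _ t okE (ok n) N0' bnd td.
have h1 := HE1 n t x.
have -> : E t x - efield F (T E) t x =
  - (En n.+1 t x - E t x) - (efield F (T E) t x - efield F (T (En n)) t x).
  rewrite /= /Phi (clamp_id td).
  by move: (E t x) (efield F (T E) t x) (efield F (T (En n)) t x) => a b c; ring.
rewrite (le_trans (ler_normB _ _)) // normrN mulrDl lerD // (le_trans (H x)) //.
have -> : half * (2 * B * half ^+ n) = B * half ^+ n by field.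
by rewrite mulrAC ler_wpM2r ?exprn_ge0 // ler_wpM2l // exp_le.
Qed.

End Iteration.

(** * The norm and the slab *)

Section Interface.
Context {R : realType}.
Implicit Types (d t s x v y p l : R) (h : R -> R -> R) (f g : R -> R -> R -> R).

Notation mu := (@lebesgue_measure R).

Lemma nonneg_ereal_sup (I : Type) (A : set I) (u : I -> \bar R) :
  A !=set0 -> (forall i, (0 <= u i)%E) -> (0 <= ereal_sup (u @` A))%E.
Proof.
move=> [i Ai] u0; apply: le_trans (u0 i) _.
by apply: ereal_sup_ubound; exists i.
Qed.

Lemma triple_norm_le p h C : (triple_norm p h <= C%:E)%E ->
  [/\ forall x v, `|h x v| <= C, forall x v, `|dv h x v| <= C,
      forall x v, `|dx h x v| <= C * decay p x &
      forall x, `|fine (int_v h x)| <= C * decay p x].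
Proof.
pose a := sup_norm h; pose b := sup_norm (dv h).
pose c := wnorm2 p (dx h); pose e := wnorm p (int_v h).
have a0 : (0 <= a)%E.
  by apply: nonneg_ereal_sup; [exists (0, 0)|move=> z; rewrite lee_fin].
have b0 : (0 <= b)%E.
  by apply: nonneg_ereal_sup; [exists (0, 0)|move=> z; rewrite lee_fin].
have c0 : (0 <= c)%E.
  apply: nonneg_ereal_sup; [by exists (0, 0)|move=> z].
  by rewrite lee_fin mulr_ge0 // powR_ge0.
have e0 : (0 <= e)%E.
  apply: nonneg_ereal_sup; [by exists 0|move=> z].
  by rewrite mule_ge0 // lee_fin powR_ge0.
rewrite /triple_norm -/a -/b -/c -/e => le.
have la : (a <= C%:E)%E.
  by apply: le_trans le; rewrite -!addeA leeDl // !adde_ge0.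
have lb : (b <= C%:E)%E.
  by apply: le_trans le; rewrite -!addeA addeCA leeDl // !adde_ge0.
have lc : (c <= C%:E)%E.
  apply: le_trans le; rewrite -addeA (addeC _ (c + e)%E) -addeA leeDl // !adde_ge0 //.
have le' : (e <= C%:E)%E.
  by apply: le_trans le; rewrite addeC leeDl // !adde_ge0.
split=> [x v|x v|x v|x].
- rewrite -lee_fin; apply: le_trans la; apply: ereal_sup_ubound.
  by exists (x, v).
- rewrite -lee_fin; apply: le_trans lb; apply: ereal_sup_ubound.
  by exists (x, v).
- apply/le_decay; rewrite -lee_fin; apply: le_trans lc; apply: ereal_sup_ubound.
  by exists (x, v).
- apply/le_decay; have : (`|int_v h x| * (weight x `^ p)%:E <= C%:E)%E.
    by apply: le_trans le'; apply: ereal_sup_ubound; exists x.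
  have w0 : 0 < weight x `^ p by rewrite powR_gt0 // weight_gt0.
  case: (int_v h x) => [r||] /=.
  - by rewrite -EFinM lee_fin.
  - by rewrite gt0_mulye ?lte_fin // leye_eq.
  - by rewrite gt0_mulye ?lte_fin // leye_eq.
Qed.

Lemma triple_norm_ge p h a b c e :
  (forall x v, `|h x v| <= a) -> (forall x v, `|dv h x v| <= b) ->
  (forall x v, `|dx h x v| <= c * decay p x) ->
  (forall x, int_v h x = (fine (int_v h x))%:E) ->
  (forall x, `|fine (int_v h x)| <= e * decay p x) ->
  (triple_norm p h <= (a + b + c + e)%:E)%E.
Proof.
move=> ha hb hc fin he; rewrite /triple_norm !EFinD; apply: leeD; [apply: leeD; [apply: leeD|]|].
- by apply: ge_ereal_sup => _ [z _ <-]; rewrite lee_fin.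
- by apply: ge_ereal_sup => _ [z _ <-]; rewrite lee_fin.
- by apply: ge_ereal_sup => _ [z _ <-]; rewrite lee_fin; apply/le_decay.
- apply: ge_ereal_sup => _ [x _ <-]; rewrite fin /= -EFinM lee_fin.
  by apply/le_decay.
Qed.

Definition slab d : set (R * R * R) := [set z | z.1.1 \in `[0, d]].

(** Clamping the time is a continuous retraction onto the slab. *)
Lemma within_slab_cont3 d f : 0 <= d ->
  {within slab d, continuous (fun z => f z.1.1 z.1.2 z.2)} ->
  cont3 (fun t => f (clamp d t)).
Proof.
move=> d0 /subspace_continuousP cf z.
pose c (z : R * R * R) := (clamp d z.1.1, z.1.2, z.2).
have inslab w : slab d (c w) by rewrite /slab /c /= in_itv /=; exact: clamp_itv.
have [ct cx cv] := @cont3_proj R.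
have cc : continuous c.
  have cct : continuous (fun w : R * R * R => clamp d w.1.1).
    by move=> w; apply: (@cvg_comp _ _ _ (fun w : R * R * R => w.1.1) (clamp d));
      [exact: ct|exact: clamp_continuous].
  by move=> w; exact: (cvg_pair (cvg_pair (cct w) (cx w)) (cv w)).
apply: (@cvg_comp _ _ _ c (fun z => f z.1.1 z.1.2 z.2) _
  (within (slab d) (nbhs (c z)))); last exact: cf.
move=> B /= HB; have := cc z _ HB; rewrite /nbhs /=.
by apply: filterS => w; apply.
Qed.

Lemma cont3_within_slab d f (g : R * R * R -> R) : cont3 f ->
  (forall z, slab d z -> g z = f z.1.1 z.1.2 z.2) -> {within slab d, continuous g}.
Proof.
move=> cf E.
have : {within slab d, continuous (fun z : R * R * R => f z.1.1 z.1.2 z.2)}.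
  exact: continuous_subspaceT.
by apply: subspace_eq_continuous => z /set_mem zs; exact/esym/E.
Qed.

Lemma within_punctured_proper d t : 0 < d -> 0 <= t <= d ->
  ProperFilter (within `[0, d] t^').
Proof.
move=> d0 /andP[t0 td]; apply: Build_ProperFilter_ex => B.
rewrite /within /dnbhs /= => -[e /= e0 He].
have [tl|tl] := ltP t d.
  pose h := Num.min (e / 2) (d - t).
  have h0 : 0 < h by rewrite lt_min divr_gt0 // subr_gt0.
  have he : h < e by apply: (@le_lt_trans _ _ (e / 2)); [rewrite ge_min lexx|lra].
  have hd : h <= d - t by rewrite ge_min lexx orbT.
  exists (t + h); apply: (He (t + h)) => /=.
  - by rewrite opprD addrA subrr sub0r normrN gtr0_norm.
  - by rewrite gt_eqF // ltrDl.
  - by rewrite in_itv /=; apply/andP; split; lra.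
pose h := Num.min (e / 2) d.
have h0 : 0 < h by rewrite lt_min divr_gt0.
have he : h < e by apply: (@le_lt_trans _ _ (e / 2)); [rewrite ge_min lexx|lra].
have hd : h <= d by rewrite ge_min lexx orbT.
exists (t - h); apply: (He (t - h)) => /=.
- by rewrite opprB addrCA subrr addr0 gtr0_norm.
- by rewrite lt_eqF // ltrBlDr ltrDl.
- by rewrite in_itv /=; apply/andP; split; lra.
Qed.

Lemma derive_in_of_is_derive d (g : R -> R) t l : 0 < d -> 0 <= t <= d ->
  is_derive t 1 g l -> derivable_in `[0, d] g t /\ derive_in `[0, d] g t = l.
Proof.
move=> d0 td /is_derive_slopeP H.
have PF := within_punctured_proper d0 td.
have cl : diff_quot g t @ within `[0, d] t^' --> l.
  apply/cvgrPdist_le => e e0; have [r r0 Hr] := H e e0.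
  rewrite /prop_near1 /= /nbhs /= /within /dnbhs /=.
  exists r => // s /= ts st _; rewrite /diff_quot.
  have st0 : s - t != 0 by rewrite subr_eq0.
  have ts' : `|s - t| < r by rewrite distrC.
  have le := Hr s ts'.
  rewrite -(@ler_pM2r _ `|s - t|) ?normr_gt0 // -normrM.
  have -> : (l - (g s - g t) / (s - t)) * (s - t) = - (g s - g t - l * (s - t)) by field.
  by rewrite normrN.
split; first by apply/cvg_ex; exists l.
exact/cvg_lim.
Qed.

Lemma is_derive_of_derivable_in d (g : R -> R) t : 0 < t < d ->
  derivable_in `[0, d] g t -> is_derive t 1 g (derive_in `[0, d] g t).
Proof.
move=> td; rewrite /derivable_in /derive_in => cl; apply/is_derive_slopeP => e e0.
have /cvgrPdist_le/(_ e e0) := cl.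
rewrite /prop_near1 /= /nbhs /= /within /dnbhs /= => -[r /= r0 Hr].
exists (Num.min r (Num.min t (d - t))).
  by rewrite !lt_min r0; case/andP: td => -> ?; rewrite subr_gt0.
move=> s; rewrite !lt_min => /andP[s1 /andP[s2 s3]].
have [->|st] := eqVneq s t; first by rewrite !subrr mulr0 subrr normr0 mulr0.
have sd : s \in `[0, d].
  by move: s2 s3; rewrite !ltr_norml in_itv /= => /andP[? ?] /andP[? ?]; apply/andP; split; lra.
have := Hr s; rewrite /= distrC => /(_ s1 st sd); rewrite /diff_quot.
set l := lim _ => le.
have st0 : s - t != 0 by rewrite subr_eq0.
have -> : g s - g t - l * (s - t) = - ((l - (g s - g t) / (s - t)) * (s - t)) by field.
by rewrite normrN normrM ler_wpM2r.
Qed.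

Lemma derivable_is_derive (g : R -> R) x : derivable g x 1 -> is_derive x 1 g (derive1 g x).
Proof. by move=> D; rewrite derive1E; exact: derivableP. Qed.

Lemma is_derive_derive1 (g : R -> R) x l : is_derive x 1 g l -> derive1 g x = l.
Proof. by move=> [_ <-]; rewrite derive1E. Qed.

(** In the open interval the one-sided derivative relative to [0, d] is the
    ordinary one, and clamping does not change it. *)
Lemma C1_slab_C1on d f : 0 <= d -> C1_slab d f ->
  C1on d (fun t => f (clamp d t)) (fun t => dt d f (clamp d t))
    (fun t => dx (f (clamp d t))) (fun t => dv (f (clamp d t))).
Proof.
move=> d0 [D cf cft cfx cfv].
have cl t : clamp d t \in `[0, d] by rewrite in_itv /=; exact: clamp_itv.
split.
- exact: within_slab_cont3 d0 cf.
- exact: within_slab_cont3 d0 cft.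
- exact: (@within_slab_cont3 d (fun t => dx (f t)) d0 cfx).
- exact: (@within_slab_cont3 d (fun t => dv (f t)) d0 cfv).
split=> [t x v td|t x v|t x v].
- have tin : t \in `[0, d] by rewrite in_itv /=; case/andP: td => /ltW -> /ltW ->.
  have -> : clamp d t = t by apply: clamp_id; rewrite in_itv in tin.
  have [Dt _ _] := D t x v tin.
  have := is_derive_of_derivable_in td Dt; apply: near_eq_is_derive.
  have t0 : 0 < Num.min t (d - t) by case/andP: td => t0 t1; rewrite lt_min t0 subr_gt0.
  apply/nbhs_ballP; exists (Num.min t (d - t)) => // s; rewrite /ball /= lt_min => /andP[s1 s2].
  rewrite clamp_id //; move: s1 s2; rewrite !ltr_norml => /andP[? ?] /andP[? ?].
  by apply/andP; split; lra.
- by have [_ Dx _] := D _ x v (cl t); exact: derivable_is_derive.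
- by have [_ _ Dv] := D _ x v (cl t); exact: derivable_is_derive.
Qed.

Lemma C1on_C1_slab d f ft fx fv : 0 < d -> (forall d, C1on d f ft fx fv) ->
  (forall t x v, is_derive t 1 (fun s => f s x v) (ft t x v)) ->
  C1_slab d f /\ (forall t x v, t \in `[0, d] -> dt d f t x v = ft t x v).
Proof.
move=> d0 C1 Dt; have [cf cft cfx cfv [_ Dx Dv]] := C1 d.
have Ht t x v : t \in `[0, d] -> derivable_in `[0, d] (fun s => f s x v) t /\
    dt d f t x v = ft t x v.
  rewrite in_itv /= => td; exact: derive_in_of_is_derive d0 td (Dt t x v).
split; last by move=> t x v /Ht H; have [] := H x v.
split.
- move=> t x v td; split; first by have [] := Ht t x v td.
    by have [] := Dx t x v.
  by have [] := Dv t x v.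
- exact: (@cont3_within_slab d f _ cf).
- by apply: (@cont3_within_slab d ft _ cft) => z zd; have [] := Ht z.1.1 z.1.2 z.2 zd.
- apply: (@cont3_within_slab d fx _ cfx) => z _; exact: is_derive_derive1 (Dx _ _ _).
- apply: (@cont3_within_slab d fv _ cfv) => z _; exact: is_derive_derive1 (Dv _ _ _).
Qed.

End Interface.

(** * The initial data *)

Section InitialData.
Context {R : realType}.
Implicit Types (d t s x v y p l : R) (h : R -> R -> R) (f g : R -> R -> R -> R).

Notation mu := (@lebesgue_measure R).
Notation half := (2^-1 : R).

Lemma C3_bounded (F : R -> R) (W : R) : C3 F -> (forall v, W < `|v| -> F v = 0) ->
  [/\ forall v, is_derive v 1 F (derive1 F v), continuous F &
    exists B : R, forall v, `|F v| <= B /\ `|derive1 F v| <= B].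
Proof.
move=> [D3 _] F0.
have D0 v : is_derive v 1 F (derive1 F v).
  exact: derivable_is_derive (D3 0%N v isT).
have cF := is_derive_continuousT D0.
have D1 v : is_derive v 1 (derive1 F) (derive1 (derive1 F) v).
  exact: derivable_is_derive (D3 1%N v isT).
have cF1 := is_derive_continuousT D1.
have F10 v : W < `|v| -> derive1 F v = 0 by exact: is_derive_vanish (D0 v) F0.
have bnd (g : R -> R) : continuous g -> (forall v, W < `|v| -> g v = 0) ->
    exists B : R, 0 <= B /\ forall v, `|g v| <= B.
  move=> cg g0; pose V := Num.max W 0.
  have VV : - V <= V by rewrite ge0_cp // le_max lexx orbT.
  have cn : {within `[- V, V], continuous (fun v => `|g v|)}.
    by apply: continuous_subspaceT => v; apply: cvg_norm; exact: cg.
  have [c _ Hc] := EVT_max VV cn.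
  exists `|g c|; split => // v; have [vV|vV] := leP `|v| V.
    by apply: Hc; rewrite in_itv /= -ler_norml.
  by rewrite g0 ?normr0 //; apply: le_lt_trans vV; rewrite le_max lexx.
have [B1 [B10 H1]] := bnd F cF F0; have [B2 [B20 H2]] := bnd _ cF1 F10.
split => //; exists (B1 + B2) => v; split.
  by rewrite (le_trans (H1 v)) // lerDl.
by rewrite (le_trans (H2 v)) // lerDr.
Qed.

Lemma dv_difference (F : R -> R) h x v : derivable F v 1 -> derivable (h x) v 1 ->
  dv (fun x v => F v - h x v) x v = derive1 F v - dv h x v.
Proof.
by move=> DF Dh; rewrite /dv !derive1E; exact: deriveB.
Qed.

Lemma dx_difference (F : R -> R) h x v : derivable (h^~ v) x 1 ->
  dx (fun x v => F v - h x v) x v = - dx h x v.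
Proof.
move=> Dh; rewrite /dx !derive1E; have := @deriveB R R R (cst (F v)) (h^~ v) x 1 _ Dh.
by rewrite derive_cst sub0r; apply; exact: derivable_cst.
Qed.

End InitialData.

(** * Uniqueness *)

Section Uniqueness.
Context {R : realType}.
Implicit Types (d t s x v y p l : R).

Notation mu := (@lebesgue_measure R).
Notation half := (2^-1 : R).

(** Both solutions have bounded velocities by transport_support, for which the
    fields only need to be bounded. Then the two stability estimates improve
    the bound on f - g in the weight exp (la t) by a factor 1 / 2, and this can
    be repeated. *)
Lemma vlasov_poisson_unique (F : R -> R) d P Q A M1 M2 B (f ft fx fv g gt gx gv : R -> R -> R -> R)
    (E1 E2 : R -> R -> R) :
  continuous F -> 0 <= d -> 0 <= Q -> (forall v, Q < `|v| -> F v = 0) ->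
  C1on d f ft fx fv -> C1on d g gt gx gv ->
  (forall t x, 0 <= t <= d -> E1 t x = efield F f t x) ->
  (forall t x, 0 <= t <= d -> E2 t x = efield F g t x) ->
  (forall t x v, 0 < t < d -> ft t x v + v * fx t x v - E1 t x * fv t x v = 0) ->
  (forall t x v, 0 < t < d -> gt t x v + v * gx t x v - E2 t x * gv t x v = 0) ->
  (forall x v, f 0 x v = g 0 x v) -> (forall x v, P < `|v| -> f 0 x v = 0) ->
  (forall t x, 0 <= t <= d -> `|E1 t x| <= M1) ->
  (forall t x, 0 <= t <= d -> `|E2 t x| <= M2) ->
  (forall t, 0 <= t <= d -> mu.-integrable setT (fun x => (rho F f t x)%:E)) ->
  (forall t, 0 <= t <= d -> mu.-integrable setT (fun x => (rho F g t x)%:E)) ->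
  (forall t x v, 0 <= t <= d -> `|fv t x v| <= A) ->
  (forall t x v, 0 <= t <= d -> `|f t x v - g t x v| <= B) ->
  forall t x v, 0 <= t <= d -> g t x v = f t x v.
Proof.
move=> cF d0 Q0 F0 Cf Cg E1f E2g ef eg ini supp bE1 bE2 irf irg bfv bfg t x v td.
have zd : 0 <= (0 : R) <= d by apply/andP.
have M10 : 0 <= M1 := le_trans (normr_ge0 _) (bE1 0 0 zd).
have M20 : 0 <= M2 := le_trans (normr_ge0 _) (bE2 0 0 zd).
have A0 : 0 <= A := le_trans (normr_ge0 _) (bfv 0 0 0 zd).
have B0 : 0 <= B := le_trans (normr_ge0 _) (bfg 0 0 0 zd).
pose V := Num.max Q (Num.max (P + M1 * d) (P + M2 * d)) + 1.
have QV : Q < V by rewrite /V ltr_pwDr // le_max lexx.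
have V0 : 0 <= V by rewrite ltW // (le_lt_trans Q0).
have V1 : P + M1 * d < V by rewrite /V ltr_pwDr // !le_max lexx orbT.
have V2 : P + M2 * d < V by rewrite /V ltr_pwDr // !le_max lexx !orbT.
have FV u : V < `|u| -> F u = 0 by move=> uV; apply: F0; exact: lt_trans uV.
have sf s y u : 0 <= s <= d -> V <= `|u| -> f s y u = 0.
  move=> sd uV; apply: (@transport_support R d f ft fx fv E1 M1 P s y u Cf M10 bE1 ef supp sd).
  apply: lt_le_trans uV; apply: le_lt_trans V1; rewrite lerD2l ler_wpM2l //.
  by case/andP: sd.
have sg s y u : 0 <= s <= d -> V <= `|u| -> g s y u = 0.
  move=> sd uV; apply: (@transport_support R d g gt gx gv E2 M2 P s y u Cg M20 bE2 eg _ sd).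
    by move=> z w zw; rewrite -ini; exact: supp.
  apply: lt_le_trans uV; apply: le_lt_trans V2; rewrite lerD2l ler_wpM2l //.
  by case/andP: sd.
pose la := 1 + 8 * V ^+ 2 * A.
have la1 : 1 <= la by rewrite /la lerDl (mulr_ge0 _ A0) // (mulr_ge0 _ (sqr_ge0 V)).
have la0 : 0 < la by apply: lt_le_trans la1.
have h0 n : 0 <= half ^+ n by rewrite exprn_ge0.
have step n s y u : 0 <= s <= d ->
    `|f s y u - g s y u| <= B * half ^+ n * expR (la * s).
  elim: n s y u => [|n IH] s y u sd.
    rewrite expr0 mulr1 (le_trans (bfg s y u sd)) // ler_peMr //.
    by rewrite -expR0 ler_expR mulr_ge0 ?(ltW la0) //; case/andP: sd.
  have Bn : 0 <= B * half ^+ n by exact: mulr_ge0.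
  have bE r z : 0 <= r <= d ->
      `|E1 r z - E2 r z| <= 4 * V ^+ 2 / la * (B * half ^+ n) * expR (la * r).
    move=> rd; rewrite E1f // E2g //.
    exact: (field_stability z cF V0 FV Cf Cg ef eg sf sg ini irf irg la0 Bn IH rd).
  have N0 : 0 <= 4 * V ^+ 2 / la * (B * half ^+ n).
    by rewrite (mulr_ge0 _ Bn) // divr_ge0 ?(ltW la0) // mulr_ge0 // sqr_ge0.
  have := @transport_stability R d f ft fx fv g gt gx gv E1 E2 M2 A _ la s y u
    Cf Cg ef eg ini bE2 bfv bE la0 N0 sd.
  move=> le; apply: le_trans le _; rewrite ler_wpM2r ?expR_ge0 //.
  have -> : A / la * (4 * V ^+ 2 / la * (B * half ^+ n)) =
    (8 * V ^+ 2 * A) / (la * la) * (B * half ^+ n.+1).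
    have aux (a w l b q : R) : l != 0 ->
        a / l * (4 * w / l * (b * q)) = (8 * w * a) / (l * l) * (b * (half * q)).
      by move=> l0; field.
    by rewrite (exprS half n) aux ?gt_eqF.
  rewrite ler_piMl //; first exact: mulr_ge0.
  rewrite ler_pdivrMr ?mulr_gt0 // mul1r.
  apply: (@le_trans _ _ la); first by rewrite /la lerDr.
  by rewrite ler_peMr // ltW.
apply/eqP; rewrite eq_sym -subr_eq0 -normr_le0.
apply: (@geometric_le0 R (B * expR (la * t))) => n.
by rewrite mulrAC; exact: step.
Qed.

End Uniqueness.

Unset Implicit Arguments.
Set Strict Implicit.
Set Printing Implicit Defensive.

Theorem theorem1 (R : realType) (p : R) (F : R -> R) (f0 : R -> R -> R)
  (p_gt1 : 1 < p)
  (* A-1 *)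
  (f0_C1 : C1_plane f0)
  (f0_ge0 : forall x v, 0 <= f0 x v)
  (f0_supp : exists P : R, forall x v, P < `|v| -> f0 x v = 0)
  (f0_decay : exists C : R, forall x v,
     `|F v - f0 x v| + `|dv (fun x v => F v - f0 x v) x v|
       <= C * weight x `^ (- p))
  (* A-2 *)
  (F_C3 : C3 F)
  (F_ge0 : forall v, 0 <= F v)
  (F_supp : exists2 W : R, 0 < W & forall v, W < `|v| -> F v = 0)
  (* A-3 *)
  (Ff0_fin : (triple_norm p (fun x v => (F v - f0 x v)%R) < +oo)%E) :
  exists (d : R) (C : R) (f : R -> R -> R -> R),
    [/\ 0 < d,
        C1_slab d f,
        VP_solution F f0 d f,
        forall t, t \in `[0, d] ->
          (triple_norm p (fun x v => (F v - f t x v)%R) <= C%:E)%E &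
        forall h : R -> R -> R -> R,
          C1_slab d h ->
          VP_solution F f0 d h ->
          (exists C' : R, forall t, t \in `[0, d] ->
             (triple_norm p (fun x v => (F v - h t x v)%R) <= C'%:E)%E) ->
          forall t x v, t \in `[0, d] -> h t x v = f t x v].
Proof.
have [W W0 F0] := F_supp; have [P' f0P] := f0_supp.
have [DF cF [B bF]] := C3_bounded F_C3 F0.
have [Df0 cf0 cgx cgv] := f0_C1.
have Dgx (x v : R) : is_derive x 1 (f0^~ v) (dx f0 x v).
  by apply: derivable_is_derive; case: (Df0 x v).
have Dgv (x v : R) : is_derive v 1 (f0 x) (dv f0 x v).
  by apply: derivable_is_derive; case: (Df0 x v).
have [N bN] : exists N : R, (triple_norm p (fun x v => (F v - f0 x v)%R) <= N%:E)%E.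
  case: (triple_norm _ _) Ff0_fin => [r _||]; [by exists r|by []|].
  by exists 0; rewrite leNye.
have [n1 n2 n3 n4] := triple_norm_le bN.
have N0 : 0 <= N := le_trans (normr_ge0 _) (n1 0 0).
pose P := Num.max P' W.
have P0 : 0 <= P by rewrite le_max (ltW W0) orbT.
have FP v : P < `|v| -> F v = 0 by rewrite gt_max => /andP[_]; exact: F0.
have f0P0 x v : P < `|v| -> f0 x v = 0 by rewrite gt_max => /andP[+ _]; exact: f0P.
have bf0 x v : `|f0 x v| <= B + N.
  have -> : f0 x v = F v - (F v - f0 x v) by ring.
  by rewrite (le_trans (ler_normB _ _)) // lerD // (bF v).1.
have bgx x v : `|dx f0 x v| <= N * decay p x.
  by have := n3 x v; rewrite dx_difference ?normrN //; case: (Df0 x v).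
have bgv x v : `|dv f0 x v| <= B + N.
  have := n2 x v; rewrite dv_difference; [|by have [] := DF v|by case: (Df0 x v)].
  move=> le; have -> : dv f0 x v = derive1 F v - (derive1 F v - dv f0 x v) by ring.
  by rewrite (le_trans (ler_normB _ _)) // lerD // (bF v).2.
have [d [Q [L [A [K [M [E [f [ft [fx [fv [[d0 d1 Q0 FQ] T bE Hrho HE]]]]]]]]]]]] :=
  local_existence p_gt1 cF FP cf0 cgx cgv Dgx Dgv bf0 f0P0 bgx bgv P0 N0 N0 n4.
have [C1 Dt eqn ini bnds] := T.
have [Cf Edt] := C1on_C1_slab d0 C1 Dt.
have [cf _ _ _ [_ Dx Dv]] := C1 d.
have itv1 t : 0 <= t <= d -> 0 <= t <= 1.
  by move=> /andP[-> td]; exact: le_trans td d1.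
have iv t x : 0 <= t <= d -> (@lebesgue_measure R).-integrable setT (fun v => (F v - f t x v)%:E).
  move=> td; apply: (@integrable_support R Q (fun v => F v - f t x v)).
    by move=> v; apply: cvgB; [exact: cF|exact: (cont3_v cf)].
  move=> v vQ; rewrite FQ // sub0r.
  by have [_ -> //] := bnds t x v (itv1 t td); [rewrite oppr0|exact: ltW].
exists d, ((B + (B + N)) + (B + A) + L + K), f; split => //.
- split=> [t x|t|t x v|//]; rewrite in_itv /= => td.
  + exact: iv.
  + by have [] := Hrho t td.
  + have -> : dt d f t x v = ft t x v by apply: Edt; rewrite in_itv.
    have -> : dx (f t) x v = fx t x v by exact: is_derive_derive1 (Dx t x v).
    have -> : dv (f t) x v = fv t x v by exact: is_derive_derive1 (Dv t x v).
    by rewrite -HE.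
- move=> t; rewrite in_itv /= => td; have bd x v := bnds t x v (itv1 t td).
  have Ei x : int_v (fun x v => F v - f t x v) x = (rho F f t x)%:E.
    by rewrite /int_v /rho /Rintegral fineK // (integrable_fin_num measurableT (iv t x td)).
  apply: triple_norm_ge.
  + move=> x v; rewrite (le_trans (ler_normB _ _)) // lerD ?(bF v).1 //.
    have [le _ _ _] := bd x v; exact: le.
  + move=> x v; rewrite dv_difference; [|by have [] := DF v|by have [] := Dv t x v].
    rewrite (le_trans (ler_normB _ _)) // lerD ?(bF v).2 //.
    have -> : dv (f t) x v = fv t x v by exact: is_derive_derive1 (Dv t x v).
    by have [] := bd x v.
  + move=> x v; rewrite dx_difference ?normrN; last by have [] := Dx t x v.
    have -> : dx (f t) x v = fx t x v by exact: is_derive_derive1 (Dx t x v).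
    by have [] := bd x v.
  + by move=> x; rewrite Ei.
  + by move=> x; rewrite Ei /=; have [_] := Hrho t td; apply.
move=> h Ch [_ irh eqnh inih] [C' bC'] t x v.
rewrite in_itv /= => td.
have cl s : 0 <= clamp d s <= d by apply: clamp_itv; exact: ltW.
have clin s : clamp d s \in `[0, d] by rewrite in_itv /=; exact: cl.
pose H s := h (clamp d s).
have CH := C1_slab_C1on (ltW d0) Ch.
have nh s : 0 <= s <= d -> [/\ forall x v, `|F v - h s x v| <= C',
    forall x, `|rho F h s x| <= C' * decay p x &
    forall x, `|efield F h s x| <= C' * mass (decay p)].
  move=> sd; have sin : s \in `[0, d] by rewrite in_itv.
  have [h1 _ _ h4] := triple_norm_le (bC' s sin).
  have C'0 : 0 <= C' := le_trans (normr_ge0 _) (h1 0 0).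
  split => // y.
  have mr : measurable_fun setT (rho F h s).
    by have /integrableP[/measurable_EFinP] := irh s sin.
  by have [_] := field_of_le y mr C'0 (decay_integrable p_gt1) h4.
have eqH s y u : 0 < s < d -> dt d h (clamp d s) y u + u * dx (h (clamp d s)) y u -
    efield F h (clamp d s) y * dv (h (clamp d s)) y u = 0.
  by move=> _; exact: eqnh.
have E1 : h t x v = H t x v by rewrite /H clamp_id.
rewrite E1; apply: (@vlasov_poisson_unique R F d P Q A M (C' * mass (decay p)) ((B + N) + (B + C'))
  f ft fx fv H _ _ _ E (fun s => efield F h (clamp d s)) cF (ltW d0) Q0 FQ (C1 d) CH) => //.
- by move=> y u; rewrite /H clamp_id ?inih ?ini // lexx ltW.
- by move=> y u yu; rewrite ini; exact: f0P0.
- by move=> s y sd; have [_ _] := nh _ (cl s); apply.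
- by move=> s sd; have [] := Hrho s sd.
- by move=> s sd; have := irh _ (clin s).
- by move=> s y u sd; have [] := bnds s y u (itv1 s sd).
- move=> s y u sd; rewrite (le_trans (ler_normB _ _)) // lerD //.
    by have [] := bnds s y u (itv1 s sd).
  have -> : H s y u = F u - (F u - h (clamp d s) y u) by rewrite /H; ring.
  rewrite (le_trans (ler_normB _ _)) // lerD ?(bF u).1 //.
  by have [hb _ _] := nh _ (cl s); exact: hb.
Qed.
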